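(* For each $N\in\mathbb N$ let $\varphi_N$ be the diagonal filling, i.e. the bijection $\varphi_N:\{1,\dots,N(N+1)/2\}\to\{(i,j)\in\{1,\dots,N\}^2:i\le j\}$ whose inverse is $$\varphi_N^{-1}(j,k)=\frac{N(N+1)}2-\frac{(N-|j-k|)(N-|j-k|+1)}2+\min(j,k),\qquad 1\le j\le k\le N.$$ Then for all $N\in\mathbb N$, $i,j\in\{1,\dots,N\}$ and all $n\in\mathbb N$ with $n>0$, $$\#\{x\in\{1,\dots,N\}:\|(i,x)-(x,j)\|_{\varphi_N}=n\}\le4.$$ In particular, for every $n\ge1$ this cardinality is $o(N)$ as $N\to\infty$, uniformly in $i,j\in\{1,\dots,N\}$; and for every real-valued stochastic process $(Z_n)_{n\in\mathbb N}$ satisfying the moment conditions (M1), (M2), (M3) stated in the context, the empirical spectral distribution $\mu_N$ of $A_N=\frac1{\sqrt N}X_N$, where $X_N$ is the symmetric matrix generated by $(Z_n)_n$ and $\varphi_N$, converges weakly in probability to the semicircle law $\nu(dx)=\frac1{2\pi}\sqrt{4-x^2}\,\mathbf 1_{|x|\le2}\,dx$.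
   Context: The diagonal filling fills the upper triangle diagonal by diagonal, starting with the main diagonal and always proceeding from top to bottom: $\varphi_N(1)=(1,1),\dots,\varphi_N(N)=(N,N),\varphi_N(N+1)=(1,2),\varphi_N(N+2)=(2,3),\dots$ The symmetric matrix $X_N\in\mathbb R^{N\times N}$ generated by $(Z_n)_n$ and $\varphi_N$ has entries $X_N(i,j)=X_N(j,i)=Z_{\varphi_N^{-1}(i,j)}$ for $1\le i\le j\le N$. Its rescaling $A_N$ has eigenvalues $\lambda_1^{(N)}\le\dots\le\lambda_N^{(N)}$ and $\mu_N=\frac1N\sum_{k=1}^N\delta_{\lambda_k^{(N)}}$. Distance: for $i\le j$, $i'\le j'$ set $\|(i,j)-(i',j')\|_{\varphi_N}:=|\varphi_N^{-1}(i,j)-\varphi_N^{-1}(i',j')|$; if $i>j$ (resp. $i'>j'$), replace $(i,j)$ by $(j,i)$ (resp. $(i',j')$ by $(j',i')$). Moment conditions on $(Z_n)_n$ (all expectations that appear are assumed to exist; convention $0^0=1$): (M1) $\mathbb E(Z_i^2)=1$ for all $i\in\mathbb N$. (M2) For all odd $k$ and all $i_1,\dots,i_k\in\mathbb N$: $\mathbb E(Z_{i_1}Z_{i_2}\cdots Z_{i_k})=0$. (M3) For all even $k$ there are constants $C>0$ and $\beta\in[0,1)$ such that for all $i_1\le i_2\le\dots\le i_k$, with $n_j:=i_{j+1}-i_j$: (a) $|\mathbb E(Z_{i_1}\cdots Z_{i_k})|\le C\beta^{n_1+n_3+\dots+n_{k-1}}$; (b) for all $j_1\le\dots\le j_k$,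 with $d:=\min_{n,m\in\{1,\dots,k\}}|i_n-j_m|$: $|\mathbb E(Z_{i_1}\cdots Z_{i_k}Z_{j_1}\cdots Z_{j_k})-\mathbb E(Z_{i_1}\cdots Z_{i_k})\mathbb E(Z_{j_1}\cdots Z_{j_k})|\le C\beta^d$; (c) with $d':=\min_{j=1,3,5,\dots,k-3}(i_{j+2}-i_j)$: $|\mathbb E(Z_{i_1}^2Z_{i_3}^2\cdots Z_{i_{k-1}}^2)-1|\le C\beta^{d'}$ (for $k=2$ the minimum is empty and (c) is contained in (M1)). Weak convergence in probability means: for every bounded continuous $f:\mathbb R\to\mathbb R$, $\int f\,d\mu_N\to\int f\,d\nu$ in probability. *)

(* Defs.v *)
From HB Require Import structures.
From mathcomp Require Import all_boot all_order all_algebra.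
From mathcomp Require Import all_classical all_reals all_analysis.
From mathcomp Require Import measurable_realfun.

Set Implicit Arguments.
Unset Strict Implicit.
Unset Printing Implicit Defensive.

Import Order.TTheory GRing.Theory Num.Theory.
Import numFieldNormedType.Exports.

Local Open Scope classical_set_scope.
Local Open Scope ring_scope.

(* All indices are 1-based natural numbers: a filling of size N is a function  *)
(* phi : nat -> nat * nat of which only the values at 1, ..., N(N+1)/2 matter. *)
Section filling.
Local Open Scope nat_scope.

Definition absdiff (m n : nat) : nat := absz (m%:Z - n%:Z)%R.

Definition upper_triangle (N : nat) (p : nat * nat) : bool :=
  (1 <= p.1 <= p.2) && (p.2 <= N).

Definition filling_inv (N : nat) (phi : nat -> nat * nat) (p : nat * nat) :
  nat := head 0 [seq n <- iota 1 (N * N.+1)./2 | phi n == p].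

Definition ordered (p : nat * nat) : nat * nat :=
  (minn p.1 p.2, maxn p.1 p.2).

Definition filling_dist (N : nat) (phi : nat -> nat * nat)
    (p q : nat * nat) : nat :=
  absdiff (filling_inv N phi (ordered p)) (filling_inv N phi (ordered q)).

(* (1,1), ..., (N,N), (1,2), (2,3), ..., (N-1,N), (1,3), ..., (1,N) *)
Definition diagonal_filling (N n : nat) : nat * nat :=
  nth (0, 0) [seq (i, i + d) | d <- iota 0 N, i <- iota 1 (N - d)] n.-1.

(* Under 1 <= j <= k <= N both halvings are exact and the subtractions are    *)
(* not truncated.                                                             *)
Definition diagonal_index (N j k : nat) : nat :=
  (N * N.+1)./2 - ((N - absdiff j k) * (N - absdiff j k + 1))./2 + minn j k.

Definition num_at_dist (N : nat) (phi : nat -> nat * nat) (i j n : nat) : nat :=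
  count (fun x => filling_dist N phi (i, x) (x, j) == n) (iota 1 N).

(* minimum of a nonempty sequence *)
Definition min_seq (s : seq nat) : nat := foldr minn (head 0 s) s.

End filling.

Section random_matrix.
Context {R : realType}.

Definition generated_mx (N : nat) (phi : nat -> nat * nat) (z : nat -> R) :
  'M[R]_N := \matrix_(i < N, j < N) z (filling_inv N phi (ordered (i.+1, j.+1))).

Definition rescaled_mx (N : nat) (phi : nat -> nat * nat) (z : nat -> R) :
  'M[R]_N := (Num.sqrt N%:R)^-1 *: generated_mx N phi z.

(* The eigenvalues in nondecreasing order, counted with multiplicity; the      *)
(* default [::] is only taken when the characteristic polynomial does not      *)
(* split over R, hence never for a symmetric matrix.                           *)
Definition eigenvalues (N : nat) (A : 'M[R]_N) : seq R :=
  xget [::] [set s : seq R | sorted <=%R s /\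
                             char_poly A = \prod_(x <- s) ('X - x%:P)].

Definition esd (N : nat) (A : 'M[R]_N) :
    {measure set (measurableTypeR R) -> \bar R} :=
  mscale (N%:R^-1)%:nng
    (msum (fun k => \d_((eigenvalues A)`_k : measurableTypeR R)) N).

Definition semicircle_pdf (x : R) : R :=
  (2 * pi)^-1 * Num.sqrt (4 - x ^+ 2) * \1_[set y : R | `|y| <= 2] x.

Definition semicircle_law : set (measurableTypeR R) -> \bar R :=
  fun V => (\int[lebesgue_measure]_(x in V) (semicircle_pdf x)%:E)%E.

Lemma semicircle_pdf_ge0 x : 0 <= semicircle_pdf x.
Proof.
rewrite /semicircle_pdf; apply: mulr_ge0; last by rewrite indicE ler0n.
by apply: mulr_ge0; rewrite ?sqrtr_ge0// invr_ge0 mulr_ge0// pi_ge0.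
Qed.

Lemma measurable_semicircle_pdf : measurable_fun setT semicircle_pdf.
Proof.
apply: measurable_funM; last first.
  apply: measurable_indic.
  rewrite (_ : [set y : R | _] = `[-2, 2]%classic); first exact: measurable_itv.
  by apply/seteqP; split => y /=; rewrite in_itv/= ler_norml.
apply: measurable_funM => //.
apply: continuous_measurable_fun => x.
have cf : {for x, continuous (fun y : R => 4 - y ^+ 2)}.
  by apply: cvgB; [exact: cvg_cst | exact: exprn_continuous].
exact: (continuous_comp cf (@sqrt_continuous R _)).
Qed.

Let semicircle0 : semicircle_law set0 = 0%E.
Proof. by rewrite /semicircle_law integral_set0. Qed.

Let semicircle_ge0 A : (0 <= semicircle_law A)%E.
Proof. by apply: integral_ge0 => x _; rewrite lee_fin semicircle_pdf_ge0. Qed.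

Let semicircle_sigma_additive : semi_sigma_additive semicircle_law.
Proof.
move=> F mF tF mUF; rewrite /semicircle_law ge0_integral_bigcup//=; last 2 first.
- apply/measurable_EFinP; apply: measurable_funTS.
  exact: measurable_semicircle_pdf.
- by move=> x _; rewrite lee_fin semicircle_pdf_ge0.
apply: is_cvg_ereal_nneg_natsum_cond => n _ _.
by apply: integral_ge0 => x _; rewrite lee_fin semicircle_pdf_ge0.
Qed.

HB.instance Definition _ := isMeasure.Build _ _ _
  semicircle_law semicircle0 semicircle_ge0 semicircle_sigma_additive.

End random_matrix.

Section probabilistic_notions.
Context {R : realType} {d : measure_display} {T : measurableType d}.
Variable P : probability T R.

Definition weakly_cvg_in_probability
    (mu : nat -> T -> {measure set (measurableTypeR R) -> \bar R})
    (nu : {measure set (measurableTypeR R) -> \bar R}) : Prop :=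
  forall f : R -> R, continuous f -> bounded_fun f ->
  forall e : R, 0 < e ->
    P [set w | (e%:E < `| \int[mu N w]_x (f x)%:E
                          - \int[nu]_x (f x)%:E |)%E] @[N --> \oo] --> 0%E.

(* The process is indexed by 1, 2, 3, ...; Z 0 is never used. *)
Variable Z : nat -> {RV P >-> R}.

Definition prod_rv (s : seq nat) : T -> R := fun w => \prod_(i <- s) Z i w.

Definition indices (s : seq nat) : bool := all (fun i => 0 < i)%N s.

Definition moments_exist : Prop :=
  forall s : seq nat, indices s -> P.-integrable setT (EFin \o prod_rv s).

Definition moment_M1 : Prop :=
  forall i : nat, (0 < i)%N -> 'E_P[fun w => (Z i w ^+ 2)%R]%E = 1%E.

Definition moment_M2 : Prop :=
  forall s : seq nat, odd (size s) -> indices s -> 'E_P[prod_rv s]%E = 0%E.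

(* Positions in the sequences i and j are 0-based: the m-th entry of the       *)
(* informal i_1, ..., i_k is nth 0 i m.-1.                                     *)
Definition moment_M3 : Prop :=
  forall k : nat, (0 < k)%N -> ~~ odd k ->
  exists C b : R, [/\ 0 < C, 0 <= b < 1 &
  forall i : seq nat, size i = k -> indices i -> sorted leq i ->
  [/\ (`| 'E_P[prod_rv i] | <=
        (C * b ^+ (\sum_(m < k./2)
                     (nth 0 i m.*2.+1 - nth 0 i m.*2))%N)%:E)%E,
      forall j : seq nat, size j = k -> indices j -> sorted leq j ->
      (`| 'E_P[prod_rv (i ++ j)] - 'E_P[prod_rv i] * 'E_P[prod_rv j] | <=
        (C * b ^+ min_seq [seq absdiff a c | a <- i, c <- j])%:E)%E &
      (* empty minimum for k = 2 *)
      (2 < k)%N ->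
      (`| 'E_P[fun w => (\prod_(m < k./2) Z (nth 0%N i m.*2) w ^+ 2)%R] - 1 | <=
        (C * b ^+ min_seq [seq (nth 0 i m.*2.+2 - nth 0 i m.*2)%N
                          | m <- iota 0 k./2.-1])%:E)%E]].

End probabilistic_notions.

(* Main.v *)
Require Import Defs.
From HB Require Import structures.
From mathcomp Require Import all_boot all_order all_algebra.
From mathcomp Require Import all_classical all_reals all_analysis.
From mathcomp Require Import measurable_realfun complex spectral sesquilinear.
From mathcomp Require Import zify ring lra.

(** The bound by 4 is elementary. The number of a position (x, y) with x <= y is
[diag_size (y - x) + x], where [diag_size] counts the positions of the preceding
diagonals. For i < j the difference of the numbers of (i, x) and (x, j) is a
strictly monotone function of x on each of the three ranges x <= i, i < x < j and
j <= x: outside because [diag_size] is strictly concave, in between because one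
number increases while the other does not ([count_diag_edge_lt]). On the outer
ranges the sign of the difference is constant, so a given distance is attained at
most once on each of them, and in between at most once with each sign.

The convergence is proved by the method of moments. The k-th moment of the
empirical measure is the normalised trace of the k-th power of the matrix, that is
[N ^ - (k/2 + 1)] times the sum, over closed walks of length k on the indices, of the
product of the variables attached to the edges ([trace_moment_walks]). The moment
conditions bound the mean of such a product by a geometric weight in [gap_sum], the
sum of the distances inside the pairs of neighbours of the sorted list of edge
numbers; for odd k the means vanish. With the sorting permutation and these distances fixed, every second step of
a pair is determined, up to orientation, by the first one. So a walk is given by at
most k/2 + 1 free vertices, and the geometric weights make the sum over the distances
converge ([sum_geometric_fibers]).

A closed walk either is the depth-first traversal of a tree, or shows a failure at
the first place where the pairing does not describe such a traversal
([traversal_of_no_failure]): a first step arrives at a visited vertex, two pairs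
cross, or the second step of a pair returns along another edge than the first one.
Each failure costs one free vertex; the last one is where the bound by 4 is used, as
the base point of an excursion with given neighbours and given distance of its two
edges has at most 4 choices ([card_mismatch]). Hence only tree traversals count in
the limit. All their edges occur in equal pairs, so that their gap sum is 0 and the
mean of their product is close to 1 except when two pairs are close to each other,
which again costs a free vertex. There are [dyck k 0] times a falling factorial of N
of them ([card_tree_walk]), and [dyck k 0], a Catalan number or 0, is the k-th moment
of the semicircle law ([semicircle_momentE]).

The variance of the k-th moment is a double sum of covariances. A covariance decays
also in the distance of some edge of the first walk to some edge of the second
([mean_prod_cov]), and a pair of linked walks has one free vertex less than a pair of
independent ones ([sum_walk_pairs]); this makes the variance of order 1/N. By
Chebyshev's inequality the moments converge in probability. Convergence of moments
gives weak convergence because a bounded continuous function is uniformly close to a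
polynomial on [-3, 3] and the moments of both measures control polynomials outside
of it ([esd_close]). *)

Set Implicit Arguments.
Unset Strict Implicit.
Unset Printing Implicit Defensive.

Import Order.TTheory GRing.Theory Num.Theory.
Import numFieldNormedType.Exports.

Local Open Scope classical_set_scope.
Local Open Scope ring_scope.

(** * Gap sums and pairings of positions *)

Section Gaps.
Local Open Scope nat_scope.

(** The exponent that controls a mixed moment: in the sorted list, the entries of
ranks 2m and 2m+1 form a pair and contribute their distance. *)
Definition gap_sum (s : seq nat) : nat :=
  \sum_(m < (size s)./2)
     (nth 0 (sort leq s) m.*2.+1 - nth 0 (sort leq s) m.*2).

Lemma count_geq_sorted (a t : nat) (r : seq nat) :
  path leq a r -> t < a -> count (fun x => x <= t) r = 0.
Proof.
move=> pr ta; apply/eqP; rewrite -leqn0 leqNgt -has_count; apply/hasPn => x xr.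
have /allP/(_ _ xr) := order_path_min leq_trans pr.
lia.
Qed.

Lemma sum_nat_itv (a b M : nat) : a <= b -> b <= M ->
  \sum_(0 <= t < M) ((a <= t) && (t < b)) = b - a.
Proof.
move=> ab bM; rewrite (big_cat_nat (n := a)) ?(leq_trans ab)//=.
rewrite big_nat_cond big1 ?add0n; last by move=> i; lia.
rewrite (big_cat_nat (n := b))//= [X in _ + X]big_nat_cond.
rewrite [X in _ + X]big1 ?addn0; last by move=> i; lia.
rewrite big_nat_cond (eq_bigr (fun=> 1)); last by move=> i; lia.
by rewrite -big_nat_cond sum_nat_const_nat muln1.
Qed.

Lemma sorted_gap_sum_odd_count (M h : nat) (s : seq nat) :
  size s = h.*2 -> sorted leq s -> all (fun x => x <= M) s ->
  \sum_(m < h) (nth 0 s m.*2.+1 - nth 0 s m.*2) =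
  \sum_(0 <= t < M) odd (count (fun x => x <= t) s).
Proof.
elim: h s => [|h IH] s; first by move=> /size0nil -> _ _; rewrite big_ord0 big1.
case: s => [|a [|b r]]//=; rewrite doubleS => -[sr] /andP[ab pr].
move=> /and3P[aM bM rM]; rewrite big_ord_recl/=.
rewrite -(sum_nat_itv ab bM).
rewrite (eq_bigr (fun i : 'I_h => nth 0 r i.*2.+1 - nth 0 r i.*2)); last first.
  by [].
rewrite (IH r)//; last exact: path_sorted pr.
rewrite -big_split/=; apply: eq_big_nat => t tM.
rewrite !oddD !oddb.
have [tb|bt] := ltnP t b; last by case: (a <= t) (leq_trans ab bt) => // _; rewrite addbA.
by rewrite (count_geq_sorted pr tb) !andbT/= addbF addn0.
Qed.

(** The intervals spanned by the pairs do not overlap, and an integer t lies in one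
of them precisely when an odd number of entries lies at or below it. This form of the
gap sum does not mention the sorting, so parity arguments apply to it. *)
Lemma gap_sum_odd_count (M : nat) (s : seq nat) :
  ~~ odd (size s) -> all (fun x => x <= M) s ->
  gap_sum s = \sum_(0 <= t < M) odd (count (fun x => x <= t) s).
Proof.
move=> ev sM; rewrite /gap_sum (@sorted_gap_sum_odd_count M).
- apply: eq_bigr => t _.
  by have /permP -> : perm_eq (sort leq s) s by rewrite perm_sort.
- by rewrite size_sort -[LHS]odd_double_half (negbTE ev).
- exact: sort_sorted leq_total _.
- by rewrite all_sort.
Qed.

Lemma gap_sum_cat (s t : seq nat) : ~~ odd (size s) -> ~~ odd (size t) ->
  gap_sum (s ++ t) <= gap_sum s + gap_sum t.
Proof.
move=> es et; pose M := \max_(x <- s ++ t) x.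
have allM : all (fun x => x <= M) (s ++ t).
  by apply/allP => x xs; exact: (@leq_bigmax_seq _ _ xpredT (fun y => y) x xs).
have := allM; rewrite all_cat => /andP[sM tM].
rewrite (@gap_sum_odd_count M)// ?size_cat ?oddD ?(negbTE es)//.
rewrite (gap_sum_odd_count es sM) (gap_sum_odd_count et tM) -big_split/=.
by apply: leq_sum => i _; rewrite count_cat oddD; case: odd; case: odd.
Qed.

Lemma gap_sum_even_count (s : seq nat) : ~~ odd (size s) ->
  (forall P : pred nat, ~~ odd (count P s)) -> gap_sum s = 0.
Proof.
move=> es ev; rewrite (@gap_sum_odd_count (\max_(x <- s) x))//.
  by rewrite big1// => t _; rewrite (negbTE (ev _)).
by apply/allP => x xs; exact: (@leq_bigmax_seq _ _ xpredT (fun y => y) x xs).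
Qed.

Lemma min_seq_mem (s : seq nat) : s != [::] -> min_seq s \in s.
Proof.
case: s => // x s _; rewrite /min_seq /=.
have : foldr minn x s \in x :: s.
  elim: s => [|y s IH] /=; first by rewrite inE.
  rewrite /minn; case: ltnP => _; first by rewrite !inE eqxx orbT.
  by move: IH; rewrite !inE => /orP[->|->]; rewrite ?orbT.
move=> h; rewrite /minn; case: ltnP => _ //; by rewrite inE eqxx.
Qed.

Definition sorting_perm (s : seq nat) : seq nat :=
  sort (relpre (nth 0 s) leq) (iota 0 (size s)).

Lemma sorting_permP (s : seq nat) : perm_eq (sorting_perm s) (iota 0 (size s)).
Proof. by rewrite perm_sort. Qed.

Lemma sort_sorting_perm (s : seq nat) :
  sort leq s = [seq nth 0 s i | i <- sorting_perm s].
Proof.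
by rewrite /sorting_perm -sort_map -/(mkseq (nth 0 s) (size s)) mkseq_nth.
Qed.

Definition gaps (s : seq nat) : seq nat :=
  mkseq (fun m => nth 0 (sort leq s) m.*2.+1 - nth 0 (sort leq s) m.*2)
    (size s)./2.

Lemma sumn_gaps (s : seq nat) : sumn (gaps s) = gap_sum s.
Proof.
rewrite sumnE big_map (_ : iota 0 _ = index_iota 0 (size s)./2) ?big_mkord//.
by rewrite /index_iota subn0.
Qed.

End Gaps.

Lemma count_involution k (f : nat -> nat) : (forall l, (l < k)%N -> (f l < k)%N) ->
  (forall l, (l < k)%N -> f (f l) = l) -> (forall l, (l < k)%N -> f l != l) ->
  (count (fun v => v < f v)%N (iota 0 k)).*2 = k.
Proof.
move=> flt fK fneq.
have pm : perm_eq (map f (iota 0 k)) (iota 0 k).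
  apply: uniq_perm; rewrite ?iota_uniq//.
    rewrite map_inj_in_uniq ?iota_uniq// => u v; rewrite !mem_iota !add0n/= => uk vk.
    by move=> uv; rewrite -(fK _ uk) uv fK.
  move=> x; rewrite mem_iota/= add0n; apply/mapP/idP => [[y]|xk].
    by rewrite mem_iota add0n/= => yk ->; exact: flt.
  by exists (f x); rewrite ?fK// mem_iota/= add0n flt.
rewrite -[RHS](size_iota 0) -(count_predC (fun v => v < f v)%N) -addnn; congr addn.
have /permP <- := pm; rewrite count_map; apply: eq_in_count => v.
rewrite mem_iota add0n/= => vk; rewrite fK//.
by have := fneq _ vk; lia.
Qed.

Section Mate.
Local Open Scope nat_scope.
Variables (k : nat) (sigma : seq nat).
Hypothesis ek : ~~ odd k.
Hypothesis sigmaP : perm_eq sigma (iota 0 k).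

Definition flip (j : nat) : nat := if odd j then j.-1 else j.+1.

(** [sigma] lists the positions by increasing value of their entries; those that
it puts at the places 2m and 2m+1 are partners. *)
Definition mate (l : nat) : nat := nth 0 sigma (flip (index l sigma)).

Lemma flipK : involutive flip.
Proof. by move=> j; rewrite /flip; case: (boolP (odd j)) => oj /=; case: ifP; lia. Qed.

Lemma ltn_flip (j h : nat) : ~~ odd h -> j < h -> flip j < h.
Proof. by rewrite /flip; case: (boolP (odd j)) => oj /=; lia. Qed.

Let size_sigma : size sigma = k.
Proof. by rewrite (perm_size sigmaP) size_iota. Qed.

Let uniq_sigma : uniq sigma.
Proof. by rewrite (perm_uniq sigmaP) iota_uniq. Qed.

Let mem_sigma (l : nat) : (l \in sigma) = (l < k).
Proof. by rewrite (perm_mem sigmaP) mem_iota. Qed.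

Let index_sigma (l : nat) : l < k -> index l sigma < k.
Proof. by rewrite -{2}size_sigma index_mem mem_sigma. Qed.

Lemma mate_lt (l : nat) : l < k -> mate l < k.
Proof.
move=> lk; rewrite -mem_sigma mem_nth// size_sigma.
by rewrite ltn_flip// index_sigma.
Qed.

Lemma mateK (l : nat) : l < k -> mate (mate l) = l.
Proof.
move=> lk; have jk := index_sigma lk.
by rewrite /mate index_uniq ?size_sigma ?ltn_flip// flipK nth_index ?mem_sigma.
Qed.

Lemma mate_neq (l : nat) : l < k -> mate l != l.
Proof.
move=> lk; have jk := index_sigma lk.
rewrite /mate -{2}(nth_index 0 (_ : l \in sigma)) ?mem_sigma//.
rewrite nth_uniq ?size_sigma ?ltn_flip// /flip; case: ifP; lia.
Qed.

Lemma mate_nth (j : nat) : j < k -> mate (nth 0 sigma j) = nth 0 sigma (flip j).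
Proof. by move=> jk; rewrite /mate index_uniq ?size_sigma. Qed.

Lemma count_openers : count (fun v => v < mate v) (iota 0 k) = k./2.
Proof. by rewrite -[RHS](congr1 half (count_involution mate_lt mateK mate_neq)) doubleK. Qed.

(** All that the counting of walks remembers of the sorting of [s]: once the gaps
[n] are fixed, an entry determines its partner. *)
Definition paired (n s : seq nat) : Prop :=
  forall m, m < k./2 ->
    nth 0 s (nth 0 sigma m.*2.+1) = nth 0 s (nth 0 sigma m.*2) + nth 0 n m.

Lemma paired_mate (n s t : seq nat) (l : nat) : paired n s -> paired n t -> l < k ->
  nth 0 s (mate l) = nth 0 t (mate l) -> nth 0 s l = nth 0 t l.
Proof.
move=> ps pt lk; rewrite /mate; have jk := index_sigma lk.
have <- : nth 0 sigma (index l sigma) = l by rewrite nth_index ?mem_sigma.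
rewrite index_uniq ?size_sigma//.
move: (index l sigma) jk => j jk; rewrite /flip.
have jh : j./2 < k./2 by lia.
have := ps _ jh; have := pt _ jh.
case: ifP => oj.
  have -> : j./2.*2.+1 = j by lia.
  have -> : j./2.*2 = j.-1 by lia.
  lia.
have -> : j./2.*2.+1 = j.+1 by lia.
have -> : j./2.*2 = j by lia.
lia.
Qed.

(** With truncated subtraction, [(a - b) + (b - a)] is the distance of [a] and [b]. *)
Lemma paired_absdiff (n s : seq nat) (l : nat) : paired n s -> l < k ->
  (nth 0 s l - nth 0 s (mate l)) + (nth 0 s (mate l) - nth 0 s l) =
  nth 0 n (index l sigma)./2.
Proof.
move=> ps lk; rewrite /mate; have jk := index_sigma lk.
have {1 4}<- : nth 0 sigma (index l sigma) = l by rewrite nth_index ?mem_sigma.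
move: (index l sigma) jk => j jk; rewrite /flip.
have jh : j./2 < k./2 by lia.
have := ps _ jh; case: ifP => oj.
  have -> : j./2.*2.+1 = j by lia.
  have -> : j./2.*2 = j.-1 by lia.
  lia.
have -> : j./2.*2.+1 = j.+1 by lia.
have -> : j./2.*2 = j by lia.
lia.
Qed.

End Mate.

Lemma paired_gaps (s : seq nat) :
  ~~ odd (size s) -> paired (size s) (sorting_perm s) (gaps s) s.
Proof.
move=> es m mk; have m1 : (m.*2.+1 < size s)%N by lia.
have sz : size (sorting_perm s) = size s by rewrite size_sort size_iota.
have nthE j : (j < size s)%N ->
    nth 0%N s (nth 0%N (sorting_perm s) j) = nth 0%N (sort leq s) j.
  by move=> js; rewrite sort_sorting_perm (nth_map 0%N) ?sz.
rewrite !nthE ?(ltnW m1)// nth_mkseq// subnKC//.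
apply: (sorted_leq_nth leq_trans leqnn); rewrite ?inE ?size_sort ?(ltnW m1)//.
exact: sort_sorted leq_total _.
Qed.

Section OddLink.
Local Open Scope nat_scope.

(** The sorted pairing of two concatenated lists of odd size cannot pair each list
within itself, so some pair contains an entry of each of them. *)
Lemma odd_cat_link (s t : seq nat) k : odd k -> size s = k -> size t = k ->
  exists l l', [/\ l < k, l' < k &
    (nth 0 s l - nth 0 t l') + (nth 0 t l' - nth 0 s l) <= gap_sum (s ++ t)].
Proof.
move=> ok sk tk; set u := s ++ t.
have su : size u = k + k by rewrite size_cat sk tk.
have ekk : ~~ odd (k + k) by rewrite addnn odd_double.
have := @paired_gaps u; rewrite su => /(_ ekk).
have := sorting_permP u; rewrite su.
move: (sorting_perm u) => sigma sigmaP pu.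
have [/hasP[l]|none] := boolP (has (fun l => k <= mate sigma l) (iota 0 k)).
  rewrite mem_iota add0n /= => lk kl; have lkk : l < k + k by lia.
  have mk := mate_lt ekk sigmaP lkk.
  exists l, (mate sigma l - k); split; [by []|by lia|].
  have := paired_absdiff ekk sigmaP pu lkk.
  rewrite /u !nth_cat sk lk ltnNge kl /= => ->.
  rewrite -/u -sumn_gaps sumnE.
  have [lt|ge] := ltnP (index l sigma)./2 (size (gaps u)).
    by rewrite (big_rem (nth 0 (gaps u) (index l sigma)./2)) ?mem_nth//= leq_addr.
  by rewrite nth_default.
have mlt l : l < k -> mate sigma l < k.
  move=> lk; have /hasPn/(_ l) := none.
  by rewrite mem_iota add0n/= lk ltnNge => /(_ isT).
have := @count_involution k (mate sigma) mlt.
have aux l : l < k -> l < k + k by move=> lk; rewrite ltn_addr.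
move=> /(_ (fun l lk => mateK ekk sigmaP (aux l lk))).
move=> /(_ (fun l lk => mate_neq ekk sigmaP (aux l lk))) E.
by move: ok; rewrite -E odd_double.
Qed.

End OddLink.

(** * Counting closed walks *)

Lemma card_code (T A B : finType) (P : pred T) (f : T -> A) (g : T -> B) :
  (forall p q, P p -> P q -> f p = f q -> g p = g q -> p = q) ->
  (#|P| <= #|A| * #|B|)%N.
Proof.
move=> inj; rewrite -card_prod.
have ij : {in P &, injective (fun p => (f p, g p))}.
  by move=> p q Pp Pq [] ? ?; exact: inj.
by rewrite -(card_in_image ij) max_card.
Qed.

Lemma card_le_union (I T : finType) (P : pred T) (Q : I -> pred T) (L : nat) :
  (forall p, P p -> exists i, Q i p) -> (forall i, (#|Q i| <= L)%N) ->
  (#|P| <= #|I| * L)%N.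
Proof.
move=> PQ QL; rewrite -sum_nat_const.
apply: (@leq_trans (\sum_(i in I) #|Q i|)); last by apply: leq_sum.
rewrite -sum1_card; under [leqRHS]eq_bigr do rewrite -sum1_card.
rewrite (exchange_big_dep xpredT)//= big_mkcond; apply: leq_sum => p _.
by case: ifP => // /PQ[i Qi]; rewrite (bigD1 i).
Qed.

Lemma big_cons_tuple (S : nmodType) N k (F : seq 'I_N -> S) (Q : pred (seq 'I_N)) :
  \sum_(w : k.+1.-tuple 'I_N | Q w) F w =
  \sum_(y : 'I_N) \sum_(w : k.-tuple 'I_N | Q (y :: w)) F (y :: w).
Proof.
rewrite pair_big_dep/=.
rewrite (reindex (fun u : 'I_N * k.-tuple 'I_N => cons_tuple u.1 u.2))//=.
exists (fun w : k.+1.-tuple 'I_N => (thead w, behead_tuple w)) => [[y w]|w] _ /=.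
  by congr (_, _); apply: val_inj.
by rewrite [RHS]tuple_eta; apply: val_inj.
Qed.

Section Walks.
Local Open Scope nat_scope.
Variable N : nat.

(** The starting point is kept apart, so that the other vertices are the [k] entries
of a tuple, one for each step. *)
Definition walk (k : nat) : Type := ('I_N * k.-tuple 'I_N)%type.

Definition closed k (p : walk k) : bool := last p.1 p.2 == p.1.

Definition vertex k (p : walk k) (i : nat) : 'I_N := nth p.1 (p.1 :: p.2) i.

Lemma vertex_last k (p : walk k) : vertex p k = last p.1 p.2.
Proof. by rewrite /vertex (last_nth p.1) size_tuple. Qed.

Lemma eq_walk k (p q : walk k) :
  (forall i, i <= k -> vertex p i = vertex q i) -> p = q.
Proof.
case: p q => x w [y u] h.
have xy : x = y by have := h 0 isT.
rewrite -{}xy in h *; congr (_, _); apply: val_inj.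
apply: (@eq_from_nth _ x); rewrite ?size_tuple// => i ik.
by have := h i.+1 ik.
Qed.

Variable e : 'I_N -> 'I_N -> nat.

Definition edges k (p : walk k) : seq nat := pairmap e p.1 p.2.

Lemma size_edges k (p : walk k) : size (edges p) = k.
Proof. by rewrite size_pairmap size_tuple. Qed.

Lemma nth_edges k (p : walk k) i : i < k ->
  nth 0 (edges p) i = e (vertex p i) (vertex p i.+1).
Proof. by move=> ik; rewrite (nth_pairmap p.1) ?size_tuple. Qed.

Hypothesis eC : forall x y, e x y = e y x.
Hypothesis e_inj : forall x y x' y', e x y = e x' y' ->
  (x = x' /\ y = y') \/ (x = y' /\ y = x').

(** An edge number determines the two ends of a step only up to their order. *)
Definition orientation k (p : walk k) : {ffun 'I_k -> bool} :=
  [ffun l : 'I_k => vertex p l <= vertex p l.+1].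

Lemma edge_ends k (p q : walk k) l : orientation p = orientation q -> l < k ->
  nth 0 (edges p) l = nth 0 (edges q) l ->
  vertex p l = vertex q l /\ vertex p l.+1 = vertex q l.+1.
Proof.
move=> /ffunP/(_ (Ordinal _)) o lk; rewrite !nth_edges//.
have := o _ lk; rewrite !ffunE/= => o1 /e_inj[//|[h1 h2]].
move: o1; rewrite h1 h2 => o1; split; apply: val_inj => /=; lia.
Qed.

Section FixedPairing.
Variables (k : nat) (sigma n : seq nat).
Hypothesis ek : ~~ odd k.
Hypothesis sigmaP : perm_eq sigma (iota 0 k).

Local Notation mate := (mate sigma).
Let mlt (l : nat) : l < k -> mate l < k := mate_lt ek sigmaP (l := l).
Let mK (l : nat) : l < k -> mate (mate l) = l := mateK ek sigmaP (l := l).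
Let mneq (l : nat) : l < k -> mate l != l := mate_neq ek sigmaP (l := l).

(** The edge number of a step is that of its partner up to a prescribed difference,
and it determines the ends of the step once the orientation is known. *)
Lemma step_from_mate (p q : walk k) l : orientation p = orientation q ->
  paired k sigma n (edges p) -> paired k sigma n (edges q) -> l < k ->
  vertex p (mate l) = vertex q (mate l) ->
  vertex p (mate l).+1 = vertex q (mate l).+1 ->
  vertex p l = vertex q l /\ vertex p l.+1 = vertex q l.+1.
Proof.
move=> o pp pq lk h1 h2; apply: edge_ends => //.
apply: (paired_mate ek sigmaP pp pq lk).
by rewrite !nth_edges ?mlt// h1 h2.
Qed.

(** The places where a vertex is chosen freely when one reads a walk from its
start: the start and the far ends of the first steps of all pairs but one. *)
Definition free_places (m : nat) : seq nat :=
  0 :: [seq v.+1 | v <- iota 0 k & (v < mate v) && (v != m)].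

Lemma count_openers_but m : m < k -> m < mate m ->
  count (fun v => (v < mate v) && (v != m)) (iota 0 k) = (k./2).-1.
Proof.
move=> mk om; have := count_openers ek sigmaP; rewrite -size_filter.
set s := [seq v <- iota 0 k | v < mate v] => sk.
have := count_predC (pred1 m) s; rewrite sk.
rewrite (count_uniq_mem _ (filter_uniq _ (iota_uniq 0 k))).
rewrite mem_filter om mem_iota mk/= add1n => <- /=.
by rewrite /s count_filter; apply: eq_count => v /=; rewrite andbC.
Qed.

Lemma size_free_places m : m < k -> m < mate m -> size (free_places m) = k./2.
Proof.
move=> mk om; rewrite /= size_map size_filter count_openers_but//; lia.
Qed.

(** One degree of freedom less: if the far end of the first step [m] of some
pair is determined by the earlier vertices, reading the walks from their start
leaves at most k/2 free vertices. *)
Lemma card_walk_forced (P : pred (walk k)) m : m < k -> m < mate m ->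
  (forall p, P p -> paired k sigma n (edges p)) ->
  (forall p q, P p -> P q -> orientation p = orientation q ->
    (forall i, i <= m -> vertex p i = vertex q i) ->
    vertex p m.+1 = vertex q m.+1) ->
  #|P| <= N ^ k./2 * 2 ^ k.
Proof.
move=> mk om Pp Pm.
have := @card_code _ _ _ P
  (fun p => [tuple vertex p (nth 0 (free_places m) i) | i < k./2])
  (@orientation k).
rewrite card_tuple card_ord card_ffun card_bool card_ord; apply=> p q hp hq f o.
have freeE i : i \in free_places m -> vertex p i = vertex q i.
  move=> iF; have jF : index i (free_places m) < k./2.
    by rewrite -(size_free_places mk om) index_mem.
  have := congr1 (fun t : (k./2).-tuple _ => tnth t (Ordinal jF)) f.
  by rewrite !tnth_mktuple/= nth_index.
apply: eq_walk => i; have [h] := ubnP i; elim: h i => // h IH [|v] vh vk.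
  by apply: freeE; rewrite inE eqxx.
have IH' j : j <= v -> vertex p j = vertex q j by move=> jv; apply: IH; lia.
have [vm|vm] := eqVneq v m.
  by rewrite vm; apply: Pm => // j jm; apply: IH'; rewrite vm.
have [ov|cv] := ltnP v (mate v).
  apply: freeE; rewrite inE/=; apply/mapP; exists v => //.
  by rewrite mem_filter ov vm mem_iota/= add0n.
have mv : mate v < v by have := mneq vk; lia.
have [] := step_from_mate o (Pp _ hp) (Pp _ hq) vk (IH' _ _) (IH' _ _) => //; lia.
Qed.

(** The first step of a pair arrives at an earlier vertex. *)
Lemma card_revisit (P : pred (walk k)) m r : m < k -> m < mate m -> r <= m ->
  (forall p, P p -> paired k sigma n (edges p) /\ vertex p m.+1 = vertex p r) ->
  #|P| <= N ^ k./2 * 2 ^ k.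
Proof.
move=> mk om rm hP; apply: (card_walk_forced mk om) => [p /hP[]//|p q].
by move=> /hP[_ ->] /hP[_ ->] _; apply.
Qed.

(** Two pairs cross: the first step [m] of a pair lies between the two steps of an
earlier pair, and its far end is the start of the second step [l], hence one of
the ends of the partner of [l]. *)
Lemma card_crossing (P : pred (walk k)) m l : l < k -> mate l < m -> m < l ->
  m < mate m ->
  (forall p, P p -> paired k sigma n (edges p) /\ vertex p m.+1 = vertex p l) ->
  #|P| <= N ^ k./2 * 2 ^ k.
Proof.
move=> lk am ml om hP; have mk := ltn_trans ml lk.
apply: (card_walk_forced mk om) => [p /hP[]//|p q].
move=> /hP[pp ->] /hP[pq ->] o h.
by have [] := step_from_mate o pp pq lk (h _ (ltnW am)) (h _ am).
Qed.

Lemma paired_opener (p q : walk k) l :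
  paired k sigma n (edges p) -> paired k sigma n (edges q) -> l < k ->
  nth 0 (edges p) l = nth 0 (edges q) l <->
  nth 0 (edges p) (minn l (mate l)) = nth 0 (edges q) (minn l (mate l)).
Proof.
move=> pp pq lk; have [lm|ml] := leqP l (mate l); first by [].
split => h; last exact: (paired_mate ek sigmaP pp pq).
by apply: (paired_mate ek sigmaP pp pq (mlt lk)); rewrite mK.
Qed.

(** Two edges of different pairs at prescribed distance cost one degree of
freedom: the later of the two pairs is determined by the earlier one. *)
Lemma card_linked (P : pred (walk k)) l l' d : l < k -> l' < k -> l != l' ->
  mate l != l' ->
  (forall p, P p -> paired k sigma n (edges p) /\
     nth 0 (edges p) l' = nth 0 (edges p) l + d) ->
  #|P| <= N ^ k./2 * 2 ^ k.
Proof.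
move=> lk l'k ll' ml' hP.
pose op u := minn u (mate u).
have op_lt u : u < k -> op u < k by move=> uk; rewrite gtn_min uk.
have op_open u : u < k -> op u < mate (op u).
  move=> uk; rewrite /op; have [um|mu] := leqP u (mate u).
    by have := mneq uk; lia.
  by rewrite mK.
have eq_open u : u < k -> op u = u \/ op u = mate u.
  by move=> _; rewrite /op; case: leqP; [left|right].
have op_neq : op l != op l'.
  apply/eqP => E; have [E1|E1] := eq_open _ lk; have [E2|E2] := eq_open _ l'k.
  - by rewrite -E1 -E2 E eqxx in ll'.
  - by move: ml'; rewrite -E1 E E2 mK// eqxx.
  - by move: ml'; rewrite -E1 E E2 eqxx.
  - by move: ll'; rewrite -(mK lk) -E1 E E2 mK// eqxx.
have main a b : (a = l /\ b = l') \/ (a = l' /\ b = l) -> op a < op b ->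
    #|P| <= N ^ k./2 * 2 ^ k.
  move=> ab lt_ab.
  have ak : a < k by case: ab => -[-> _].
  have bk : b < k by case: ab => -[_ ->].
  apply: (card_walk_forced (op_lt _ bk) (op_open _ bk)) => [p /hP[]//|p q].
  move=> /hP[pp ep] /hP[pq eq] o h.
  have ea : nth 0 (edges p) a = nth 0 (edges q) a.
    by apply/(paired_opener pp pq ak); rewrite !nth_edges ?op_lt// !h// ltnW.
  have eb : nth 0 (edges p) b = nth 0 (edges q) b.
    by case: ab => -[? ?]; subst a b; lia.
  have {}eb := (paired_opener pp pq bk).1 eb.
  by have [] := edge_ends o (op_lt _ bk) eb.
have [lt|gt|/eqP] := ltngtP (op l) (op l'); last by rewrite (negbTE op_neq).
  by apply: (main l l') => //; left.
by apply: (main l' l) => //; right.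
Qed.

(** A walk that leaves on the first step of a pair, makes an excursion paired
within itself, and comes back on the second step of that pair along another
edge: the rest of the walk, read forward from its start and backward from its
end, fixes both neighbours of the excursion, hence its base point up to [c]
choices. *)
Lemma card_mismatch (c : nat) (P : pred (walk k)) l :
  (forall i j d, 0 < d ->
     #|[pred x | (e i x - e x j) + (e x j - e i x) == d]| <= c) ->
  l < k -> mate l < l ->
  (forall u, mate l < u < l -> mate l < mate u < l) ->
  (forall p, P p -> [/\ paired k sigma n (edges p), closed p,
     vertex p l = vertex p (mate l).+1 &
     nth 0 (edges p) l != nth 0 (edges p) (mate l)]) ->
  #|P| <= N ^ k./2 * (2 ^ k * c.+1).
Proof.
move=> hc lk; have := mlt lk; have := mK lk.
set a := mate l => ma ak al ins hP.
have oa : a < mate a by rewrite ma.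
pose d := nth 0 n (index l sigma)./2.
(* after the excursion the walk is read backward: a pair behind it is met
first at its second step, and the vertex to be chosen is the start of that step *)
pose far v := if l < v then mate v else v.+1.
pose places := 0 :: [seq far v | v <- iota 0 k & (v < mate v) && (v != a)].
have size_places : size places = k./2.
  rewrite /= size_map size_filter count_openers_but//; lia.
pose base (p : walk k) := [pred x |
  (e (vertex p a) x - e x (vertex p l.+1)) +
  (e x (vertex p l.+1) - e (vertex p a) x) == d].
have base_vtx p : P p -> vertex p l \in base p.
  move=> /hP[pp cp lE ne]; rewrite inE.
  have := paired_absdiff ek sigmaP pp lk; rewrite -/a -/d !nth_edges// -lE => <-.
  by apply/eqP; rewrite addnC.
have base_gt0 p : P p -> 0 < d.
  move=> /hP[pp cp lE ne].
  have := paired_absdiff ek sigmaP pp lk; rewrite -/a -/d => <-; lia.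
have index_base p : P p -> index (vertex p l) (enum (base p)) < c.
  move=> hp; apply: leq_trans (hc (vertex p a) (vertex p l.+1) d _).
    by rewrite cardE index_mem mem_enum base_vtx.
  exact: base_gt0 hp.
have := @card_code _ _ _ P
  (fun p => [tuple vertex p (nth 0 places i) | i < k./2])
  (fun p => (orientation p,
     (inord (index (vertex p l) (enum (base p))) : 'I_c.+1))).
rewrite card_tuple card_ord card_prod card_ffun card_bool !card_ord; apply=> p q hp hq f.
move=> [ori ix]; have [pp cp lp _] := hP _ hp; have [pq cq lq _] := hP _ hq.
have freeE i : i \in places -> vertex p i = vertex q i.
  move=> iF; have jF : index i places < k./2 by rewrite -size_places index_mem.
  have := congr1 (fun t : (k./2).-tuple _ => tnth t (Ordinal jF)) f.
  by rewrite !tnth_mktuple/= nth_index.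
have farE v : v < k -> v < mate v -> v != a -> vertex p (far v) = vertex q (far v).
  move=> vk ov va; apply: freeE; rewrite inE/=; apply/orP; right.
  by apply/mapP; exists v => //; rewrite mem_filter ov va mem_iota/= add0n.
have start : vertex p 0 = vertex q 0 by apply: freeE; rewrite inE eqxx.
have step v : v < k -> vertex p (mate v) = vertex q (mate v) ->
    vertex p (mate v).+1 = vertex q (mate v).+1 ->
    vertex p v = vertex q v /\ vertex p v.+1 = vertex q v.+1.
  by move=> vk; exact: (step_from_mate ori pp pq vk).
have before i : i <= a -> vertex p i = vertex q i.
  have [h] := ubnP i; elim: h i => // h IH [//|v] vh va.
  have IH' j : j <= v -> vertex p j = vertex q j by move=> jv; apply: IH; lia.
  have vk : v < k by lia.
  have [ov|cv] := ltnP v (mate v).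
    by have := farE v vk ov _; rewrite /far ifF; [apply; lia|lia].
  have mv : mate v < v by have := mneq vk; lia.
  by have [] := step v vk (IH' _ _) (IH' _ _) => //; lia.
have outside v : v < k -> l < v -> mate v < a \/ l < mate v.
  move=> vk lv; have [?|ge] := ltnP (mate v) a; [by left|right].
  have [//|le] := ltnP l (mate v).
  have [E|na] := eqVneq (mate v) a; first by have := mK vk; rewrite E ma; lia.
  have [E|nl] := eqVneq (mate v) l; first by have := mK vk; rewrite E -/a; lia.
  have := ins (mate v); rewrite mK//; lia.
have after i : l < i -> i <= k -> vertex p i = vertex q i.
  move=> li ik; have [h] := ubnP (k - i); elim: h i li ik => // h IH i li ik hi.
  have [->|ik'] := eqVneq i k.
    by rewrite !vertex_last (eqP cp) (eqP cq); exact: start.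
  have {ik'} ik' : i < k by lia.
  have IH' j : i < j -> j <= k -> vertex p j = vertex q j.
    by move=> ij jk; apply: IH; lia.
  have [lt|gt] := outside _ ik' li.
    by have [] := step i ik' (before _ _) (before _ _) => //; lia.
  have [ov|cv] := ltnP i (mate i).
    have mik := mlt ik'.
    by have [] := step i ik' (IH' _ _ _) (IH' _ _ _) => //; lia.
  have mi : mate i < i by have := mneq ik'; lia.
  have := farE (mate i) (mlt ik') _ _; rewrite /far gt mK//; apply => //.
  by apply/eqP; lia.
have baseE : vertex p l = vertex q l.
  have bpq : base p =i base q.
    by move=> x; rewrite !inE before// (after l.+1).
  have := congr1 val ix.
  rewrite /= !inordK ?ltnS ?(ltnW (index_base _ hp)) ?(ltnW (index_base _ hq))// => ixE.
  have pin : vertex p l \in enum (base p) by rewrite mem_enum base_vtx.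
  have qin : vertex q l \in enum (base q) by rewrite mem_enum base_vtx.
  rewrite -(nth_index (vertex p l) pin) ixE (eq_enum bpq).
  by rewrite -[RHS](nth_index (vertex p l) qin).
have within i : a < i -> i <= l -> vertex p i = vertex q i.
  have [h] := ubnP i; elim: h i => // h IH [//|v] vh va vl.
  have [->|av] := eqVneq v a; first by rewrite -lp -lq.
  have {}av : a < v by lia.
  have vk : v < k by lia.
  have IH' j : a < j -> j <= v -> vertex p j = vertex q j.
    by move=> aj jv; apply: IH; lia.
  have [ov|cv] := ltnP v (mate v).
    by have := farE v vk ov _; rewrite /far ifF; [apply; lia|lia].
  have mv : mate v < v by have := mneq vk; lia.
  have := ins v; rewrite av vl => /(_ isT)/andP[amv _].
  by have [] := step v vk (IH' _ _ _) (IH' _ _ _) => //; lia.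
apply: eq_walk => i ik; have [ia|ai] := leqP i a; first exact: before.
by have [il|li] := leqP i l; [exact: within|exact: after].
Qed.

End FixedPairing.

(** Reading a walk as a depth-first traversal of a tree: every step either
discovers a new vertex, which is pushed on the stack of ancestors, or goes back
to the parent. *)
Fixpoint traversal (x : 'I_N) (stack visited w : seq 'I_N) : bool :=
  match w with
  |[::] => stack == [::]
  | y :: w' =>
      if y \notin visited then traversal y (x :: stack) (y :: visited) w'
      else match stack with
           | z :: stack' => (y == z) && traversal z stack' visited w'
           |[::] => false
           end
  end.

Definition tree_walk k (p : walk k) : bool := traversal p.1 [::] [:: p.1] p.2.

Lemma last_traversal x stack visited w :
  traversal x stack visited w -> last x w = last x stack.
Proof.
elim: w x stack visited => [|y w IH] x stack visited /=; first by move/eqP->.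
case: ifP => _; first by move/IH.
by case: stack => // z stack /andP[/eqP-> /IH].
Qed.

Lemma tree_walk_closed k (p : walk k) : tree_walk p -> closed p.
Proof. by move/last_traversal => h; rewrite /closed h. Qed.

(** Every edge of the tree is traversed once in each direction; for those leading to
the vertices on the stack only the way back is still to come. *)
Lemma odd_count_traversal (P : pred nat) x stack visited w :
  traversal x stack visited w ->
  odd (count P (pairmap e x w)) = odd (count P (pairmap e x stack)).
Proof.
elim: w x stack visited => [|y w IH] x stack visited /=; first by move/eqP->.
case: ifP => _ => [/IH|]; first by move=> h; rewrite oddD h /= oddD eC addKb.
by case: stack => // z stack /andP[/eqP-> /IH h] /=; rewrite !oddD h.
Qed.

Lemma tree_walk_gap_sum k (p : walk k) : ~~ odd k -> tree_walk p ->
  gap_sum (edges p) = 0.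
Proof.
move=> ek tp; apply: gap_sum_even_count => [|P]; first by rewrite size_edges.
by rewrite (odd_count_traversal _ tp).
Qed.

(** The three ways in which a closed walk with paired steps can fail to be a tree
traversal that opens an edge on the first step of every pair and closes it on
the second step. *)
Definition revisits k (mt : nat -> nat) (p : walk k) m r : bool :=
  [&& m < mt m, r <= m & vertex p m.+1 == vertex p r].
Definition crosses k (mt : nat -> nat) (p : walk k) l m : bool :=
  [&& mt l < m, m < l, m < mt m & vertex p m.+1 == vertex p l].
Definition mismatches k (mt : nat -> nat) (p : walk k) l : bool :=
  [&& mt l < l, all (fun u => (mt l < u) ==> (mt l < mt u < l)) (iota 0 l),
      vertex p l == vertex p (mt l).+1 &
      nth 0 (edges p) l != nth 0 (edges p) (mt l)].

Section Classification.
Variables (k : nat) (mt : nat -> nat) (p : walk k).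
Hypothesis mlt : forall l, l < k -> mt l < k.
Hypothesis mK : forall l, l < k -> mt (mt l) = l.
Hypothesis mneq : forall l, l < k -> mt l != l.
Hypothesis no_revisit : forall m r, m < k -> ~~ revisits mt p m r.
Hypothesis no_cross : forall l m, l < k -> ~~ crosses mt p l m.
Hypothesis no_mismatch : forall l, l < k -> ~~ mismatches mt p l.

(** The stack of the traversal, seen through the pairing: the steps in [st] are the
tree edges from [x] back to the root. *)
Fixpoint chain (x : 'I_N) (st : seq nat) : Prop :=
  match st with
  |[::] => True
  | m :: st' => vertex p m.+1 = x /\ chain (vertex p m) st'
  end.

(** The stack consists of the steps whose partner is still to come. A first step
goes to a new vertex because there is no revisit; a second step closes the top of
the stack because nothing crosses, and it runs along the same edge because there
is no mismatch. *)
Lemma traversal_of_no_failure (h t : nat) (st : seq nat) (visited : seq 'I_N) :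
  t + h = k -> sorted (fun a b => b < a) st ->
  (forall l, (l \in st) = (l < t) && (t <= mt l)) ->
  chain (vertex p t) st ->
  (forall x, x \in visited <-> exists2 i, i <= t & x = vertex p i) ->
  (forall l m, l < t -> mt l < m -> m < l -> mt m < l) ->
  traversal (vertex p t) [seq vertex p m | m <- st] visited (drop t p.2).
Proof.
elim: h t st visited => [|h IH] t st visited.
  rewrite addn0 => tk _ st_open _ _ _.
  rewrite drop_oversize ?size_tuple ?tk//=; case: st st_open => // l st.
  move=> /(_ l); rewrite inE eqxx /= => /esym/andP[lt].
  by have := mlt (l := l); lia.
move=> thk srt st_open ch vis nocr; have tk : t < k by lia.
have dropE : drop t p.2 = vertex p t.+1 :: drop t.+1 p.2.
  by rewrite (drop_nth p.1) ?size_tuple.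
rewrite dropE /=.
have vis' x : x \in vertex p t.+1 :: visited <->
    exists2 i, i <= t.+1 & x = vertex p i.
  rewrite inE; split.
    case/orP => [/eqP->|/vis[i it ->]]; first by exists t.+1.
    by exists i => //; rewrite ltnW.
  case=> i; rewrite leq_eqVlt => /orP[/eqP-> ->|it ->]; first by rewrite eqxx.
  by apply/orP; right; apply/vis; exists i.
have [ot|ct] := ltnP t (mt t).
  rewrite ifT; last first.
    apply/negP => /vis[r rt E].
    by have := no_revisit r tk; rewrite /revisits ot rt E eqxx.
  apply: (IH t.+1 (t :: st)) => //=; first by lia.
  - case: st srt st_open {ch} => //= m st -> st_open; rewrite andbT.
    by have := st_open m; rewrite inE eqxx /= => /esym/andP[].
  - move=> l; rewrite inE st_open; have [->|lt] := eqVneq l t; first by lia.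
    have [lt'|] := ltnP l t; last by lia.
    have ltk := ltn_trans lt' tk.
    have : mt l != t by apply/eqP => E; have := mK ltk; rewrite E; lia.
    by lia.
  - move=> l m; rewrite ltnS leq_eqVlt => /orP[/eqP->|]; last exact: nocr.
    by lia.
have {}ct : mt t < t by have := mneq tk; lia.
have : mt t \in st by rewrite st_open ct mK/=.
case: st srt st_open ch => // m st srt st_open [vm ch] ain.
have [mt_t tm] : m < t /\ t <= mt m.
  by apply/andP; rewrite -st_open inE eqxx.
have st_lt l : l \in st -> l < m.
  move=> ls; have /allP := order_path_min (rev_trans ltn_trans) srt.
  by move=> /(_ _ ls).
have mE : m = mt t.
  apply/eqP; apply/negPn/negP => ne; have ltm : mt t < m.
    by move: ain; rewrite inE eq_sym (negbTE ne) => /st_lt.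
  have := no_cross m tk; rewrite /crosses ltm mt_t vm eqxx andbT /=.
  by lia.
have ins u : mt t < u -> u < t -> mt t < mt u < t.
  move=> au ut; have uk := ltn_trans ut tk.
  have mut : mt u < t.
    have [//|tmu] := ltnP (mt u) t.
    have : u \in m :: st by rewrite st_open ut tmu.
    by rewrite inE => /orP[/eqP|/st_lt]; lia.
  rewrite mut andbT; have := nocr u (mt t) ut; rewrite mK//.
  have : mt u != mt t by apply/eqP => E; have := mK uk; rewrite E mK//; lia.
  by lia.
have eE : nth 0 (edges p) t = nth 0 (edges p) (mt t).
  apply/eqP/negPn/negP => ne; have := no_mismatch tk.
  rewrite /mismatches ct ne -mE vm eqxx !andbT /=; case/negP.
  apply/allP => u; rewrite mem_iota/= add0n => ut; apply/implyP; rewrite mE => mu.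
  exact: ins.
have back : vertex p t.+1 = vertex p m.
  move: eE; rewrite -mE !nth_edges ?(ltn_trans mt_t)// vm.
  by move=> /e_inj[[-> ->]|[_ ->]].
rewrite ifF; last first.
  by apply/negP/negP/vis; exists m => //; rewrite ltnW.
rewrite back eqxx /= -back; apply: (IH t.+1 st) => //.
- by lia.
- exact: path_sorted srt.
- move=> l; have [->|lm] := eqVneq l m.
    have -> : (m \in st) = false by apply/negP => /st_lt; rewrite ltnn.
    by rewrite mE mK//; lia.
  have := st_open l; rewrite inE (negbTE lm)/= => ->.
  have [->|lt] := eqVneq l t; first by lia.
  have [lt'|] := ltnP l t; last by lia.
  have ltk := ltn_trans lt' tk.
  have : mt l != t by apply/eqP => E; have := mK ltk; rewrite E -mE; lia.
  by lia.
- by rewrite back.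
- move=> x; rewrite vis; split => -[i it ->]; first by exists i => //; lia.
  move: it; rewrite leq_eqVlt => /orP[/eqP->|it]; last by exists i.
  by exists m; rewrite ?back// ltnW.
- move=> l u; rewrite ltnS leq_eqVlt => /orP[/eqP-> au ut|]; last exact: nocr.
  by have /andP[] := ins _ au ut.
Qed.

Lemma tree_walk_of_no_failure : tree_walk p.
Proof.
have := @traversal_of_no_failure k 0 [::] [:: p.1]; rewrite drop0; apply => //.
by move=> x; rewrite inE; split=> [/eqP->|[l]]; [exists 0|case: l => // _ ->].
Qed.

End Classification.

Lemma card_walk k (P : pred (walk k)) :
  #|P| = \sum_(x : 'I_N) #|[pred w : k.-tuple 'I_N | P (x, w)]|.
Proof.
rewrite -sum1_card.
under [RHS]eq_bigr do rewrite -sum1_card.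
by rewrite pair_big_dep/=; apply: eq_bigl => -[x w].
Qed.

End Walks.

(** Number of nearest-neighbour paths of length [k] on the nonnegative integers
that lead from [h] to 0. *)
Fixpoint dyck (k h : nat) : nat :=
  match k with
  | 0 => h == 0
  | k'.+1 => dyck k' h.+1 + (if h is h'.+1 then dyck k' h' else 0)
  end.

Lemma dyck_lt (k h : nat) : (k < h)%N -> dyck k h = 0%N.
Proof.
elim: k h => [|k IH] [|h]//= kh; rewrite !IH//; lia.
Qed.

(** The shape of a traversal is a path counted by [dyck], and each discovery of a
vertex chooses among those that have not been visited yet. *)
Lemma card_traversal N k (x : 'I_N) (stack visited : seq 'I_N) :
  uniq visited -> {subset x :: stack <= visited} ->
  #|[pred w : k.-tuple 'I_N | traversal x stack visited w]| =
  (dyck k (size stack) * (N - size visited) ^_ (k - size stack)./2)%N.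
Proof.
elim: k x stack visited => [|k IH] x stack visited uv sv.
  rewrite sub0n ffactn0 muln1 /= (eq_card (B := fun=> stack == [::])); last first.
    by move=> w; rewrite (tuple0 w) inE.
  case: stack {sv} => [|z s] /=; last by rewrite eq_card0.
  by rewrite -[RHS](expn0 #|'I_N|) -card_tuple; apply: eq_card => w; rewrite !inE.
have -> : #|[pred w : k.+1.-tuple 'I_N | traversal x stack visited w]| =
    (\sum_(y : 'I_N) #|[pred w : k.-tuple 'I_N | traversal x stack visited (y :: w)]|)%N.
  rewrite -sum1_card (big_cons_tuple _ (fun=> 1%N) (fun w => traversal x stack visited w)).
  by apply: eq_bigr => y _; rewrite sum1_card.
rewrite (bigID (mem visited))/= addnC mulnDl; congr (_ + _)%N.
  have cardE y : y \notin visited ->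
      #|[pred w : k.-tuple 'I_N | traversal x stack visited (y :: w)]| =
      (dyck k (size stack).+1 *
        (N - (size visited).+1) ^_ (k - (size stack).+1)./2)%N.
    move=> yv; have := IH y (x :: stack) (y :: visited); rewrite /= yv => <- //.
    by move=> z; rewrite !inE => /orP[->//|/sv ->]; rewrite orbT.
  rewrite (eq_bigr _ cardE) sum_nat_const.
  have -> : #|[pred i | i \notin visited]| = (N - size visited)%N.
    have := cardC (mem visited); rewrite card_ord (card_uniqP uv) => NE.
    exact: (canRL (addKn _) NE).
  have [lt|ge] := ltnP k (size stack).+1; first by rewrite dyck_lt// !mul0n muln0.
  have -> : ((k.+1 - size stack)./2 = (k - (size stack).+1)./2.+1)%N.
    by clear -ge; lia.
  by rewrite ffactnS subnS mulnCA.
case: stack sv => [|z stack] sv.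
  by rewrite mul0n big1// => y yv; apply: eq_card0 => w; rewrite !inE/= yv.
rewrite (bigD1 z)/=; last by apply: sv; rewrite !inE eqxx orbT.
rewrite [X in (_ + X)%N]big1 ?addn0; last first.
  move=> y /andP[yv yz]; apply: eq_card0 => w.
  by rewrite !inE/= yv /= (negbTE yz).
rewrite subSS -(IH z)//; last by move=> y ys; apply: sv; rewrite inE ys orbT.
apply: eq_card => w; rewrite !inE/=.
by rewrite (sv z) ?eqxx// !inE eqxx orbT.
Qed.

Lemma card_tree_walk N k :
  #|@tree_walk N k| = (dyck k 0 * N ^_ k./2.+1)%N.
Proof.
rewrite card_walk /tree_walk/=.
rewrite (eq_bigr (fun=> (dyck k 0 * N.-1 ^_ k./2)%N)); last first.
  by move=> x _; rewrite card_traversal//= subn1 subn0.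
by rewrite sum_nat_const card_ord ffactnS mulnCA.
Qed.

(** The ballot formula, cleared of denominators; for [h = 0] it identifies [dyck]
with the Catalan numbers. *)
Lemma dyck_ballot (j h : nat) :
  (dyck (j.*2 + h) h * (j + h).+1`! * j`! = h.+1 * (j.*2 + h)`!)%N.
Proof.
have [n] := ubnP (j.*2 + h); elim: n j h => // n IH [|j] [|h] le.
- by [].
- have := IH 0%N h; rewrite /= !add0n !muln1 => IH0.
  rewrite dyck_lt// add0n factS mulnCA IH0; last by lia.
  by rewrite (factS h) mulnA.
- have := IH j 1%N; rewrite doubleS !addn0 addn1 /= addn0 addn1 => IH1.
  have {}IH1 := IH1 ltac:(lia).
  set A := (_ + _)%N in IH1 *.
  have -> : (A * j.+2`! * j.+1`! = A * j.+2`! * j`! * j.+1)%N.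
    by rewrite (factS j); ring.
  rewrite IH1 (factS j.*2.+1); set F := _ `!.
  by rewrite -mul2n; ring.
- have IHa := IH j (h.+2) ltac:(lia).
  have IHb := IH (j.+1) h ltac:(lia).
  have E1 : (j.+1.*2 + h.+1 = (j.*2 + h.+2).+1)%N by lia.
  have E2 : (j.+1.*2 + h = j.*2 + h.+2)%N by lia.
  have E3 : ((j + h.+2).+1 = (j.+1 + h).+2)%N by lia.
  have E4 : ((j.+1 + h.+1).+1 = (j.+1 + h).+2)%N by lia.
  rewrite {}E2 in IHb; rewrite {}E3 in IHa; rewrite {}E1 {}E4.
  rewrite [dyck _.+1 _]/=.
  set A := dyck _ _ in IHa *; set B := dyck _ _ in IHb *.
  have -> : ((A + B) * (j.+1 + h).+2`! * j.+1`! =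
      (A * (j.+1 + h).+2`! * j`!) * j.+1 +
      (B * (j.+1 + h).+1`! * j.+1`!) * (j.+1 + h).+2)%N.
    by rewrite (factS (j.+1 + h).+1) (factS j); ring.
  rewrite IHa IHb (factS (j.*2 + h.+2)); set F := _ `!.
  by rewrite -mul2n; ring.
Qed.

Lemma dyck_odd (k h : nat) : odd (k + h) -> dyck k h = 0%N.
Proof.
elim: k h => [|k IH] [|h]//= kh; rewrite !IH//; move: kh; rewrite !addnS//=.
by rewrite negbK.
Qed.

Lemma dyck_le k h : (dyck k h <= 2 ^ k)%N.
Proof.
elim: k h => [|k IH] h /=; first by case: h.
rewrite expnS mul2n -addnn leq_add//; by case: h.
Qed.

Section WalkPairs.
Local Open Scope nat_scope.
Variables (N : nat) (e : 'I_N -> 'I_N -> nat).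
Hypothesis e_inj : forall x y x' y', e x y = e x' y' ->
  (x = x' /\ y = y') \/ (x = y' /\ y = x').
Variables (k : nat) (sigma n : seq nat).
Hypothesis sigmaP : perm_eq sigma (iota 0 (k + k)).

Local Notation mate := (mate sigma).
Let ekk : ~~ odd (k + k). Proof. by rewrite addnn odd_double. Qed.

Let mlt (l : nat) : l < k + k -> mate l < k + k := mate_lt ekk sigmaP (l := l).
Let mK (l : nat) : l < k + k -> mate (mate l) = l := mateK ekk sigmaP (l := l).
Let mneq (l : nat) : l < k + k -> mate l != l := mate_neq ekk sigmaP (l := l).

(* The two walks one after the other: the vertices 0, ..., k are those of the first
walk and k+1, ..., 2k+1 those of the second; there is no step from k to k+1, so the
edge of number l starts at the vertex [src l]. *)
Let vtx (pq : walk N k * walk N k) (i : nat) : 'I_N :=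
  if i <= k then vertex pq.1 i else vertex pq.2 (i - k.+1).
Let src (l : nat) : nat := if l < k then l else l.+1.
Let edges2 (pq : walk N k * walk N k) : seq nat := edges e pq.1 ++ edges e pq.2.

Let vtx_lo pq i : i <= k -> vtx pq i = vertex pq.1 i.
Proof. by rewrite /vtx => ->. Qed.

Let vtx_hi pq i : vtx pq (k + i).+1 = vertex pq.2 i.
Proof. by rewrite /vtx ltnNge leq_addr subSS addKn. Qed.

Let src_lo l : l < k -> src l = l.
Proof. by rewrite /src => ->. Qed.

Let src_hi l : k <= l -> src l = l.+1.
Proof. by rewrite /src ltnNge => ->. Qed.

Let nth_edges2 pq l : l < k + k ->
  nth 0 (edges2 pq) l = e (vtx pq (src l)) (vtx pq (src l).+1).
Proof.
move=> lk; rewrite /edges2 nth_cat size_edges.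
case: ltnP => lk'; first by rewrite src_lo// !vtx_lo ?nth_edges// ltnW.
rewrite src_hi// -(subnKC lk') vtx_hi -addnS vtx_hi addKn nth_edges//; lia.
Qed.

(** A priori two walks have two starting points and [k] first steps of pairs. If some
edge of the second walk is determined by the first walk,
then the second walk can be read from that edge, forward to its end and backward
to its start, which saves the choice of its starting point. *)
Lemma card_linked_pairs (P : pred (walk N k * walk N k)) l l' : l < k -> l' < k ->
  (forall pq, P pq -> paired (k + k) sigma n (edges e pq.1 ++ edges e pq.2)) ->
  (forall pq pq', P pq -> P pq' ->
    nth 0 (edges e pq.1) l = nth 0 (edges e pq'.1) l ->
    nth 0 (edges e pq.2) l' = nth 0 (edges e pq'.2) l') ->
  #|P| <= N ^ k.+1 * (2 ^ k * 2 ^ k).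
Proof.
move=> lk l'k hP link; pose L := k + l'.
have LK : L < k + k by rewrite /L ltn_add2l.
(* the first walk is read forward, the second one forward after the step [L] and
then backward before it; in each case this is the vertex reached by the step of the pair
that is met first *)
pose far v := if v < k then v.+1 else if L < v then v.+2
  else if L < mate v then (mate v).+2 else (mate v).+1.
pose places := 0 :: [seq far v | v <- iota 0 (k + k) & v < mate v].
have size_places : size places = k.+1.
  by rewrite /= size_map size_filter (count_openers ekk sigmaP) addnn doubleK.
have := @card_code _ _ _ P
  (fun p => [tuple vtx p (nth 0 places i) | i < k.+1])
  (fun p => (orientation p.1, orientation p.2)).
rewrite card_tuple card_prod !card_ffun card_bool !card_ord.
apply=> p q hp hq f [ori1 ori2]; have pp := hP _ hp; have pq := hP _ hq.
have freeE i : i \in places -> vtx p i = vtx q i.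
  move=> iF; have jF : index i places < k.+1 by rewrite -size_places index_mem.
  have := congr1 (fun t : (k.+1).-tuple _ => tnth t (Ordinal jF)) f.
  by rewrite !tnth_mktuple/= nth_index.
have farE v : v < k + k -> v < mate v -> vtx p (far v) = vtx q (far v).
  move=> vk ov; apply: freeE; rewrite inE/=; apply/orP; right.
  by apply/mapP; exists v => //; rewrite mem_filter ov mem_iota/= add0n.
have edgeE v : v < k + k -> nth 0 (edges2 p) v = nth 0 (edges2 q) v ->
    vtx p (src v) = vtx q (src v) /\ vtx p (src v).+1 = vtx q (src v).+1.
  move=> vk; rewrite /edges2 !nth_cat !size_edges.
  case: ltnP => vk'.
    by rewrite src_lo// !vtx_lo ?(ltnW vk')//; exact: edge_ends.
  have vk2 : v - k < k by lia.
  rewrite src_hi// -(subnKC vk') !vtx_hi -addnS !vtx_hi addKn.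
  exact: edge_ends.
have step v : v < k + k -> vtx p (src (mate v)) = vtx q (src (mate v)) ->
    vtx p (src (mate v)).+1 = vtx q (src (mate v)).+1 ->
    vtx p (src v) = vtx q (src v) /\ vtx p (src v).+1 = vtx q (src v).+1.
  move=> vk h1 h2; apply: edgeE => //.
  apply: (paired_mate ekk sigmaP pp pq vk).
  by rewrite -!/(edges2 _) !nth_edges2 ?mlt// h1 h2.
have first i : i <= k -> vtx p i = vtx q i.
  have [h] := ubnP i; elim: h i => // h IH [|v] vh vk.
    by apply: freeE; rewrite inE eqxx.
  have IH' j : j <= v -> vtx p j = vtx q j by move=> jv; apply: IH; lia.
  have vkk : v < k + k by lia.
  have [ov|cv] := ltnP v (mate v).
    by have := farE v vkk ov; rewrite /far vk.
  have mv : mate v < v by have := mneq vkk; lia.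
  have := step v vkk; rewrite !src_lo ?(ltn_trans mv)//.
  by move=> [] //; apply: IH'; lia.
have linkE : vtx p L.+1 = vtx q L.+1 /\ vtx p L.+2 = vtx q L.+2.
  have := edgeE L LK; rewrite src_hi; last by lia.
  have kL : (L < k) = false by lia.
  apply; rewrite /edges2 !nth_cat !size_edges kL /L addKn; apply: link => //.
  have := first _ (ltnW lk); have := first _ lk.
  by rewrite !vtx_lo ?(ltnW lk)// !nth_edges// => -> ->.
have low v : v < k -> vtx p v = vtx q v /\ vtx p v.+1 = vtx q v.+1.
  by move=> vk; split; apply: first => //; exact: ltnW.
have second_fwd i : L < i -> i <= k + k -> vtx p i.+1 = vtx q i.+1.
  have [h] := ubnP i; elim: h i => // h IH [//|v] vh Lv vk.
  have [->|vL] := eqVneq v L; first exact: linkE.2.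
  have {vL Lv} Lv : L < v by lia.
  have kv : k <= v by rewrite /L in Lv; lia.
  have IH' j : L <= j -> j < v -> vtx p j.+1 = vtx q j.+1 /\ vtx p j.+2 = vtx q j.+2.
    move=> Lj jv; split; last by apply: IH; lia.
    by have [->|?] := eqVneq j L; [exact: linkE.1|apply: IH; lia].
  have := step v vk; rewrite [src v]src_hi//.
  have [mk|km] := ltnP (mate v) k.
    by rewrite src_lo// => -[]; [exact: (low _ mk).1|exact: (low _ mk).2|].
  rewrite src_hi//.
  have [ov|cv] := ltnP v (mate v).
    by move=> _; have := farE v vk ov; rewrite /far ifF ?Lv//; lia.
  have mv : mate v < v by have := mneq vk; lia.
  have [Lm|mL] := leqP L (mate v).
    by have [h1 h2] := IH' _ Lm mv => -[].
  move=> _; have := farE (mate v) (mlt vk); rewrite mK// => /(_ mv).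
  by rewrite /far mK// Lv ifF ?ifF//; lia.
have second_bwd i : k <= i -> i <= L -> vtx p i.+1 = vtx q i.+1.
  have [h] := ubnP (L - i); elim: h i => // h IH i hi ki iL.
  have [->|iL'] := eqVneq i L; first exact: linkE.1.
  have {iL iL'} iL : i < L by lia.
  have ik : i < k + k by lia.
  have IH' j : i < j -> j < k + k -> vtx p j.+1 = vtx q j.+1 /\ vtx p j.+2 = vtx q j.+2.
    move=> ij jk; have aux u : i < u -> u <= k + k -> vtx p u.+1 = vtx q u.+1.
      by move=> iu uk; have [uL|Lu] := leqP u L; [apply: IH; lia|exact: second_fwd].
    by split; apply: aux; lia.
  have := step i ik; rewrite [src i]src_hi//.
  have [mk|km] := ltnP (mate i) k.
    by rewrite src_lo// => -[]; [exact: (low _ mk).1|exact: (low _ mk).2|].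
  rewrite src_hi//.
  have [om|cm] := ltnP i (mate i).
    by have [h1 h2] := IH' _ om (mlt ik) => -[].
  have mi : mate i < i by have := mneq ik; lia.
  move=> _; have := farE (mate i) (mlt ik); rewrite mK// => /(_ mi).
  by rewrite /far mK// !ifF//; lia.
case: p q hp hq {f freeE farE edgeE step ori1 ori2 pp pq linkE low}
  first second_fwd second_bwd => [p p'] [q q'] _ _ first fwd bwd.
congr (_, _); apply: eq_walk => i ik.
  by have := first i ik; rewrite !vtx_lo.
have : vtx (p, p') (k + i).+1 = vtx (q, q') (k + i).+1.
  have [iL|Li] := leqP (k + i) L; first by apply: bwd => //; rewrite leq_addr.
  by apply: fwd => //; rewrite leq_add2l.
by rewrite !vtx_hi.
Qed.

End WalkPairs.

(** * Weighted sums over walks *)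

Section WeightedSums.
Context {R : realFieldType}.
Implicit Types b : R.

Lemma geometric_sum_le b M : 0 <= b < 1 -> \sum_(j < M) b ^+ j <= (1 - b)^-1.
Proof.
move=> /andP[b0 b1]; have c0 : 0 < 1 - b by rewrite subr_gt0.
rewrite -[leRHS]mul1r ler_pdivlMr//.
have -> : (\sum_(j < M) b ^+ j) * (1 - b) = 1 - b ^+ M.
  by apply: oppr_inj; rewrite opprB subrX1; ring.
by rewrite lerBlDr lerDl exprn_ge0.
Qed.

(** The [h] statistics are summed out one after the other, each against its own
geometric series; [L] bounds the number of elements left in the end. *)
Lemma sum_geometric_fibers (T : finType) (P : pred T) (D : T -> seq nat)
    (h L : nat) b : 0 <= b < 1 ->
  (forall p, P p -> size (D p) = h) ->
  (forall s, #|[pred p | P p && (D p == s)]| <= L)%N ->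
  \sum_(p | P p) b ^+ sumn (D p) <= L%:R * (1 - b)^-1 ^+ h.
Proof.
move=> b01; elim: h P D => [|h IH] P D szD fib.
  rewrite expr0 mulr1 (eq_bigr (fun=> 1)); last first.
    by move=> p Pp; rewrite (size0nil (szD _ Pp)).
  rewrite sumr_const ler_nat; apply: leq_trans (fib [::]).
  apply/eq_leq/eq_card => p; rewrite !inE -topredE /=.
  by case: (boolP (P p)) => //= Pp; rewrite (size0nil (szD _ Pp)).
have b0 : 0 <= b by case/andP: b01.
pose hd p := head 0%N (D p).
pose M := (\max_(p | P p) hd p).+1.
rewrite (partition_big (fun p => inord (hd p) : 'I_M) xpredT)//=.
have hdE p : P p -> val (inord (hd p) : 'I_M) = hd p.
  by move=> Pp; rewrite /= inordK// /M ltnS; exact: leq_bigmax_cond.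
have step (j : 'I_M) :
    \sum_(p | P p && (inord (hd p) == j)) b ^+ sumn (D p) <=
    b ^+ j * (L%:R * (1 - b)^-1 ^+ h).
  rewrite (eq_bigr (fun p => b ^+ j * b ^+ sumn (behead (D p)))); last first.
    move=> p /andP[Pp /eqP hj]; rewrite -exprD; congr (_ ^+ _).
    have := hdE _ Pp; rewrite hj /hd; have := szD _ Pp.
    by case: (D p) => //= x s _ ->.
  rewrite -mulr_sumr ler_wpM2l ?exprn_ge0//; apply: IH.
    by move=> p /andP[Pp _]; rewrite size_behead szD.
  move=> s; apply: leq_trans (fib (val j :: s)).
  apply/subset_leq_card/fintype.subsetP => p; rewrite !inE => /andP[/andP[Pp /eqP hj] /eqP ds].
  rewrite Pp/=; have := hdE _ Pp; rewrite hj /hd; have := szD _ Pp.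
  by move: ds; case: (D p) => //= x s' -> _ ->.
apply: le_trans (ler_sum _ (fun j _ => step j)) _.
rewrite -mulr_suml exprS mulrCA; apply: ler_wpM2l => //.
apply: ler_wpM2r; last exact: geometric_sum_le.
by rewrite exprn_ge0// invr_ge0 subr_ge0 ltW//; case/andP: b01.
Qed.

(** The order of the entries is one of [k`!] permutations, so it may be fixed. *)
Lemma sum_sorting_perm (T : finType) (P : pred T) (s : T -> seq nat) (k : nat)
    (F : T -> R) (K : R) :
  (forall p, size (s p) = k) -> (forall p, 0 <= F p) ->
  (forall sigma, perm_eq sigma (iota 0 k) ->
    \sum_(p | P p && (sorting_perm (s p) == sigma)) F p <= K) ->
  \sum_(p | P p) F p <= (k`!)%:R * K.
Proof.
move=> sk F0 FK; pose perms := permutations (iota 0 k).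
have szp : size perms = k`! by rewrite size_permutations ?iota_uniq// size_iota.
apply: (@le_trans _ _ (\sum_(sigma <- perms)
    \sum_(p | P p && (sorting_perm (s p) == sigma)) F p)).
  rewrite (exchange_big_dep P)/=; last by move=> ? ? _ /andP[].
  apply: ler_sum => p Pp.
  have hp : sorting_perm (s p) \in perms.
    by rewrite mem_permutations -(sk p) sorting_permP.
  rewrite big_mkcond (bigD1_seq (sorting_perm (s p)))//= ?permutations_uniq//.
  by rewrite Pp eqxx /= lerDl sumr_ge0// => ? _; case: ifP.
rewrite big_seq; apply: (@le_trans _ _ (\sum_(sigma <- perms | sigma \in perms) K)).
  by apply: ler_sum => sigma; rewrite mem_permutations; exact: FK.
by rewrite -big_seq big_const_seq count_predT iter_addr addr0 szp mulr_natl.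
Qed.

Variables (c N : nat) (e : 'I_N -> 'I_N -> nat).
Hypothesis e_inj : forall x y x' y', e x y = e x' y' ->
  (x = x' /\ y = y') \/ (x = y' /\ y = x').
Hypothesis e_dist : forall i j d, (0 < d)%N ->
  (#|[pred x | (e i x - e x j) + (e x j - e i x) == d]| <= c)%N.

Lemma paired_edges k (p : walk N k) (sigma n : seq nat) : ~~ odd k ->
  sorting_perm (edges e p) = sigma -> gaps (edges e p) = n ->
  paired k sigma n (edges e p).
Proof.
by move=> ek <- <-; have := @paired_gaps (edges e p); rewrite size_edges; apply.
Qed.

(** A closed walk that is not a tree traversal fails in one of the three ways, at one
of boundedly many places, and each failure costs one of the [k/2 + 1] free vertices
of a tree traversal. *)
Lemma sum_not_tree_walk k b : ~~ odd k -> 0 <= b < 1 ->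
  \sum_(p : walk N k | closed p && ~~ tree_walk p) b ^+ gap_sum (edges e p) <=
  (k`! * ((k * k + k * k + k) * (2 ^ k * c.+1)))%:R * (1 - b)^-1 ^+ k./2
  * N%:R ^+ k./2.
Proof.
move=> ek b01; have b0 : 0 <= b by case/andP: b01.
rewrite natrM -!mulrA; apply: (@sum_sorting_perm _ _ (@edges N e k) k).
- by move=> p; rewrite size_edges.
- by move=> p; rewrite exprn_ge0.
move=> sigma sigmaP; rewrite (mulrC ((1 - b)^-1 ^+ _)) mulrA -natrX -natrM.
under eq_bigr do rewrite -sumn_gaps.
apply: sum_geometric_fibers => //.
  by move=> p _; rewrite size_mkseq size_edges.
move=> n; have mlt l := mate_lt ek sigmaP (l := l).
have mK l := mateK ek sigmaP (l := l); have mneq l := mate_neq ek sigmaP (l := l).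
pose Q (i : ('I_k * 'I_k) + ('I_k * 'I_k) + 'I_k) : pred (walk N k) :=
  fun p => [&& closed p, sorting_perm (edges e p) == sigma,
    gaps (edges e p) == n & match i with
    | inl (inl (m, r)) => revisits (mate sigma) p m r
    | inl (inr (l, m)) => crosses (mate sigma) p l m
    | inr l => mismatches e (mate sigma) p l
    end].
apply: leq_trans (@card_le_union _ _ _ Q (N ^ k./2 * (2 ^ k * c.+1)) _ _) _.
- move=> p /andP[/andP[/andP[cp tp] sp] gp]; apply/existsP; apply: contraR tp.
  rewrite negb_exists => /forallP none.
  have Qp i : Q i p = match i with
    | inl (inl (m, r)) => revisits (mate sigma) p m r
    | inl (inr (l, m)) => crosses (mate sigma) p l m
    | inr l => mismatches e (mate sigma) p l
    end by rewrite /Q cp sp gp.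
  apply: (@tree_walk_of_no_failure _ e e_inj k (mate sigma)) => //.
  + move=> m r mk; have [rk|kr] := ltnP r k.
      by have := none (inl (inl (Ordinal mk, Ordinal rk))); rewrite Qp.
    by rewrite /revisits; lia.
  + move=> l m lk; have [mk|km] := ltnP m k.
      by have := none (inl (inr (Ordinal lk, Ordinal mk))); rewrite Qp.
    by rewrite /crosses; lia.
  + by move=> l lk; have := none (inr (Ordinal lk)); rewrite Qp.
- have weak A : (A <= N ^ k./2 * 2 ^ k -> A <= N ^ k./2 * (2 ^ k * c.+1))%N.
    by move/leq_trans; apply; rewrite leq_mul2l leq_pmulr ?orbT.
  case=> [[[m r]|[l m]]|l].
  + have [/andP[om rm]|no] := boolP ((m < mate sigma m) && (r <= m))%N; last first.
      rewrite eq_card0// => p; apply/negP => /and4P[_ _ _ /and3P[om rm _]].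
      by rewrite om rm in no.
    apply: weak; apply: (card_revisit e_inj ek sigmaP (n := n) (ltn_ord m) om rm).
    move=> p /and4P[_ /eqP sp /eqP gp /and3P[_ _ /eqP ->]]; split=> //.
    exact: paired_edges.
  + have [/and3P[lm ml om]|no] :=
        boolP ([&& (mate sigma l < m), (m < l) & (m < mate sigma m)]%N); last first.
      rewrite eq_card0// => p; apply/negP => /and4P[_ _ _ /and4P[lm ml om _]].
      by rewrite lm ml om in no.
    apply: weak; apply: (card_crossing e_inj ek sigmaP (n := n) (ltn_ord l) lm ml om).
    move=> p /and4P[_ /eqP sp /eqP gp /and4P[_ _ _ /eqP ->]]; split=> //.
    exact: paired_edges.
  + have [/andP[ml ins]|no] := boolP ((mate sigma l < l) &&
        all (fun u => (mate sigma l < u) ==> (mate sigma l < mate sigma u < l))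
          (iota 0 l))%N; last first.
      rewrite eq_card0// => p; apply/negP => /and4P[_ _ _ /and4P[ml ins _ _]].
      by rewrite ml ins in no.
    apply: (card_mismatch e_inj ek sigmaP (n := n) e_dist (ltn_ord l) ml).
      move=> u /andP[lu ul]; have /allP/(_ u) := ins.
      by rewrite mem_iota add0n ul lu; apply.
    move=> p /and4P[cp /eqP sp /eqP gp /and4P[_ _ /eqP v_l ne]]; split=> //.
    exact: paired_edges.
by rewrite !card_sum !card_prod !card_ord (mulnC (N ^ _)%N) mulnA.
Qed.

(** Once their distance is fixed, two consecutive pairs of the sorted edges are
linked, which costs one of the [k/2 + 1] free vertices; the geometric weight makes
the sum over the distances converge. *)
Lemma sum_walk_close_pairs k m b : ~~ odd k -> 0 <= b < 1 -> (m.+1 < k./2)%N ->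
  \sum_(p : walk N k) b ^+ (gap_sum (edges e p) +
     (nth 0%N (sort leq (edges e p)) m.*2.+2 -
      nth 0%N (sort leq (edges e p)) m.*2))%N <=
  (k`! * 2 ^ k)%:R * (1 - b)^-1 ^+ k./2.+1 * N%:R ^+ k./2.
Proof.
move=> ek b01 mk; have b0 : 0 <= b by case/andP: b01.
rewrite natrM -!mulrA; apply: (@sum_sorting_perm _ _ (@edges N e k) k).
- by move=> p; rewrite size_edges.
- by move=> p; rewrite exprn_ge0.
move=> sigma sigmaP.
have sz : size sigma = k by rewrite (perm_size sigmaP) size_iota.
have us : uniq sigma by rewrite (perm_uniq sigmaP) iota_uniq.
have m2k : (m.*2.+2 < k)%N by lia.
rewrite (mulrC ((1 - b)^-1 ^+ _)) mulrA -natrX -natrM.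
pose D (p : walk N k) := (nth 0%N (sort leq (edges e p)) m.*2.+2 -
      nth 0%N (sort leq (edges e p)) m.*2)%N :: gaps (edges e p).
rewrite (eq_bigr (fun p => b ^+ sumn (D p))); last first.
  by move=> p _; rewrite /D/= sumn_gaps addnC.
apply: sum_geometric_fibers => //.
  by move=> p _; rewrite /= size_mkseq size_edges.
move=> [|d n]; first by rewrite eq_card0// => p; rewrite !inE andbF.
pose l := nth 0%N sigma m.*2; pose l' := nth 0%N sigma m.*2.+2.
have mem_s j : (j < k)%N -> (nth 0%N sigma j < k)%N.
  move=> jk; have : nth 0%N sigma j \in iota 0 k.
    by rewrite -(perm_mem sigmaP) mem_nth ?sz.
  by rewrite mem_iota.
have m1k : (m.*2 < k)%N by lia.
rewrite mulnC; apply: (card_linked e_inj ek sigmaP (n := n) (l := l) (l' := l') (d := d)).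
- exact: mem_s.
- exact: mem_s.
- by rewrite nth_uniq ?sz//; lia.
- rewrite /l (mate_nth sigmaP)// /flip odd_double nth_uniq ?sz//; lia.
move=> p /= /andP[/eqP sp]; rewrite /D => /eqP[dE gE]; split.
  exact: paired_edges.
rewrite /l /l' -sp.
have nthE j : (j < k)%N ->
    nth 0%N (edges e p) (nth 0%N (sorting_perm (edges e p)) j) =
    nth 0%N (sort leq (edges e p)) j.
  by move=> jk; rewrite sort_sorting_perm (nth_map 0%N) ?sp ?sz.
rewrite !nthE// -dE subnKC//.
apply: (sorted_leq_nth leq_trans leqnn);
  rewrite ?inE ?size_sort ?size_edges//; last by lia.
exact: sort_sorted leq_total _.
Qed.

(** Two independent walks with [k] steps have [k + 2] free vertices; a link between an
edge of one and an edge of the other costs one of them. *)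
Lemma sum_walk_pairs k l l' b : (l < k)%N -> (l' < k)%N -> 0 <= b < 1 ->
  \sum_(pq : walk N k * walk N k)
    b ^+ (gap_sum (edges e pq.1 ++ edges e pq.2) +
      ((nth 0%N (edges e pq.1) l - nth 0%N (edges e pq.2) l') +
       (nth 0%N (edges e pq.2) l' - nth 0%N (edges e pq.1) l)))%N <=
  ((k + k)`! * (2 * (2 ^ k * 2 ^ k)))%:R * (1 - b)^-1 ^+ k.+1 * N%:R ^+ k.+1.
Proof.
move=> lk l'k b01; have b0 : 0 <= b by case/andP: b01.
rewrite natrM -!mulrA.
apply: (@sum_sorting_perm _ _ (fun pq => edges e pq.1 ++ edges e pq.2) (k + k)).
- by move=> pq; rewrite size_cat !size_edges.
- by move=> p; rewrite exprn_ge0.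
move=> sigma sigmaP; have ekk : ~~ odd (k + k) by rewrite addnn odd_double.
rewrite (mulrC ((1 - b)^-1 ^+ _)) mulrA -natrX -natrM.
pose D (pq : walk N k * walk N k) :=
  ((nth 0%N (edges e pq.1) l - nth 0%N (edges e pq.2) l') +
   (nth 0%N (edges e pq.2) l' - nth 0%N (edges e pq.1) l))%N ::
  gaps (edges e pq.1 ++ edges e pq.2).
rewrite (eq_bigr (fun p => b ^+ sumn (D p))); last first.
  by move=> p _; rewrite /D/= sumn_gaps addnC.
apply: sum_geometric_fibers => //.
  by move=> p _; rewrite /= size_mkseq size_cat !size_edges addnn doubleK.
move=> [|d n]; first by rewrite eq_card0// => p; rewrite !inE andbF.
pose Q (s : bool) : pred (walk N k * walk N k) := fun pq =>
  [&& sorting_perm (edges e pq.1 ++ edges e pq.2) == sigma,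
    gaps (edges e pq.1 ++ edges e pq.2) == n &
    if s then nth 0%N (edges e pq.2) l' == (nth 0%N (edges e pq.1) l + d)%N
    else nth 0%N (edges e pq.1) l == (nth 0%N (edges e pq.2) l' + d)%N].
apply: leq_trans (@card_le_union _ _ _ Q (N ^ k.+1 * (2 ^ k * 2 ^ k)) _ _) _.
- move=> pq /= /andP[/eqP sp]; rewrite /D => /eqP[dE gE].
  have [le|lt] := leqP (nth 0%N (edges e pq.1) l) (nth 0%N (edges e pq.2) l').
    exists true; rewrite /Q sp gE !eqxx/= -dE; apply/eqP.
    by rewrite (eqP le) add0n subnKC.
  exists false; rewrite /Q sp gE !eqxx/= -dE; apply/eqP.
  by have /ltnW/eqP -> := lt; rewrite addn0 subnKC// ltnW.
- move=> s; apply: (card_linked_pairs e_inj sigmaP (n := n) lk l'k).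
    move=> pq /and3P[/eqP sp /eqP gp _]; rewrite -sp -gp.
    have := @paired_gaps (edges e pq.1 ++ edges e pq.2).
    by rewrite size_cat !size_edges; apply.
  move=> pq pq' /and3P[_ _ h] /and3P[_ _ h'] E; move: h h'.
  case: s => /eqP h /eqP h'; first by rewrite h h' E.
  by apply/eqP; rewrite -(eqn_add2r d) -h -h' E.
by rewrite card_bool mulnCA mulnC.
Qed.

End WeightedSums.

(** * The diagonal filling *)

Section DiagonalFilling.
Local Open Scope nat_scope.
Variable N : nat.

(** The diagonal at distance [a] from the main one has [N - a] positions. *)
Definition diag_size (d : nat) : nat := \sum_(a < d) (N - a).

Lemma diag_sizeS d : diag_size d.+1 = diag_size d + (N - d).
Proof. by rewrite /diag_size big_ord_recr. Qed.

Lemma diag_sizeE d : d <= N ->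
  diag_size d + ((N - d) * (N - d).+1)./2 = (N * N.+1)./2.
Proof.
elim: d => [|d IH] dN; first by rewrite /diag_size big_ord0 subn0.
rewrite diag_sizeS -IH; last exact: ltnW.
have -> : N - d = (N - d.+1).+1 by lia.
move: (N - d.+1) => n; rewrite -addnA; congr (_ + _).
have -> : n.+1 * n.+2 = n.+1.*2 + n * n.+1 by lia.
by rewrite halfD odd_double doubleK.
Qed.

Definition diagonals (m : nat) : seq (nat * nat) :=
  [seq (i, i + d) | d <- iota 0 m, i <- iota 1 (N - d)].

Lemma diagonalsS m :
  diagonals m.+1 = diagonals m ++ [seq (i, i + m) | i <- iota 1 (N - m)].
Proof.
by rewrite /diagonals -[m.+1]addn1 iotaD map_cat flatten_cat /= cats0.
Qed.

Lemma size_diagonals m : size (diagonals m) = diag_size m.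
Proof.
elim: m => [|m IH]; first by rewrite /diag_size big_ord0.
by rewrite diagonalsS size_cat IH size_map size_iota diag_sizeS.
Qed.

Lemma mem_diagonals m p : (p \in diagonals m) = (upper_triangle N p && (p.2 - p.1 < m)).
Proof.
case: p => j k; apply/allpairsPdep/idP => /=.
  move=> [d [i []]]; rewrite !mem_iota => /= dm iN [-> ->].
  by rewrite /upper_triangle/=; lia.
rewrite /upper_triangle/= => h; exists (k - j), j; rewrite !mem_iota/=; split.
- lia.
- lia.
- by congr (_, _); lia.
Qed.

Lemma uniq_diagonals m : uniq (diagonals m).
Proof.
elim: m => // m IH; rewrite diagonalsS cat_uniq IH /=.
rewrite map_inj_uniq ?iota_uniq ?andbT; last by move=> a b [].
apply/hasPn => _ /mapP[i _ ->]; rewrite mem_diagonals/=.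
by rewrite addKn ltnn andbF.
Qed.

Lemma index_diagonals m j k : 1 <= j -> j <= k -> k <= N -> k - j < m ->
  index (j, k) (diagonals m) = diag_size (k - j) + j.-1.
Proof.
move=> j1 jk kN; elim: m => // m IH; rewrite ltnS leq_eqVlt => dm.
rewrite diagonalsS index_cat mem_diagonals/=.
have [km|km] := ltnP (k - j) m.
  by rewrite ifT ?IH// /upper_triangle/=; lia.
rewrite andbF size_diagonals; have {km} mE : m = k - j by lia.
rewrite -mE; congr (_ + _).
have -> : (j, k) = (fun i => (i, i + m)) j by congr (_, _); lia.
rewrite index_map; last by move=> a b [].
have jE : nth 0 (iota 1 (N - m)) j.-1 = j by rewrite nth_iota; lia.
by rewrite -{1}jE index_uniq ?iota_uniq// size_iota; lia.
Qed.

Lemma diagonal_fillingE n : diagonal_filling N n = nth (0, 0) (diagonals N) n.-1.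
Proof. by []. Qed.

Lemma size_diagonals_full : size (diagonals N) = (N * N.+1)./2.
Proof. by rewrite size_diagonals -(diag_sizeE (leqnn N)) subnn mul0n addn0. Qed.

Lemma mem_diagonals_full p : (p \in diagonals N) = upper_triangle N p.
Proof.
rewrite mem_diagonals /upper_triangle; apply: andb_idr.
by case: p => j k /=; lia.
Qed.

Lemma diagonal_filling_bij :
  set_bij [set n : nat | 1 <= n <= (N * N.+1)./2]
          [set p : nat * nat | upper_triangle N p] (diagonal_filling N).
Proof.
split.
- move=> n /= nN; rewrite -mem_diagonals_full diagonal_fillingE mem_nth//.
  by rewrite size_diagonals_full; lia.
- move=> a b /set_mem/= aN /set_mem/= bN; rewrite !diagonal_fillingE => /eqP.
  rewrite nth_uniq ?uniq_diagonals ?size_diagonals_full//.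
  - by move/eqP; lia.
  - by lia.
  - by lia.
- move=> p /=; rewrite -mem_diagonals_full => pd.
  exists (index p (diagonals N)).+1; last by rewrite diagonal_fillingE nth_index.
  by rewrite /= -size_diagonals_full index_mem.
Qed.

Lemma filling_inv_diagonal p : upper_triangle N p ->
  filling_inv N (diagonal_filling N) p = diag_size (p.2 - p.1) + p.1.
Proof.
move=> up; have pd := up; rewrite -mem_diagonals_full in pd.
have pN : index p (diagonals N) < (N * N.+1)./2.
  by rewrite -size_diagonals_full index_mem.
rewrite /filling_inv (@eq_in_filter _ _ (pred1 (index p (diagonals N)).+1)).
  rewrite filter_pred1_uniq ?iota_uniq ?mem_iota//=.
  move: up; rewrite /upper_triangle => /andP[/andP[p1 p12] p2].
  rewrite [p]surjective_pairing index_diagonals//=; lia.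
move=> n; rewrite mem_iota => nN /=; rewrite diagonal_fillingE.
rewrite -[in LHS](nth_index (0, 0) pd) nth_uniq ?uniq_diagonals ?size_diagonals_full//; lia.
Qed.

Lemma filling_inv_diagonal_index j k : 1 <= j -> j <= k -> k <= N ->
  filling_inv N (diagonal_filling N) (j, k) = diagonal_index N j k.
Proof.
move=> j1 jk kN; rewrite filling_inv_diagonal /= ?/upper_triangle ?j1 ?jk//.
rewrite /diagonal_index (_ : absdiff j k = k - j); last by rewrite /absdiff; lia.
have dN : k - j <= N by lia.
rewrite addn1 -(diag_sizeE dN) addnK; congr (_ + _); lia.
Qed.

(** The number of the matrix entry at (x, y): the diagonals before its own, then its
place on the diagonal. *)
Definition diag_edge (x y : nat) : nat := diag_size (maxn x y - minn x y) + minn x y.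

Lemma filling_inv_ordered x y : 1 <= x <= N -> 1 <= y <= N ->
  filling_inv N (diagonal_filling N) (ordered (x, y)) = diag_edge x y.
Proof.
by move=> xN yN; rewrite filling_inv_diagonal// /upper_triangle /ordered/=; lia.
Qed.

Lemma diag_edgeC x y : diag_edge x y = diag_edge y x.
Proof. by rewrite /diag_edge maxnC minnC. Qed.

Lemma diag_edge_inj x y x' y' :
  1 <= x <= N -> 1 <= y <= N -> 1 <= x' <= N -> 1 <= y' <= N ->
  diag_edge x y = diag_edge x' y' -> (x = x' /\ y = y') \/ (x = y' /\ y = x').
Proof.
move=> xN yN x'N y'N; rewrite -!filling_inv_ordered//.
have up a b : 1 <= a <= N -> 1 <= b <= N -> ordered (a, b) \in diagonals N.
  by move=> aN bN; rewrite mem_diagonals_full /upper_triangle /ordered/=; lia.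
have fE a b : 1 <= a <= N -> 1 <= b <= N ->
    filling_inv N (diagonal_filling N) (ordered (a, b)) =
    (index (ordered (a, b)) (diagonals N)).+1.
  move=> aN bN; rewrite filling_inv_ordered// /diag_edge /ordered/=.
  by rewrite index_diagonals; lia.
rewrite !fE// => -[/(congr1 (nth (0, 0) (diagonals N)))].
rewrite !nth_index ?up// /ordered/= => -[]; lia.
Qed.

(** The increments [N - d] of [diag_size] decrease by one at every step; moving from
[t] to [t' > t] thus lowers the increment over a length [c] by at least [c]. *)
Lemma diag_size_concave t t' c : t < t' -> t' + c <= N ->
  diag_size (t' + c) + diag_size t + c <= diag_size (t + c) + diag_size t'.
Proof.
have step u : u + c <= N ->
    diag_size (u.+1 + c) + diag_size u + c = diag_size (u + c) + diag_size u.+1.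
  by move=> uN; rewrite addSn !diag_sizeS; lia.
elim: t' => // t' IH; rewrite ltnS leq_eqVlt => /orP[/eqP<-|tt'] tN.
  by rewrite step//; lia.
have := IH tt' ltac:(lia); have := step t' ltac:(lia); lia.
Qed.

Lemma diag_size_growth t c : t + c <= N -> diag_size t + c <= diag_size (t + c).
Proof.
elim: c => [|c IH] tN; first by rewrite !addn0.
by rewrite (addnS t c) diag_sizeS; have := IH ltac:(lia); lia.
Qed.

Lemma count_le1 (P : pred nat) (s : seq nat) : uniq s ->
  {in s &, forall x y, x < y -> P x -> P y -> False} -> count P s <= 1.
Proof.
move=> us inj; rewrite -size_filter leqNgt; apply/negP.
have : uniq [seq x <- s | P x] by rewrite filter_uniq.
have : {subset [seq x <- s | P x] <= s} by move=> x; rewrite mem_filter => /andP[].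
have : all P [seq x <- s | P x] by rewrite filter_all.
case: [seq x <- s | P x] => [|x [|y r]]//= /and3P[Px Py _] sub.
rewrite !inE !negb_or => /andP[/andP[xy _] _] _.
have xs : x \in s by apply: sub; rewrite !inE eqxx.
have ys : y \in s by apply: sub; rewrite !inE eqxx orbT.
by have [lt|gt|/eqP] := ltngtP x y; [exact: (inj x y)|exact: (inj y x)|rewrite (negbTE xy)].
Qed.

(** For i < j, the difference of the positions of (i, x) and (x, j) is strictly
monotone in x on each of the three ranges cut out by i and j; it keeps its sign on
the outer two, so a given absolute difference is reached at most four times. *)
Lemma count_diag_edge_lt i j n : 1 <= i -> i < j -> j <= N -> 0 < n ->
  count (fun x => absdiff (diag_edge i x) (diag_edge x j) == n) (iota 1 N) <= 4.
Proof.
move=> i1 ij jN n0; pose P1 x := (x <= i) && (diag_edge x j == diag_edge i x + n).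
pose P2 x := [&& i < x, x < j & diag_edge x j == diag_edge i x + n].
pose P3 x := [&& i < x, x < j & diag_edge i x == diag_edge x j + n].
pose P4 x := (j <= x) && (diag_edge i x == diag_edge x j + n).
have lowE x : x <= i -> diag_edge x j = diag_size (j - x) + x /\
    diag_edge i x = diag_size (i - x) + x.
  move=> xi; have xj : x <= j by lia.
  by rewrite /diag_edge (maxn_idPr xj) (minn_idPl xj) (maxn_idPl xi) (minn_idPr xi).
have midE x : i < x -> x < j -> diag_edge x j = diag_size (j - x) + x /\
    diag_edge i x = diag_size (x - i) + i.
  move=> /ltnW ix /ltnW xj.
  by rewrite /diag_edge (maxn_idPr xj) (minn_idPl xj) (maxn_idPr ix) (minn_idPl ix).
have upE x : j <= x -> diag_edge x j = diag_size (x - j) + j /\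
    diag_edge i x = diag_size (x - i) + i.
  move=> jx; have ix : i <= x by lia.
  by rewrite /diag_edge (maxn_idPl jx) (minn_idPr jx) (maxn_idPr ix) (minn_idPl ix).
have growth a b : a <= b -> b <= N -> diag_size a + (b - a) <= diag_size b.
  by move=> ab bN; have := @diag_size_growth a (b - a); rewrite subnKC//; apply.
have sub x : x \in iota 1 N -> absdiff (diag_edge i x) (diag_edge x j) == n ->
    [|| P1 x, P2 x, P3 x | P4 x].
  rewrite mem_iota /absdiff => xN xn; rewrite /P1 /P2 /P3 /P4.
  have [xi|ix] := leqP x i.
    have [E1 E2] := lowE _ xi; have := growth (i - x) (j - x); lia.
  have [jx|xj] := leqP j x; last by lia.
  have [E1 E2] := upE _ jx; have := growth (x - j) (x - i); lia.
apply: (@leq_trans (count P1 (iota 1 N) + (count P2 (iota 1 N) +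
    (count P3 (iota 1 N) + count P4 (iota 1 N))))).
  apply: (@leq_trans (count (predU P1 (predU P2 (predU P3 P4))) (iota 1 N))).
    by rewrite -!size_filter; apply: uniq_leq_size;
      rewrite ?filter_uniq ?iota_uniq// => x; rewrite !mem_filter => /andP[h xN];
      rewrite xN andbT; exact: sub.
  have countU (P Q : pred nat) s : count (predU P Q) s <= count P s + count Q s.
    by rewrite -count_predUI leq_addr.
  by do 3! [apply: leq_trans (countU _ _ _) _; rewrite leq_add2l].
have uN := iota_uniq 1 N.
have c1 : count P1 (iota 1 N) <= 1.
  apply: count_le1 => // x y; rewrite !mem_iota => xN yN xy.
  rewrite /P1 => /andP[xi /eqP Ex] /andP[yi /eqP Ey].
  have [E1 E2] := lowE _ xi; have [E3 E4] := lowE _ yi.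
  have := @diag_size_concave (i - y) (i - x) (j - i).
  have -> : i - x + (j - i) = j - x by lia.
  have -> : i - y + (j - i) = j - y by lia.
  by move=> /(_ ltac:(lia) ltac:(lia)); lia.
have c4 : count P4 (iota 1 N) <= 1.
  apply: count_le1 => // x y; rewrite !mem_iota => xN yN xy.
  rewrite /P4 => /andP[jx /eqP Ex] /andP[jy /eqP Ey].
  have [E1 E2] := upE _ jx; have [E3 E4] := upE _ jy.
  have := @diag_size_concave (x - j) (y - j) (j - i).
  have -> : x - j + (j - i) = x - i by lia.
  have -> : y - j + (j - i) = y - i by lia.
  by move=> /(_ ltac:(lia) ltac:(lia)); lia.
have mono x y : i < x -> x < y -> y < j ->
    diag_edge i x < diag_edge i y /\ diag_edge y j <= diag_edge x j.
  move=> ix xy yj; have [E1 E2] := midE x ix ltac:(lia).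
  have [E3 E4] := midE y ltac:(lia) yj.
  have := growth (x - i) (y - i) ltac:(lia) ltac:(lia).
  have := growth (j - y) (j - x) ltac:(lia) ltac:(lia).
  by lia.
have c2 : count P2 (iota 1 N) <= 1.
  apply: count_le1 => // x y _ _ xy /and3P[ix xj /eqP Ex] /and3P[iy yj /eqP Ey].
  by have := mono x y ix xy yj; lia.
have c3 : count P3 (iota 1 N) <= 1.
  apply: count_le1 => // x y _ _ xy /and3P[ix xj /eqP Ex] /and3P[iy yj /eqP Ey].
  by have := mono x y ix xy yj; lia.
by rewrite -[4]/(1 + (1 + (1 + 1))) !leq_add.
Qed.

(** The distance is symmetric in i and j, and it is 0 for i = j. *)
Lemma num_at_dist_diagonal_le4 i j n : 1 <= i <= N -> 1 <= j <= N -> 0 < n ->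
  num_at_dist N (diagonal_filling N) i j n <= 4.
Proof.
move=> iN jN n0; rewrite /num_at_dist.
rewrite (@eq_in_count _ _ (fun x => absdiff (diag_edge i x) (diag_edge x j) == n)); last first.
  by move=> x; rewrite mem_iota => xN; rewrite /filling_dist !filling_inv_ordered//; lia.
have [ij|ji|->] := ltngtP i j.
- by apply: count_diag_edge_lt => //; lia.
- rewrite (eq_count (a2 := fun x =>
    absdiff (diag_edge j x) (diag_edge x i) == n)).
    by apply: count_diag_edge_lt => //; lia.
  move=> x /=; rewrite (diag_edgeC i) (diag_edgeC x j) /absdiff.
  by congr (_ == _); lia.
- rewrite (@eq_count _ _ pred0) ?count_pred0// => x /=.
  by rewrite diag_edgeC /absdiff; lia.
Qed.

End DiagonalFilling.

(** * Traces and the empirical spectral measure *)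

Lemma char_poly_conj (F : fieldType) (n : nat) (P D : 'M[F]_n) : P \in unitmx ->
  char_poly (invmx P *m D *m P) = char_poly D.
Proof.
move=> uP; rewrite /char_poly.
have PQ : map_mx polyC (invmx P) *m map_mx polyC P = 1%:M :> 'M[{poly F}]_n.
  by rewrite -map_mxM mulVmx// map_mx1.
have -> : char_poly_mx (invmx P *m D *m P) =
    map_mx polyC (invmx P) *m char_poly_mx D *m map_mx polyC P.
  rewrite /char_poly_mx mulmxBr mulmxBl !map_mxM/=; congr (_ - _).
  by rewrite scalar_mxC -mulmxA PQ mulmx1.
by rewrite !det_mulmx mulrAC -det_mulmx PQ det1 mul1r.
Qed.

Lemma exprmx_conj (F : fieldType) (n : nat) (P D : 'M[F]_n) k : P \in unitmx ->
  (invmx P *m D *m P) ^+ k = invmx P *m (D ^+ k) *m P.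
Proof.
move=> uP; elim: k => [|k IH]; first by rewrite !expr0 mulmx1 mulVmx.
rewrite !exprS IH -!mulmxE; rewrite !mulmxA; congr (_ *m _ *m _).
by rewrite -!mulmxA mulmxV// mulmx1.
Qed.

Lemma expr_diag_mx (F : fieldType) (n : nat) (d : 'rV[F]_n) k :
  diag_mx d ^+ k = diag_mx (map_mx (fun x => x ^+ k) d).
Proof.
elim: k => [|k IH].
  by apply/matrixP => i j; rewrite expr0 !mxE.
rewrite exprS IH -mulmxE; apply/matrixP => i j; rewrite mul_diag_mx !mxE.
by case: eqP => [->|]; rewrite ?mulr1n ?exprS// !mulr0n mulr0.
Qed.

Section SymmetricSpectrum.
Context {R : realType}.

(** The spectral theorem over the complex numbers, read back over the reals. *)
Lemma symmetric_spectrum (n : nat) (A : 'M[R]_n) : A^T = A ->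
  exists s : seq R, [/\ size s = n,
    char_poly A = \prod_(x <- s) ('X - x%:P) &
    forall k, \sum_(x <- s) x ^+ k = \tr (A ^+ k)].
Proof.
move=> sA; pose f := real_complex R; pose B : 'M[R[i]]_n := map_mx f A.
have hB : B \is hermsymmx.
  apply: realsym_hermsym; last first.
    by apply/mxOverP => i j; rewrite mxE; apply/complex_realP; exists (A i j).
  by apply/is_hermitianmxP; rewrite expr0 scale1r map_mx_id//;
     apply/matrixP => i j; rewrite !mxE -[in LHS]sA mxE.
have /orthomx_spectralP BE := hermitian_normalmx hB.
have dre := hermitian_spectral_diag_real hB.
have uP := spectral_unit B.
move: (spectralmx B) (spectral_diag B) uP BE dre => P d uP BE dre.
pose s := [seq complex.Re (d 0 i) | i <- enum 'I_n].
have dE i : d 0 i = f (complex.Re (d 0 i)).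
  by rewrite /f RRe_real//; apply: (mxOverP dre).
exists s; split.
- by rewrite size_map size_enum_ord.
- apply: (map_poly_inj f); rewrite map_char_poly/=.
  rewrite -/B BE char_poly_conj// char_poly_trig ?diag_mx_is_trig//.
  rewrite rmorph_prod/= big_map big_enum/=; apply: eq_bigr => i _.
  by rewrite rmorphB/= map_polyX map_polyC/= !mxE eqxx mulr1n dE.
- move=> k; apply: (fmorph_inj f); rewrite rmorph_sum/= big_map big_enum/=.
  rewrite -trace_map_mx rmorphXn/= -/B BE exprmx_conj// -mulmxA mxtrace_mulC.
  rewrite -mulmxA mulmxV// mulmx1 expr_diag_mx mxtrace_diag.
  by apply: eq_bigr => i _; rewrite !mxE [in RHS]dE -rmorphXn.
Qed.

Lemma eigenvalues_spec (n : nat) (A : 'M[R]_n) : A^T = A ->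
  size (eigenvalues A) = n /\
  forall k, \sum_(x <- eigenvalues A) x ^+ k = \tr (A ^+ k).
Proof.
move=> /symmetric_spectrum[s [sn cp tk]].
have : perm_eq (eigenvalues A) s.
  apply: prod_XsubC_eq; rewrite -cp /eigenvalues; case: xgetP => [t _ [_ ->]//|].
  move=> /(_ (sort <=%R s)) []; split; first exact: sort_le_sorted.
  by rewrite cp; apply: perm_big; rewrite perm_sym perm_sort.
move=> ps; split; first by rewrite (perm_size ps).
by move=> k; rewrite (perm_big _ ps) tk.
Qed.

End SymmetricSpectrum.

(** * Moments of the semicircle law *)

Section Semicircle.
Context {R : realType}.
Local Notation mu := (@lebesgue_measure R).
Implicit Types x : R.

Let u x : R := Num.sqrt (4 - x ^+ 2).

Let u_cont : continuous u.
Proof.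
move=> x; apply: (continuous_comp (f := fun y : R => 4 - y ^+ 2)).
  by apply: cvgB; [exact: cvg_cst | exact: exprn_continuous].
exact: sqrt_continuous.
Qed.

Let u_gt0 x : -2 < x < 2 -> 0 < u x.
Proof. by move=> /andP[x1 x2]; rewrite /u sqrtr_gt0; nra. Qed.

Let u_sqr x : -2 < x < 2 -> u x ^+ 2 = 4 - x ^+ 2.
Proof. by move=> /andP[x1 x2]; rewrite /u sqr_sqrtr//; nra. Qed.

Let is_derive_u x : -2 < x < 2 -> is_derive x 1 u (- x / u x).
Proof.
move=> x2; have p : 0 < 4 - x ^+ 2 by have := u_gt0 x2; rewrite /u sqrtr_gt0.
have d1 : is_derive x 1 (fun y : R => 4 - y ^+ 2) (- (2 * x)).
  by apply: is_derive_eq; rewrite /GRing.scale/=; ring.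
have d2 := is_derive1_sqrt p.
have := @is_derive1_comp _ Num.sqrt (fun y : R => 4 - y ^+ 2) x _ _ d2 d1.
by move=> h; apply: (is_derive_eq h); rewrite /u invfM; lra.
Qed.

Let FTC (F f : R -> R) : continuous F -> continuous f ->
  (forall x, -2 < x < 2 -> is_derive x 1 F (f x)) ->
  \int[mu]_(x in `[-2, 2]) f x = F 2 - F (-2).
Proof.
move=> cF cf dF; rewrite /Rintegral (@continuous_FTC2 R f F)//.
- by lra.
- exact: continuous_subspaceT.
- split => [x x2| |].
  + by have := dF x; rewrite in_itv/= in x2 => /(_ x2) [].
  + exact/cvg_at_right_filter/cF.
  + exact/cvg_at_left_filter/cF.
- move=> x x2; rewrite in_itv/= in x2; rewrite derive1E.
  by have [_] := dF x x2.
Qed.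

Definition semicircle_moment_integral (k : nat) : R :=
  \int[mu]_(x in `[-2, 2]) (x ^+ k * u x).
Local Notation J := semicircle_moment_integral.

Let xu_cont k : continuous (fun x => x ^+ k * u x).
Proof. by move=> x; apply: cvgM; [exact: exprn_continuous|exact: u_cont]. Qed.

Let u3_cont : continuous (fun x => u x ^+ 3).
Proof.
move=> x; apply: (@continuous_comp _ _ _ u (fun y => y ^+ 3)); first exact: u_cont.
exact: exprn_continuous.
Qed.

(* Half the area of a disc. The primitive uses atan (x / (2 + u x)), half of the
angle, because this is smooth up to the ends of the interval. *)
Let J0 : J 0 = 2 * pi.
Proof.
have u0 x : 0 <= u x by rewrite /u sqrtr_ge0.
pose q x := x / (2 + u x).
have cq : continuous q.
  move=> x; apply: cvgM; first exact: cvg_id.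
  apply: cvgV; first by have := u0 x; lra.
  by apply: cvgD; [exact: cvg_cst|exact: u_cont].
rewrite /J; under eq_Rintegral do rewrite expr0 mul1r.
pose F x := x * u x / 2 + 4 * atan (q x).
transitivity (F 2 - F (-2)).
  apply: (@FTC F u); last 1 first.
  - move=> x x2; have du := is_derive_u x2; have := u_gt0 x2 => ux.
    have ux2 := u_sqr x2; have ux0 : u x != 0 by rewrite gt_eqF.
    have ux2' : 2 + u x != 0 by rewrite gt_eqF//; lra.
    have x2E : x ^+ 2 = 4 - u x ^+ 2 by lra.
    have dq : is_derive x 1 q (2 / (u x * (2 + u x))).
      apply: is_derive_eq; rewrite /GRing.scale/=.
      transitivity (x ^+ 2 / (u x * (2 + u x) ^+ 2) + (2 + u x)^-1).
        by field; rewrite ux0 ux2'.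
      by rewrite x2E; field; rewrite ux0 ux2'.
    have datan := @is_derive1_comp R atan q x _ _ (is_derive1_atan _) dq.
    apply: is_derive_eq; rewrite /GRing.scale/=.
    have -> : (1 + q x ^+ 2)^-1 = (2 + u x) / 4.
      have -> : 1 + q x ^+ 2 = 4 / (2 + u x).
        rewrite /q expr_div_n (_ : x ^+ 2 = 4 - u x ^+ 2); last by lra.
        by field.
      by rewrite invf_div.
    rewrite mulr1 (_ : x * (- x / u x) = (u x ^+ 2 - 4) / u x); last first.
      by rewrite ux2 mulrA mulrN -expr2; congr (_ / _); ring.
    by field; rewrite ux0 ux2'.
  - move=> x; apply: cvgD; apply: cvgM.
    + by apply: cvgM; [exact: cvg_id|exact: u_cont].
    + exact: cvg_cst.
    + exact: cvg_cst.
    + by apply: (continuous_comp (@cq x)); exact: continuous_atan.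
  - exact: u_cont.
have u2 : u 2 = 0 by rewrite /u (_ : 4 - _ = 0) ?sqrtr0//; ring.
have u2' : u (-2) = 0 by rewrite /u (_ : 4 - _ = 0) ?sqrtr0//; ring.
rewrite /F /q u2 u2' addr0 !mulr0 mulNr divff ?pnatr_eq0//.
by rewrite atanN atan1; lra.
Qed.

(* The integrand is the derivative of - (u ^ 3) / 3. *)
Let J1 : J 1 = 0.
Proof.
pose F x := - (u x ^+ 3) / 3.
transitivity (F 2 - F (-2)).
  apply: (@FTC F (fun x => x ^+ 1 * u x)); last 1 first.
  - move=> x x2; have du := is_derive_u x2; have ux := u_gt0 x2.
    apply: is_derive_eq; rewrite /GRing.scale/=; field; lra.
  - move=> x; apply: cvgM; last exact: cvg_cst.
    by apply: cvgN; exact: u3_cont.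
  - exact: xu_cont.
by rewrite /F /u sqrrN subrr.
Qed.

(* Integration of the derivative of x ^ (k + 1) * u ^ 3, which vanishes at both ends. *)
Let J_rec k : (k + 4)%:R * J k.+2 = 4 * (k.+1)%:R * J k.
Proof.
pose F x := x ^+ k.+1 * u x ^+ 3.
pose f x := 4 * (k.+1)%:R * (x ^+ k * u x) - (k + 4)%:R * (x ^+ k.+2 * u x).
have cf : continuous f.
  by move=> x; apply: cvgB; apply: cvgM; try exact: cvg_cst; exact: xu_cont.
have : \int[mu]_(x in `[-2, 2]) f x = F 2 - F (-2).
  apply: FTC => //.
  - by move=> x; apply: cvgM; [exact: exprn_continuous|exact: u3_cont].
  - move=> x x2; have du := is_derive_u x2; have ux := u_gt0 x2; have ux2 := u_sqr x2.
    have x2E : x ^+ 2 = 4 - u x ^+ 2 by lra.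
    have d1 : is_derive x 1 (fun y : R => y ^+ k.+1) (k.+1%:R * x ^+ k).
      constructor; first exact: exprn_derivable.
      by rewrite exp_derive /GRing.scale/= mulr1.
    have d3 : is_derive x 1 (fun y => u y ^+ 3) (- 3 * x * u x).
      by apply: is_derive_eq; rewrite /GRing.scale/=; field; lra.
    apply: is_derive_eq; rewrite /GRing.scale/= /f/=.
    have -> : x ^+ k.+1 * (- 3 * x * u x) = - 3 * (x ^+ k.+2 * u x).
      by rewrite (exprSr x k.+1); ring.
    have -> : u x ^+ 3 * (k.+1%:R * x ^+ k) =
        k.+1%:R * (4 * (x ^+ k * u x)) - k.+1%:R * (x ^+ k.+2 * u x).
      rewrite exprSr ux2 !(exprSr x); ring.
    rewrite natrD -natr1; ring.
have u2 : u 2 = 0 by rewrite /u (_ : 4 - _ = 0) ?sqrtr0//; ring.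
have u2' : u (-2) = 0 by rewrite /u (_ : 4 - _ = 0) ?sqrtr0//; ring.
have int g : continuous g -> mu.-integrable `[-2, 2] (EFin \o g).
  move=> cg; apply: continuous_compact_integrable; first exact: segment_compact.
  exact: continuous_subspaceT.
rewrite /F u2 u2' expr0n !mulr0 subr0 /f RintegralB//; last 2 first.
- by apply: int => x; apply: cvgM; [exact: cvg_cst|exact: xu_cont].
- by apply: int => x; apply: cvgM; [exact: cvg_cst|exact: xu_cont].
rewrite !RintegralZl//; last 2 first.
- by apply: int; exact: xu_cont.
- by apply: int; exact: xu_cont.
by move/subr0_eq.
Qed.

(** The recursion and the ballot formula both give the Catalan numbers. *)
Lemma semicircle_moment_dyck k : (2 * pi)^-1 * J k = (dyck k 0)%:R.
Proof.
have pi0 : 2 * pi != 0 :> R by rewrite mulf_neq0// gt_eqF// pi_gt0.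
have rec n : (n.*2 + 4)%:R * ((2 * pi)^-1 * J n.*2.+2) =
    4 * (n.*2.+1)%:R * ((2 * pi)^-1 * J n.*2) :> R.
  by rewrite mulrCA J_rec; ring.
have recD n : ((n.*2 + 4) * dyck n.*2.+2 0 = 4 * n.*2.+1 * dyck n.*2 0)%N.
  have := dyck_ballot n.+1 0; have := dyck_ballot n 0.
  rewrite !addn0 !mul1n doubleS => E1 E2.
  have F0 : (0 < n.+1`! * n`!)%N by rewrite muln_gt0 !fact_gt0.
  have : (dyck n.*2.+2 0 * n.+2 * (n.+1 * (n.+1`! * n`!)) =
      2 * n.*2.+1 * dyck n.*2 0 * (n.+1 * (n.+1`! * n`!)))%N.
    transitivity ((n.*2.+2)`!).
      by rewrite -E2 (factS n.+1) (factS n); ring.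
    by rewrite (factS n.*2.+1) (factS n.*2) -E1 -(mul2n n); ring.
  have F1 : (0 < n.+1 * (n.+1`! * n`!))%N by rewrite muln_gt0.
  move/eqP; rewrite (eqn_pmul2r F1) => /eqP; clear; lia.
have ev n : (2 * pi)^-1 * J n.*2 = (dyck n.*2 0)%:R.
  elim: n => [|n IH]; first by rewrite J0 mulVf.
  have c0 : (n.*2 + 4)%:R != 0 :> R by rewrite pnatr_eq0 addn4.
  apply: (mulfI c0); rewrite doubleS rec IH -!natrM recD !natrM; ring.
have od n : J n.*2.+1 = 0.
  elim: n => [|n IH]; first exact: J1.
  have c0 : (n.*2.+1 + 4)%:R != 0 :> R by rewrite pnatr_eq0 addn4.
  by apply: (mulfI c0); rewrite doubleS J_rec IH !mulr0.
have [ok|ek] := boolP (odd k).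
  have -> : k = k./2.*2.+1 by rewrite -[LHS]odd_double_half ok.
  by rewrite od mulr0 dyck_odd// addn0/= odd_double.
have -> : k = k./2.*2 by rewrite -[LHS]odd_double_half (negbTE ek).
exact: ev.
Qed.

End Semicircle.

Section Density.
Context d (T : measurableType d) (R : realType).
Variables (m m' : {measure set T -> \bar R}) (g : T -> R).
Hypotheses (mg : measurable_fun setT g) (g0 : forall x, 0 <= g x).
Hypothesis m'E : forall A, measurable A -> m' A = (\int[m]_(x in A) (g x)%:E)%E.
Local Open Scope ereal_scope.
Import HBNNSimple.

Let density_nnsfun (h : {nnsfun T >-> R}) :
  \int[m']_x (h x)%:E = \int[m]_x ((h x)%:E * (g x)%:E).
Proof.
under [LHS]eq_integral do rewrite fimfunE -fsumEFin//.
rewrite [LHS]ge0_integral_fsum//; last 2 first.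
  - by move=> r; exact/measurable_EFinP/measurableT_comp.
  - by move=> n x _; rewrite EFinM nnfun_muleindic_ge0.
under [RHS]eq_integral.
  move=> x xD; rewrite fimfunE -fsumEFin// muleC ge0_mule_fsumr; last first.
    by move=> r; rewrite EFinM nnfun_muleindic_ge0.
  over.
rewrite [RHS]ge0_integral_fsum//; last 2 first.
  - move=> r; apply/measurable_EFinP; apply: measurable_funM => //.
    exact: measurableT_comp.
  - by move=> n x _; rewrite mule_ge0 ?lee_fin// -lee_fin EFinM nnfun_muleindic_ge0.
apply: eq_fsbigr => r /set_mem/= -[y _ yr].
have r0 : (0 <= r)%R by rewrite -yr.
have mA : measurable (h @^-1` [set r]) by [].
rewrite integralZl_indic_nnsfun// integral_indic// setIT m'E//.
rewrite integral_mkcond -ge0_integralZl//; last 2 first.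
- apply: (measurable_restrictT (fun x => (g x)%:E) mA).1.
  by apply: measurable_funTS; exact/measurable_EFinP.
- by move=> x _; rewrite patchE; case: ifP => // _; rewrite lee_fin.
apply: eq_integral => x _; rewrite patchE indicE muleC.
by case: ifP => xA; rewrite -EFinM /= ?mulr1 ?mulr0 ?mule0 ?mul0r// muleC.
Qed.

(** Change of measure, from simple functions by monotone convergence. *)
Lemma ge0_integral_density (f : T -> R) : measurable_fun setT f ->
  (forall x, (0 <= f x)%R) ->
  \int[m']_x (f x)%:E = \int[m]_x ((f x)%:E * (g x)%:E).
Proof.
move=> mf f0; have mf' : measurable_fun setT (EFin \o f) by exact/measurable_EFinP.
pose f_ := nnsfun_approx measurableT mf'.
transitivity (limn (fun n => \int[m']_x (f_ n x)%:E)).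
  rewrite -monotone_convergence//=.
  - apply: eq_integral => x _; apply/esym/cvg_lim => //=.
    by apply: cvg_nnsfun_approx => // y _; rewrite lee_fin.
  - by move=> n; exact/measurable_EFinP/measurable_funTS.
  - by move=> n x _; rewrite lee_fin.
  - by move=> x _ a b ab; rewrite lee_fin; exact/lefP/nd_nnsfun_approx.
transitivity (limn (fun n => \int[m]_x ((f_ n x)%:E * (g x)%:E))).
  by congr (limn _); apply/funext => n; exact: density_nnsfun.
rewrite -monotone_convergence//=.
- apply: eq_integral => x _; apply/cvg_lim => //=.
  apply: cvgeZr => //; apply: cvg_nnsfun_approx => // y _; by rewrite lee_fin.
- move=> n; apply/measurable_EFinP; apply: measurable_funM => //.
- by move=> n x _; rewrite mule_ge0// lee_fin.
- move=> x _ a b ab; rewrite lee_wpmul2r ?lee_fin//.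
  exact/lefP/nd_nnsfun_approx.
Qed.

End Density.

Section SemicircleIntegral.
Context {R : realType}.
Local Notation mu := (@lebesgue_measure R).
Local Notation nu := (@semicircle_law R).

Let s (x : R) : R := (2 * pi)^-1 * Num.sqrt (4 - x ^+ 2).

Let s_cont : continuous s.
Proof.
move=> x; apply: cvgM; first exact: cvg_cst.
apply: (continuous_comp (f := fun y : R => 4 - y ^+ 2)).
  by apply: cvgB; [exact: cvg_cst | exact: exprn_continuous].
exact: sqrt_continuous.
Qed.

Let compact_integrable (f : R -> R) : continuous f ->
  mu.-integrable `[-2, 2] (fun x => (f x * s x)%:E).
Proof.
move=> cf; apply: continuous_compact_integrable; first exact: segment_compact.
by apply: continuous_subspaceT => x; apply: cvgM; [exact: cf|exact: s_cont].
Qed.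

Let ge0_semicircle_integral (f : R -> R) : continuous f -> (forall x, 0 <= f x) ->
  (\int[nu]_x (f x)%:E = (\int[mu]_(x in `[-2, 2]) (f x * s x))%:E)%E.
Proof.
move=> cf f0; have mf : measurable_fun setT f by exact: continuous_measurable_fun.
rewrite (@ge0_integral_density _ _ R mu nu (@semicircle_pdf R))//; last 2 first.
- exact: measurable_semicircle_pdf.
- by move=> x; exact: semicircle_pdf_ge0.
rewrite /Rintegral fineK; last first.
  by apply: integrable_fin_num => //; exact: compact_integrable.
rewrite [RHS]integral_mkcond; apply: eq_integral => x _.
rewrite patchE /semicircle_pdf indicE -EFinM.
have -> : (x \in `[-2, 2]%classic) = (x \in [set y : R | `|y| <= 2]).
  by apply/idP/idP => /set_mem/= h; apply/mem_set => /=; move: h;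
    rewrite in_itv/= ler_norml.
by case: ifP => _; rewrite ?mulr1 ?mulr0 ?mulr0.
Qed.

Lemma semicircle_integrable (f : R -> R) : continuous f ->
  nu.-integrable setT (EFin \o f).
Proof.
move=> cf; apply/integrableP; split.
  by apply/measurable_EFinP; exact: continuous_measurable_fun.
rewrite (_ : (fun x => _) = (fun x => (`|f x|)%:E))//.
rewrite ge0_semicircle_integral ?ltry// => x.
by apply: (continuous_comp (@cf x)); exact: norm_continuous.
Qed.

Lemma semicircle_integralE (f : R -> R) : continuous f ->
  (\int[nu]_x (f x)%:E = (\int[mu]_(x in `[-2, 2]) (f x * s x))%:E)%E.
Proof.
move=> cf; have cn : continuous (fun x => `|f x|).
  by move=> x; apply: (continuous_comp (@cf x)); exact: norm_continuous.
have cD : continuous (fun x => f x + `|f x|).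
  by move=> x; apply: cvgD; [exact: cf|exact: cn].
(* a continuous function is the difference of two nonnegative continuous functions *)
have -> : (\int[nu]_x (f x)%:E = \int[nu]_x (f x + `|f x|)%:E - \int[nu]_x (`|f x|)%:E)%E.
  rewrite -integralB//; try exact: semicircle_integrable.
  by apply: eq_integral => x _; rewrite -EFinB addrK.
rewrite !ge0_semicircle_integral//; last first.
  by move=> x; have := ler_norm (- f x); rewrite normrN; lra.
rewrite -EFinB -RintegralB//; try exact: compact_integrable.
by congr EFin; apply: eq_Rintegral => x _; ring.
Qed.

Lemma semicircle_momentE k : (\int[nu]_x (x ^+ k)%:E = (dyck k 0)%:R%:E)%E.
Proof.
rewrite semicircle_integralE; last exact: exprn_continuous.
rewrite -semicircle_moment_dyck -RintegralZl//.
  by congr EFin; apply: eq_Rintegral => x _; rewrite /s mulrCA.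
apply: continuous_compact_integrable; first exact: segment_compact.
apply: continuous_subspaceT => x; apply: cvgM; first exact: exprn_continuous.
apply: (continuous_comp (f := fun y : R => 4 - y ^+ 2)).
  by apply: cvgB; [exact: cvg_cst | exact: exprn_continuous].
exact: sqrt_continuous.
Qed.

End SemicircleIntegral.

(** * From moments to weak convergence *)

Section Weierstrass.
Context {R : realType}.
Implicit Types (t e : R) (phi : nat -> R).

Lemma uniform_continuity (f : R -> R) (a b e : R) : continuous f -> 0 < e ->
  exists2 dl : R, 0 < dl &
    forall x y, a <= x <= b -> `|x - y| < dl -> `|f x - f y| < e.
Proof.
move=> cf e0; have e20 : 0 < e / 2 by rewrite divr_gt0.
have /compact_near_coveringP cov := @segment_compact R a b.
have := cov R (0 : R)^'+ (fun dl x => forall y, `|x - y| < dl -> `|f x - f y| < e) _.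
have cvr : forall x, `[a, b]%classic x -> \forall x' \near x & dl \near (0 : R)^'+,
    forall y, `|x' - y| < dl -> `|f x' - f y| < e.
  move=> x _; have /cvgrPdist_lt/(_ _ e20) := cf x.
  move=> /nbhs_ballP[r /= r0 xr]; have r20 : 0 < r / 2 by rewrite divr_gt0.
  exists (ball x (r / 2), [set dl | dl < r / 2]) => /=.
    split; first exact: nbhsx_ballx.
    exact: nbhs_right_lt.
  move=> [x' dl] /= [xx dlr] y x'y; have xx' : `|x - x'| < r / 2 := xx.
  have h1 : `|f x - f x'| < e / 2.
    by apply: xr; rewrite /ball/= (lt_le_trans xx')//; lra.
  have h2 : `|f x - f y| < e / 2.
    apply: xr; rewrite /ball/= /ball_/=.
    rewrite (_ : x - y = (x - x') + (x' - y)); last by ring.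
    by rewrite (le_lt_trans (ler_normD _ _))//; have := lt_trans x'y dlr; lra.
  rewrite (_ : f x' - f y = - (f x - f x') + (f x - f y)); last by ring.
  by rewrite (le_lt_trans (ler_normD _ _))// normrN; lra.
move=> /(_ _ cvr) => h.
have [dl [dl0 hdl]] : exists dl, 0 < dl /\ `[a, b]%classic `<=`
    (fun x => forall y, `|x - y| < dl -> `|f x - f y| < e).
  near (0 : R)^'+ => dl; exists dl; split; first by near: dl; exact: nbhs_right_gt.
  by near: dl.
by exists dl => // x y xab; apply: hdl; rewrite /= in_itv/=.
Unshelve. all: by end_near.
Qed.

(** The Bernstein operator, that is the mean of [phi] under the binomial law, in
the form of its one-step recursion. *)
Fixpoint bernstein (n : nat) phi : {poly R} :=
  match n with
  | 0 => (phi 0)%:P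
  | n'.+1 => 'X * bernstein n' (fun i => phi i.+1) + (1 - 'X) * bernstein n' phi
  end.

Lemma bernsteinB n phi psi t :
  (bernstein n (fun i => phi i - psi i)).[t] = (bernstein n phi).[t] - (bernstein n psi).[t].
Proof.
elim: n phi psi => [|n IH] phi psi; first by rewrite /= !hornerE.
by rewrite /= !hornerE !IH; ring.
Qed.

Lemma bernstein_cst n (c : R) t : (bernstein n (fun=> c)).[t] = c.
Proof. by elim: n => [|n IH]; rewrite /= !hornerE// !IH; ring. Qed.

Lemma bernstein_affine n (a b : R) phi t :
  (bernstein n (fun i => a + b * phi i)).[t] = a + b * (bernstein n phi).[t].
Proof.
elim: n phi => [|n IH] phi; first by rewrite /= !hornerE.
by rewrite /= !hornerE !IH; ring.
Qed.

Lemma ler_norm_bernstein n phi psi t : 0 <= t <= 1 ->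
  (forall i, (i <= n)%N -> `|phi i| <= psi i) ->
  `|(bernstein n phi).[t]| <= (bernstein n psi).[t].
Proof.
move=> /andP[t0 t1]; elim: n phi psi => [|n IH] phi psi h.
  by rewrite /= !hornerE; exact: h.
rewrite /= !hornerE; have t1' : 0 <= 1 - t by rewrite subr_ge0.
apply: le_trans (ler_normD _ _) _; rewrite !normrM (ger0_norm t0) (ger0_norm t1').
apply: lerD; apply: ler_wpM2l => //; apply: IH => i ni; apply: h => //.
exact: leqW.
Qed.

(** The second moment of the binomial law about an arbitrary centre [c]: as [c] is
free, the recursion of [bernstein] proves it by induction. *)
Lemma bernstein_square n (c t : R) :
  (bernstein n (fun i => (i%:R - c) ^+ 2)).[t] =
  n%:R * t * (1 - t) + (n%:R * t - c) ^+ 2.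
Proof.
elim: n c => [|n IH] c; first by rewrite /= !hornerE; ring.
have IH' : (bernstein n (fun i => (i.+1%:R - c) ^+ 2)).[t] =
    n%:R * t * (1 - t) + (n%:R * t - (c - 1)) ^+ 2.
  rewrite -IH; congr (_.[_]); congr bernstein; apply/funext => i.
  by rewrite -natr1; ring.
by rewrite /= !hornerE IH IH' -natr1; ring.
Qed.

(** Bernstein's proof: the binomial mean of [g t - g (i / n)] is small where [i / n] is
close to [t] by uniform continuity, and elsewhere because its mass is small by
Chebyshev's inequality. *)
Lemma weierstrass01 (g : R -> R) (M e : R) : continuous g -> (forall x, `|g x| <= M) ->
  0 < e -> exists p : {poly R}, forall t, 0 <= t <= 1 -> `|g t - p.[t]| <= e.
Proof.
move=> cg gM e0; have e20 : 0 < e / 2 by rewrite divr_gt0.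
have [dl dl0 hdl] := uniform_continuity 0 1 cg e20.
have M0 : 0 <= M by apply: le_trans (gM 0).
(* where the distance of two points is at least [dl], [2 * M] is at most [K] times its
square *)
pose K := 2 * M / dl ^+ 2.
have K0 : 0 <= K by rewrite /K !mulr_ge0// invr_ge0 sqr_ge0.
pose n := (Num.truncn (K / (e / 2))).+1.
have n0 : 0 < n%:R :> R by rewrite ltr0n.
have nK : K / n%:R <= e / 2.
  rewrite ler_pdivrMr// mulrC -ler_pdivrMr//.
  by rewrite ltW// truncnS_gt.
exists (bernstein n (fun i => g (i%:R / n%:R))) => t t01.
rewrite -[X in `|X - _|](bernstein_cst n (g t) t) -bernsteinB.
pose psi i := e / 2 + K / n%:R ^+ 2 * (i%:R - n%:R * t) ^+ 2.
apply: (@le_trans _ _ (bernstein n psi).[t]).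
  apply: ler_norm_bernstein => // i _.
  have [lt|ge] := ltP `|t - i%:R / n%:R| dl.
    apply: (le_trans (ltW (hdl _ _ t01 lt))).
    by rewrite /psi lerDl mulr_ge0 ?sqr_ge0// mulr_ge0// invr_ge0 sqr_ge0.
  apply: (@le_trans _ _ (2 * M)).
    have := gM t; have := gM (i%:R / n%:R).
    by have := ler_normB (g t) (g (i%:R / n%:R)); lra.
  apply: (@le_trans _ _ (K / n%:R ^+ 2 * (i%:R - n%:R * t) ^+ 2)); last first.
    by rewrite lerDr ltW.
  have -> : K / n%:R ^+ 2 * (i%:R - n%:R * t) ^+ 2 = K * (t - i%:R / n%:R) ^+ 2.
    by field; rewrite gt_eqF.
  rewrite /K mulrAC ler_pdivlMr ?exprn_gt0//.
  apply: ler_wpM2l; first by rewrite mulr_ge0.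
  rewrite -(real_normK (num_real (t - _))) ler_sqr// nnegrE ltW//.
rewrite bernstein_affine bernstein_square subrr expr0n addr0.
have -> : K / n%:R ^+ 2 * (n%:R * t * (1 - t)) = K / n%:R * (t * (1 - t)).
  by field; rewrite gt_eqF.
have tt : t * (1 - t) <= 1 by case/andP: t01 => *; nra.
have : K / n%:R * (t * (1 - t)) <= K / n%:R by rewrite ler_piMr// divr_ge0// ltW.
by lra.
Qed.

Lemma weierstrass (f : R -> R) (M B e : R) : continuous f -> (forall x, `|f x| <= M) ->
  0 < B -> 0 < e ->
  exists p : {poly R}, forall x, `|x| <= B -> `|f x - p.[x]| <= e.
Proof.
move=> cf fM B0 e0; pose g t := f (2 * B * t - B).
have cg : continuous g.
  move=> t; apply: (@continuous_comp _ _ _ (fun t => 2 * B * t - B) f); last exact: cf.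
  by apply: cvgB; [apply: cvgM; [exact: cvg_cst|exact: cvg_id]|exact: cvg_cst].
have [p hp] := weierstrass01 cg (fun t => fM _) e0.
exists (p \Po (((2 * B)^-1)%:P * ('X + B%:P))) => x; rewrite ler_norml => /andP[x1 x2].
have B20 : 0 < 2 * B by rewrite mulr_gt0.
rewrite horner_comp !hornerE; set t := _ * (x + B).
have -> : f x = g t by congr f; rewrite /t; field; rewrite gt_eqF.
apply: hp; rewrite /t mulrC; apply/andP; split.
  by rewrite divr_ge0// ?(ltW B20)//; lra.
by rewrite ler_pdivrMr// mul1r; lra.
Qed.

End Weierstrass.

Section PolynomialDomination.
Context {R : realType}.

Lemma norm_horner_le (p : {poly R}) (x : R) : 1 <= `|x| ->
  `|p.[x]| <= (\sum_(i < size p) `|p`_i|) * `|x| ^+ size p.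
Proof.
move=> x1; rewrite horner_coef mulr_suml.
apply: le_trans (ler_norm_sum _ _ _) _; apply: ler_sum => i _.
rewrite normrM normrX; apply: ler_wpM2l => //.
by apply: ler_weXn2l => //; exact: ltnW.
Qed.

(** Outside of [-3, 3] a high even power, divided by its value at 3, dominates
everything of polynomial growth; its integral is small for measures whose moments
grow like powers of 2. *)
Lemma polynomial_domination (f : R -> R) (M e : R) : continuous f ->
  (forall x, `|f x| <= M) -> 0 < e ->
  exists (p : {poly R}) (L : nat) (dl : R), [/\ 0 <= dl,
    forall x, `|f x - p.[x]| <= e + dl * x ^+ L.*2 &
    dl * (4 ^+ L + 1) <= e].
Proof.
move=> cf fM e0; have B0 : 0 < 3 :> R by [].
have [p hp] := weierstrass cf fM B0 e0.
pose S := \sum_(i < size p) `|p`_i|.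
have S0 : 0 <= S by rewrite sumr_ge0.
have M0 : 0 <= M by apply: le_trans (fM 0).
pose C := (M + S) * 3 ^+ size p.
have C0 : 0 <= C by rewrite mulr_ge0 ?addr_ge0 ?exprn_ge0.
(* 4 bounds the growth of the even moments, 9 is the square of the radius 3 *)
have [L [qL hL]] : exists L, (size p <= L)%N /\ 2 * C * (4 / 9) ^+ L <= e.
  have c : (4 / 9 : R) ^+ n @[n --> \oo] --> (0 : R).
    by apply: cvg_expr; rewrite ger0_norm; lra.
  have c' : 2 * C * (4 / 9 : R) ^+ n @[n --> \oo] --> (0 : R).
    by rewrite -[X in _ --> X](mulr0 (2 * C)); apply: cvgMr.
  have /cvgrPdist_le/(_ e e0) := c'.
  move=> hn; near \oo => L; exists L; split; first by near: L; exact: nbhs_infty_ge.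
  have : `|0 - 2 * C * (4 / 9) ^+ L| <= e by near: L.
  by rewrite sub0r normrN; apply: le_trans; exact: ler_norm.
exists p, L, (C / 9 ^+ L); split.
- by rewrite divr_ge0// exprn_ge0.
- move=> x; have x2L : 0 <= x ^+ L.*2 by rewrite exprn_even_ge0// odd_double.
  have [x3|x3] := leP `|x| 3.
    by rewrite (le_trans (hp _ x3))// lerDl mulr_ge0// divr_ge0// exprn_ge0.
  apply: (@le_trans _ _ (C / 9 ^+ L * x ^+ L.*2)); last by rewrite lerDr ltW.
  have x1 : 1 <= `|x| by lra.
  apply: (@le_trans _ _ ((M + S) * `|x| ^+ size p)).
    rewrite (le_trans (ler_normB _ _))// mulrDl lerD ?norm_horner_le//.
    by rewrite (le_trans (fM x))// ler_peMr// exprn_ege1.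
  have -> : C / 9 ^+ L * x ^+ L.*2 = (M + S) * (3 ^+ size p * (`|x| / 3) ^+ L.*2).
    rewrite expr_div_n -(mul2n L) (exprM 3) (_ : 3 ^+ 2 = 9 :> R); last by ring.
    by rewrite /C (exprM `|x|) real_normK ?num_real// -exprM; ring.
  apply: ler_wpM2l; first by rewrite addr_ge0.
  rewrite -[X in X ^+ size p](@divfK _ 3)// exprMn mulrC; apply: ler_wpM2l.
    by rewrite exprn_ge0.
  apply: ler_weXn2l; first by rewrite ler_pdivlMr// mul1r ltW.
  by rewrite -addnn (leq_trans qL)// leq_addr.
- apply: le_trans hL; rewrite expr_div_n.
  have -> : 2 * C * (4 ^+ L / 9 ^+ L) = C / 9 ^+ L * (2 * 4 ^+ L) by ring.
  apply: ler_wpM2l; first by rewrite divr_ge0// exprn_ge0.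
  have : 1 <= 4 ^+ L :> R by rewrite exprn_ege1//; lra.
  by lra.
Unshelve. all: by end_near.
Qed.

End PolynomialDomination.

Section EmpiricalMeasure.
Context {R : realType}.

Lemma esd_integral (N : nat) (A : 'M[R]_N) (f : R -> R) : A^T = A -> continuous f ->
  (\int[esd A]_x (f x)%:E =
   (N%:R^-1 * \sum_(x <- eigenvalues A) f x)%:E)%E.
Proof.
move=> sA cf; have [sz _] := eigenvalues_spec sA.
have ge0 (g : R -> R) : continuous g -> (forall x, 0 <= g x) ->
    (\int[esd A]_x (g x)%:E = (N%:R^-1 * \sum_(x <- eigenvalues A) g x)%:E)%E.
  move=> cg g0; have mg : measurable_fun setT (EFin \o g).
    by apply/measurable_EFinP; exact: continuous_measurable_fun.
  rewrite /esd ge0_integral_mscale//; last by move=> x _; rewrite lee_fin.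
  rewrite ge0_integral_measure_sum//; last by move=> x _; rewrite lee_fin.
  rewrite EFinM -sumEFin; congr (_ * _)%E.
  rewrite [RHS](big_nth 0) sz big_mkord; apply: eq_bigr => i _.
  by rewrite integral_dirac//= diracE in_setT mul1e.
have cn : continuous (fun x => `|f x|).
  by move=> x; apply: (continuous_comp (@cf x)); exact: norm_continuous.
have cD : continuous (fun x => f x + `|f x|).
  by move=> x; apply: cvgD; [exact: cf|exact: cn].
have int (g : R -> R) : continuous g -> (esd A).-integrable setT (EFin \o g).
  move=> cg; apply/integrableP; split.
    by apply/measurable_EFinP; exact: continuous_measurable_fun.
  rewrite (_ : (fun x => _) = (fun x => (`|g x|)%:E))// ge0 ?ltry// => x.
  by apply: (continuous_comp (@cg x)); exact: norm_continuous.
have -> : (\int[esd A]_x (f x)%:E =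
    \int[esd A]_x (f x + `|f x|)%:E - \int[esd A]_x (`|f x|)%:E)%E.
  rewrite -integralB//; [|exact: int..].
  by apply: eq_integral => x _; rewrite -EFinB addrK.
rewrite !ge0//; last by move=> x; have := ler_norm (- f x); rewrite normrN; lra.
rewrite -EFinB -mulrBr -sumrB; congr (_ * _)%:E.
by apply: eq_bigr => x _; rewrite addrK.
Qed.

End EmpiricalMeasure.

Section MomentsToWeak.
Context {R : realType}.
Local Notation nu := (@semicircle_law R).

Lemma continuous_horner_poly (p : {poly R}) : continuous (fun x => p.[x]).
Proof.
elim/poly_ind: p => [|p c IH].
  rewrite (_ : (fun x => _) = cst 0); first exact: cst_continuous.
  by apply/funext => x; rewrite horner0.
rewrite (_ : (fun x => _) = (fun x => p.[x] * x + c)).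
  by move=> x; apply: cvgD; [apply: cvgM; [exact: IH|exact: cvg_id]|exact: cvg_cst].
by apply/funext => x; rewrite hornerMXaddC.
Qed.

Definition trace_moment (N : nat) (A : 'M[R]_N) (k : nat) : R :=
  N%:R^-1 * \tr (A ^+ k).

Lemma mean_horner_eigenvalues N (A : 'M[R]_N) (p : {poly R}) : A^T = A ->
  N%:R^-1 * \sum_(x <- eigenvalues A) p.[x] =
  \sum_(i < size p) p`_i * trace_moment A i.
Proof.
move=> sA; have [_ tE] := eigenvalues_spec sA.
under eq_bigr do rewrite horner_coef.
rewrite exchange_big/= mulr_sumr; apply: eq_bigr => i _.
by rewrite -mulr_sumr tE /trace_moment mulrCA.
Qed.

Let scaled_power_integrable (c : R) k :
  nu.-integrable setT (fun x => (c * x ^+ k)%:E).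
Proof.
apply: semicircle_integrable => x; apply: cvgM; first exact: cvg_cst.
exact: exprn_continuous.
Qed.

Let semicircle_scaled_momentE (c : R) k :
  (\int[nu]_x (c * x ^+ k)%:E = (c * (dyck k 0)%:R)%:E)%E.
Proof.
under eq_integral do rewrite EFinM.
rewrite integralZl//; last by apply: semicircle_integrable; exact: exprn_continuous.
by rewrite semicircle_momentE.
Qed.

Lemma semicircle_horner (p : {poly R}) :
  (\int[nu]_x (p.[x])%:E = (\sum_(i < size p) p`_i * (dyck i 0)%:R)%:E)%E.
Proof.
under eq_integral do rewrite horner_coef -sumEFin.
rewrite integral_sum//.
rewrite -sumEFin; apply: eq_bigr => i _; exact: semicircle_scaled_momentE.
Qed.

(** [f] is replaced by a polynomial; the error is at most [e] plus a small multiple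
of a high even power, whose integrals are again moments. The moments in question
are finitely many, and close for the two measures. *)
Lemma esd_close (f : R -> R) (M e : R) : continuous f -> (forall x, `|f x| <= M) ->
  0 < e -> exists (J : nat) (eta : R), 0 < eta /\
    forall (N : nat) (A : 'M[R]_N), (0 < N)%N -> A^T = A ->
      (forall j, (j < J)%N -> `|trace_moment A j - (dyck j 0)%:R| <= eta) ->
      (`| \int[esd A]_x (f x)%:E - \int[nu]_x (f x)%:E | <= (5 * e)%:E)%E.
Proof.
move=> cf fM e0; have [p [L [dl [dl0 dom dlL]]]] := polynomial_domination cf fM e0.
pose S := \sum_(i < size p) `|p`_i|.
have S0 : 0 <= S by rewrite sumr_ge0.
exists (maxn (size p) L.*2.+1), (Num.min 1 (e / (S + 1))).
have S1 : 0 < S + 1 by lra.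
split; first by rewrite lt_min ltr01 divr_gt0.
move=> N A N0 sA close.
have close1 j : (j < maxn (size p) L.*2.+1)%N ->
    `|trace_moment A j - (dyck j 0)%:R| <= 1.
  by move=> /close; rewrite le_min => /andP[].
have closeS j : (j < maxn (size p) L.*2.+1)%N ->
    `|trace_moment A j - (dyck j 0)%:R| <= e / (S + 1).
  by move=> /close; rewrite le_min => /andP[].
have Nn0 : N%:R != 0 :> R by rewrite pnatr_eq0 -lt0n.
have N0' : 0 <= N%:R^-1 :> R by rewrite invr_ge0.
have dyckL : (dyck L.*2 0)%:R <= 4 ^+ L :> R.
  by rewrite -natrX ler_nat (leq_trans (dyck_le _ _))// -mul2n expnM.
have mL : trace_moment A L.*2 <= 4 ^+ L + 1.
  have := close1 L.*2 _; rewrite leq_max leqnn orbT => /(_ isT).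
  by rewrite ler_norml => /andP[_]; lra.
have [sz tE] := eigenvalues_spec sA.
have cp := @continuous_horner_poly p.
have chi : continuous (fun x : R => e + dl * x ^+ L.*2).
  move=> x; apply: cvgD; first exact: cvg_cst.
  by apply: cvgM; [exact: cvg_cst|exact: exprn_continuous].
have cfp : continuous (fun x => f x - p.[x]).
  by move=> x; apply: cvgB; [exact: cf|exact: cp].
rewrite esd_integral//.
have [I IE] : exists I, (\int[nu]_x (f x)%:E = I%:E)%E.
  by rewrite semicircle_integralE//; eexists.
rewrite IE -EFinB abse_EFin lee_fin.
pose Ip := \sum_(i < size p) p`_i * (dyck i 0)%:R.
have Ifp : `|I - Ip| <= 2 * e.
  have IpE : (\int[nu]_x (f x - p.[x])%:E = (I - Ip)%:E)%E.
    rewrite EFinB -IE -semicircle_horner -integralB//; exact: semicircle_integrable.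
  have intfp : nu.-integrable setT (fun x => (f x - p.[x])%:E).
    exact: semicircle_integrable.
  rewrite -lee_fin -abse_EFin -IpE; apply: le_trans (le_abse_integral _ _ _) _ => //.
    exact: measurable_int intfp.
  apply: (@le_trans _ _ (\int[nu]_x (e + dl * x ^+ L.*2)%:E)%E).
    apply: ge0_le_integral => //.
    - by apply/measurableT_comp => //; exact: measurable_int intfp.
    - by apply/measurable_EFinP; exact: continuous_measurable_fun.
    - by move=> x _; rewrite abse_EFin lee_fin.
  have -> : (\int[nu]_x (e + dl * x ^+ L.*2)%:E = (e + dl * (dyck L.*2 0)%:R)%:E)%E.
    transitivity (\int[nu]_x ((e * x ^+ 0)%:E + (dl * x ^+ L.*2)%:E))%E.
      by apply: eq_integral => x _; rewrite expr0 mulr1.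
    rewrite integralD//; try exact: scaled_power_integrable.
    by rewrite !semicircle_scaled_momentE /= mulr1.
  rewrite lee_fin; have : dl * (dyck L.*2 0)%:R <= dl * (4 ^+ L + 1).
    by apply: ler_wpM2l => //; lra.
  by lra.
have h1 : `|N%:R^-1 * \sum_(x <- eigenvalues A) f x -
    N%:R^-1 * \sum_(x <- eigenvalues A) p.[x]| <= 2 * e.
  rewrite -mulrBr -sumrB normrM (ger0_norm N0').
  apply: (@le_trans _ _ (N%:R^-1 * \sum_(x <- eigenvalues A) (e + dl * x ^+ L.*2))).
    apply: ler_wpM2l => //; apply: le_trans (ler_norm_sum _ _ _) _.
    by apply: ler_sum => x _; exact: dom.
  rewrite big_split/= -mulr_sumr tE big_const_seq count_predT sz iter_addr addr0.
  have -> : N%:R^-1 * (e *+ N + dl * \tr (A ^+ L.*2)) =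
      e + dl * trace_moment A L.*2.
    by rewrite /trace_moment -mulr_natr; field.
  have : dl * trace_moment A L.*2 <= dl * (4 ^+ L + 1) by exact: ler_wpM2l.
  by lra.
have h2 : `|N%:R^-1 * \sum_(x <- eigenvalues A) p.[x] - Ip| <= e.
  rewrite mean_horner_eigenvalues// -sumrB.
  apply: le_trans (ler_norm_sum _ _ _) _.
  apply: (@le_trans _ _ (S * (e / (S + 1)))).
    rewrite mulr_suml; apply: ler_sum => i _; rewrite -mulrBr normrM.
    by apply: ler_wpM2l => //; apply: closeS; rewrite leq_max ltn_ord.
  by rewrite mulrA ler_pdivrMr// mulrDr mulr1 (mulrC S) lerDl ltW.
have -> : N%:R^-1 * \sum_(x <- eigenvalues A) f x - I =
  (N%:R^-1 * \sum_(x <- eigenvalues A) f x - N%:R^-1 * \sum_(x <- eigenvalues A) p.[x]) +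
  ((N%:R^-1 * \sum_(x <- eigenvalues A) p.[x] - Ip) - (I - Ip)) by ring.
apply: le_trans (ler_normD _ _) _; have := ler_normB
  (N%:R^-1 * \sum_(x <- eigenvalues A) p.[x] - Ip) (I - Ip).
by lra.
Qed.

End MomentsToWeak.

Section MeasurableSpectrum.
Context {R : realType} d (T : measurableType d).
Variables (N : nat) (A : T -> 'M[R]_N).
Hypothesis mA : forall i j, measurable_fun setT (fun w => A w i j).
Hypothesis sA : forall w, (A w)^T = A w.

Lemma measurable_trace_moment k : measurable_fun setT (fun w => trace_moment (A w) k).
Proof.
apply: measurable_funM => //.
have mpow i j : measurable_fun setT (fun w => (A w ^+ k) i j).
  elim: k i j => [|k IH] i j.
    rewrite (_ : (fun w => _) = cst ((i == j)%:R)); first exact: measurable_cst.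
    by apply/funext => w; rewrite expr0 !mxE.
  rewrite (_ : (fun w => _) = (fun w => \sum_l A w i l * (A w ^+ k) l j)).
    by apply: measurable_sum => l; exact: measurable_funM.
  by apply/funext => w; rewrite exprS -mulmxE mxE.
by rewrite /mxtrace; exact: measurable_sum.
Qed.

(** The integral against the empirical measure is a pointwise limit of integrals
of polynomials, hence of polynomials in the entries. *)
Lemma measurable_esd_integral (f : R -> R) (M : R) : continuous f ->
  (forall x, `|f x| <= M) ->
  measurable_fun setT (fun w => (\int[esd (A w)]_x (f x)%:E)%E).
Proof.
move=> cf fM.
have approx (m : nat) : exists q : {poly R}, forall x, `|x| <= m.+1%:R ->
    `|f x - q.[x]| <= m.+1%:R^-1.
  by apply: weierstrass => //; rewrite ?invr_gt0 ltr0n.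
have [p hp] := choice approx.
pose F w := N%:R^-1 * \sum_(x <- eigenvalues (A w)) f x.
rewrite (_ : (fun w => _) = EFin \o F); last first.
  by apply/funext => w; rewrite esd_integral.
apply/measurable_EFinP.
apply: (@measurable_fun_cvg _ _ _ _ (fun m w =>
    N%:R^-1 * \sum_(x <- eigenvalues (A w)) (p m).[x])).
  move=> m; rewrite (_ : (fun w => _) =
      (fun w => \sum_(i < size (p m)) (p m)`_i * trace_moment (A w) i)).
    apply: measurable_sum => i; apply: measurable_funM => //.
    exact: measurable_trace_moment.
  by apply/funext => w; rewrite mean_horner_eigenvalues.
move=> w _; have [sz _] := eigenvalues_spec (sA w).
apply/cvgrPdist_le => e e0.
near=> m; rewrite /F -mulrBr -sumrB normrM ger0_norm ?invr_ge0//.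
have bd x : x \in eigenvalues (A w) -> `|x| <= m.+1%:R.
  move=> xs; apply: (@le_trans _ _ (\sum_(y <- eigenvalues (A w)) `|y|)).
    by rewrite (big_rem x)//= lerDl sumr_ge0.
  apply: (@le_trans _ _ m%:R); last by rewrite ler_nat.
  by near: m; exact: nbhs_infty_ger.
have me : m.+1%:R^-1 <= e.
  rewrite ltW//; near: m; exact: (near_infty_natSinv_lt (PosNum e0)).
have [N00|N0] := eqVneq N 0%N.
  have -> : N%:R^-1 = 0 :> R by rewrite N00 invr0.
  by rewrite mul0r ltW.
rewrite mulrC ler_pdivrMr ?ltr0n ?lt0n//.
apply: le_trans (ler_norm_sum _ _ _) _; rewrite big_seq.
apply: (@le_trans _ _ (\sum_(x <- eigenvalues (A w) | x \in eigenvalues (A w)) e)).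
  by apply: ler_sum => x xs; exact: le_trans (hp m x (bd x xs)) me.
by rewrite -big_seq big_const_seq count_predT sz iter_addr addr0 mulr_natr.
Unshelve. all: by end_near.
Qed.

End MeasurableSpectrum.

(** * Trace moments as sums over closed walks *)

Section EdgeIndex.
Variable N : nat.

Definition edge_index (x y : 'I_N) : nat :=
  filling_inv N (diagonal_filling N) (ordered (x.+1, y.+1)).

Let ordP (x : 'I_N) : (1 <= x.+1 <= N)%N. Proof. by rewrite ltn_ord. Qed.

Lemma edge_indexE x y : edge_index x y = diag_edge N x.+1 y.+1.
Proof. by rewrite /edge_index filling_inv_ordered. Qed.

Lemma edge_indexC x y : edge_index x y = edge_index y x.
Proof. by rewrite !edge_indexE diag_edgeC. Qed.

Lemma edge_index_gt0 x y : (0 < edge_index x y)%N.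
Proof. by rewrite edge_indexE /diag_edge; lia. Qed.

Lemma edge_index_inj x y x' y' : edge_index x y = edge_index x' y' ->
  (x = x' /\ y = y') \/ (x = y' /\ y = x').
Proof.
rewrite !edge_indexE => /diag_edge_inj[] //; try exact: ordP.
  by move=> [[/val_inj ->] [/val_inj ->]]; left.
by move=> [[/val_inj ->] [/val_inj ->]]; right.
Qed.

(** The form in which the bound on the filling enters the counting of walks. *)
Lemma card_edge_index_dist i j d : (0 < d)%N ->
  (#|[pred x | (edge_index i x - edge_index x j) +
               (edge_index x j - edge_index i x) == d]| <= 4)%N.
Proof.
move=> d0; have := num_at_dist_diagonal_le4 (ordP i) (ordP j) d0.
apply: leq_trans; rewrite /num_at_dist -[1%N]addn0 iotaDl -val_enum_ord !count_map.
rewrite cardE size_filter; apply/eq_leq/eq_count => x /=.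
rewrite unfold_in /= /filling_dist /absdiff /edge_index add1n.
by congr (_ == _); lia.
Qed.

End EdgeIndex.

Section TraceExpansion.
Context {R : realType}.
Implicit Types z : nat -> R.

Lemma exprmx_walks N (z : nat -> R) k (x y : 'I_N) :
  (generated_mx N (diagonal_filling N) z ^+ k) x y =
  \sum_(w : k.-tuple 'I_N | last x w == y)
    \prod_(i <- pairmap (@edge_index N) x w) z i.
Proof.
elim: k x => [|k IH] x.
  rewrite expr0 mxE big_mkcond (big_pred1 [tuple])/=; last first.
    by move=> w; rewrite (tuple0 w) [RHS]eqxx.
  by rewrite big_nil; case: (x == y).
rewrite exprS -mulmxE mxE (big_cons_tuple _
  (fun w => \prod_(i <- pairmap (@edge_index N) x w) z i) (fun w => last x w == y)).
apply: eq_bigr => j _; rewrite IH mulr_sumr; apply: eq_bigr => w _ /=.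
by rewrite big_cons mxE.
Qed.

Lemma trace_walks N (z : nat -> R) k :
  \tr (generated_mx N (diagonal_filling N) z ^+ k) =
  \sum_(p : walk N k | closed p) \prod_(i <- edges (@edge_index N) p) z i.
Proof.
rewrite /mxtrace; under eq_bigr do rewrite exprmx_walks.
by rewrite pair_big_dep/=; apply: eq_bigl => -[x w]; rewrite /closed/=.
Qed.

Lemma rescaled_mx_sym N (z : nat -> R) :
  (rescaled_mx N (diagonal_filling N) z)^T = rescaled_mx N (diagonal_filling N) z.
Proof.
apply/matrixP => i j; rewrite !mxE; congr (_ * z _).
exact: edge_indexC.
Qed.

Lemma expr_scale_mx N (a : R) (A : 'M[R]_N) k : (a *: A) ^+ k = a ^+ k *: A ^+ k.
Proof.
elim: k => [|k IH]; first by rewrite !expr0 scale1r.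
by rewrite !exprS IH -!mulmxE -scalemxAl -scalemxAr scalerA.
Qed.

Lemma trace_moment_walks N (z : nat -> R) k :
  trace_moment (rescaled_mx N (diagonal_filling N) z) k =
  (N%:R^-1 * (Num.sqrt N%:R)^-1 ^+ k) *
  \sum_(p : walk N k | closed p) \prod_(i <- edges (@edge_index N) p) z i.
Proof.
by rewrite /trace_moment /rescaled_mx expr_scale_mx mxtraceZ trace_walks mulrA.
Qed.

End TraceExpansion.

(** * Variance and bias of the trace moments *)

Lemma sqrt_lt1 (R : rcfType) (b : R) : 0 <= b < 1 -> 0 <= Num.sqrt b < 1 /\ Num.sqrt b ^+ 2 = b.
Proof.
move=> /andP[b0 b1]; rewrite sqrtr_ge0 sqr_sqrtr//; split => //=.
by rewrite -[ltRHS]sqrtr1 ltr_sqrt.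
Qed.

Lemma absdiffE (a b : nat) : absdiff a b = ((a - b) + (b - a))%N.
Proof. by rewrite /absdiff; lia. Qed.

Lemma ffact_le_exp (N h : nat) : (N ^_ h <= N ^ h)%N.
Proof. by elim: h => // h IH; rewrite ffactnSr expnSr leq_mul// leq_subr. Qed.

Lemma ffact_ge (N h : nat) : (N ^ h.+1 <= N ^_ h.+1 + h.+1 ^ 2 * N ^ h)%N.
Proof.
elim: h => [|h IH]; first by rewrite expn1 ffactn1 expn0 leq_addr.
rewrite ffactnSr.
have le : (N ^_ h.+1 * N <= N ^_ h.+1 * (N - h.+1) + N ^_ h.+1 * h.+1)%N.
  by rewrite -mulnDr leq_mul2l; apply/orP; right; lia.
have le3 : (N ^_ h.+1 * h.+1 <= h.+1 * N ^ h.+1)%N by rewrite mulnC leq_mul2l ffact_le_exp orbT.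
have le4 : (N ^ h.+2 <= N ^_ h.+1 * N + h.+1 ^ 2 * N ^ h.+1)%N.
  by rewrite [in leqLHS]expnSr (leq_trans (leq_mul IH (leqnn N)))// mulnDl -mulnA -expnSr.
have : (h.+1 ^ 2 * N ^ h.+1 + h.+1 * N ^ h.+1 <= h.+2 ^ 2 * N ^ h.+1)%N.
  by rewrite -mulnDl leq_mul2r; apply/orP; right; rewrite -!mulnn; lia.
lia.
Qed.

Section ProcessMoments.
Context {R : realType} {d : measure_display} {T : measurableType d}.
Variables (P : probability T R) (Z : nat -> {RV P >-> R}).
Hypothesis mex : moments_exist Z.
Hypothesis m1 : moment_M1 Z.
Hypothesis m2 : moment_M2 Z.
Hypothesis m3 : moment_M3 Z.

Definition mean_prod (s : seq nat) : R := fine ('E_P[prod_rv Z s])%E.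
Local Notation m := mean_prod.

Lemma mean_prodE s : indices s -> ('E_P[prod_rv Z s] = (m s)%:E)%E.
Proof.
move=> hs; rewrite /mean_prod fineK// unlock; apply: integrable_fin_num => //.
exact: mex.
Qed.

Lemma prod_rv_perm s t : perm_eq s t -> prod_rv Z s = prod_rv Z t.
Proof. by move=> st; apply/funext => w; exact: perm_big. Qed.

Lemma mean_prod_perm s t : perm_eq s t -> m s = m t.
Proof. by rewrite /mean_prod => /prod_rv_perm ->. Qed.

Lemma indices_perm s t : perm_eq s t -> indices s = indices t.
Proof. by move=> st; rewrite /indices (perm_all _ st). Qed.

Lemma mean_prod_odd s : indices s -> odd (size s) -> m s = 0.
Proof. by move=> hs os; rewrite /mean_prod m2. Qed.

Lemma mean_prod_nil : m [::] = 1.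
Proof.
rewrite /mean_prod (_ : prod_rv Z [::] = cst 1) ?expectation_cst//.
by apply/funext => w; rewrite /prod_rv big_nil.
Qed.

Let perm_sortl (s : seq nat) : perm_eq (sort leq s) s.
Proof. by rewrite perm_sort. Qed.

Let sorted_sort (s : seq nat) : sorted leq (sort leq s).
Proof. exact: sort_sorted leq_total _. Qed.

Lemma mean_prod_bound k : (0 < k)%N -> ~~ odd k -> exists C b : R,
  [/\ 0 < C, 0 <= b < 1 & forall s, size s = k -> indices s ->
    `|m s| <= C * b ^+ gap_sum s].
Proof.
move=> k0 ek; have [C [b [C0 b01 h]]] := m3 k0 ek.
exists C, b; split => // s sk hs.
have hs' : indices (sort leq s) by rewrite (indices_perm (perm_sortl s)).
have [] := h (sort leq s) _ hs' (sorted_sort s); first by rewrite size_sort.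
rewrite mean_prodE// abse_EFin lee_fin (mean_prod_perm (perm_sortl s)) => hb _ _.
by rewrite /gap_sum sk.
Qed.

(** The sum over the distances of consecutive pairs replaces the power to the smallest
distance: unlike a minimum it can be summed over walks term by term. *)
Lemma mean_prod_pairs k : (0 < k)%N -> ~~ odd k -> exists C b : R,
  [/\ 0 < C, 0 <= b < 1 & forall s, size s = k -> indices s -> gap_sum s = 0%N ->
    `|m s - 1| <= C * \sum_(j < k./2.-1) b ^+ (gap_sum s +
      (nth 0 (sort leq s) j.*2.+2 - nth 0 (sort leq s) j.*2))%N].
Proof.
move=> k0 ek; have [C [b [C0 b01 h]]] := m3 k0 ek; have b0 : 0 <= b by case/andP: b01.
exists C, b; split => // s sk hs g0.
set t := sort leq s; have st : size t = k by rewrite size_sort.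
have ht : indices t by rewrite (indices_perm (perm_sortl s)).
have tt : forall j, (j < k./2)%N -> nth 0%N t j.*2.+1 = nth 0%N t j.*2.
  move=> j jk; have := g0; rewrite /gap_sum sk => /eqP.
  rewrite sum_nat_eq0 => /forallP/(_ (Ordinal jk))/= /eqP dj.
  have : (nth 0 t j.*2 <= nth 0 t j.*2.+1)%N.
    have jk1 : (j.*2.+1 < k)%N by clear -jk; lia.
    apply: (sorted_leq_nth leq_trans leqnn); rewrite ?inE ?st ?(ltnW jk1)//.
    exact: sorted_sort.
  rewrite -/t in dj; clear -dj; lia.
have prodE w : prod_rv Z t w = \prod_(j < k./2) Z (nth 0%N t j.*2) w ^+ 2.
  rewrite /prod_rv (big_nth 0%N) st.
  have -> : k = k./2.*2 by rewrite -[LHS]odd_double_half (negbTE ek).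
  rewrite doubleK; have gen n : (n <= k./2)%N ->
      \prod_(0 <= i < n.*2) Z (nth 0%N t i) w =
      \prod_(j < n) Z (nth 0%N t j.*2) w ^+ 2.
    elim: n => [|n IH] nk; first by rewrite big_nil big_ord0.
    rewrite doubleS big_nat_recr//= big_nat_recr//= big_ord_recr/=.
    by rewrite IH ?(ltnW nk)// tt// -mulrA expr2.
  exact: gen.
rewrite -(mean_prod_perm (perm_sortl s)) -/t.
have [k2|k2] := leqP k 2.
  have kE : k = 2%N by case: k k0 ek k2 {h sk st tt prodE} => [|[|[]]].
  have -> : m t = 1.
    rewrite /mean_prod (_ : prod_rv Z t = (fun w => Z (nth 0%N t 0) w ^+ 2)).
      by rewrite m1//; have /allP := ht; apply; rewrite mem_nth// st kE.
    by apply/funext => w; rewrite prodE kE/= big_ord1.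
  by rewrite subrr normr0 mulr_ge0 ?sumr_ge0 ?ltW// => j _; rewrite exprn_ge0.
have [_ _ /(_ k2)] := h t st ht (sorted_sort s).
rewrite (_ : (fun w => _) = prod_rv Z t); last by apply/funext => w; rewrite prodE.
rewrite mean_prodE// -EFinB abse_EFin lee_fin => /le_trans; apply.
apply: ler_wpM2l; first exact: ltW.
set q := [seq _ | _ <- _].
have : min_seq q \in q.
  by apply: min_seq_mem; rewrite -size_eq0 size_map size_iota; lia.
move=> /mapP[j]; rewrite mem_iota/= => jk qE.
have {}jk : (j < k./2.-1)%N by lia.
rewrite qE (bigD1 (Ordinal jk))//= g0 add0n lerDl.
by apply: sumr_ge0 => i _; rewrite exprn_ge0.
Qed.

Let cat_bound k : (0 < k)%N -> exists C b : R,
  [/\ 0 < C, 0 <= b < 1 & forall s t, size s = k -> size t = k ->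
    indices s -> indices t -> `|m (s ++ t)| <= C * b ^+ gap_sum (s ++ t)].
Proof.
move=> k0; have kk0 : (0 < k + k)%N by rewrite addn_gt0 k0.
have ekk : ~~ odd (k + k) by rewrite addnn odd_double.
have [C [b [C0 b01 h]]] := mean_prod_bound kk0 ekk.
exists C, b; split => // s t sk tk hs ht; apply: h; first by rewrite size_cat sk tk.
by rewrite /indices all_cat; apply/andP.
Qed.

(** Each covariance has two bounds, by the gaps of the concatenation and by the distance
of the two lists; their geometric mean decays in both. For lists of even size the
second bound is an assumption on the process; for odd size the means vanish and the
pairing of the concatenation contains a link between the lists. *)
Lemma mean_prod_cov k : (0 < k)%N -> exists C b : R,
  [/\ 0 < C, 0 <= b < 1 & forall s t, size s = k -> size t = k ->
    indices s -> indices t ->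
    `|m (s ++ t) - m s * m t| <= C * \sum_(l < k) \sum_(l' < k)
      b ^+ (gap_sum (s ++ t) + ((nth 0 s l - nth 0 t l') + (nth 0 t l' - nth 0 s l)))%N].
Proof.
move=> k0; have [C2 [b2 [C20 b201 h2]]] := cat_bound k0.
have b20 : 0 <= b2 by case/andP: b201.
pose dist (s t : seq nat) l l' := ((nth 0 s l - nth 0 t l') + (nth 0 t l' - nth 0 s l))%N.
(* it suffices to bound by one term of the double sum *)
suff [C [b [C0 b01 h]]] : exists C b : R, [/\ 0 < C, 0 <= b < 1 &
    forall s t, size s = k -> size t = k -> indices s -> indices t ->
    exists l l', [/\ (l < k)%N, (l' < k)%N &
      `|m (s ++ t) - m s * m t| <= C * b ^+ (gap_sum (s ++ t) + dist s t l l')%N]].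
  have b0 : 0 <= b by case/andP: b01.
  exists C, b; split => // s t sk tk hs ht.
  have [l [l' [lk l'k]]] := h s t sk tk hs ht; move/le_trans; apply.
  apply: ler_wpM2l; first exact: ltW.
  rewrite (bigD1 (Ordinal lk))//= (bigD1 (Ordinal l'k))//= -addrA lerDl.
  rewrite addr_ge0// ?sumr_ge0// => i _; rewrite ?sumr_ge0// ?exprn_ge0// => j _.
  by rewrite exprn_ge0.
have [ok|ek] := boolP (odd k).
  have [g01 gE] := sqrt_lt1 b201; have [g0 g1] := andP g01.
  exists C2, (Num.sqrt b2); split => // s t sk tk hs ht.
  have [l [l' [lk l'k le]]] := odd_cat_link ok sk tk.
  exists l, l'; split => //.
  rewrite (mean_prod_odd hs) ?sk// mul0r subr0.
  apply: le_trans (h2 s t sk tk hs ht) _; apply: ler_wpM2l; first exact: ltW.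
  rewrite -[X in X ^+ gap_sum _]gE -exprM; apply: ler_wiXn2l; rewrite ?(ltW g1)//.
  by rewrite mul2n -addnn leq_add2l.
have [C1 [b1 [C10 b101 h1]]] := mean_prod_bound k0 ek.
have b10 : 0 <= b1 by case/andP: b101.
have [C3 [b3 [C30 b301 h3]]] := m3 k0 ek.
have b30 : 0 <= b3 by case/andP: b301.
pose B := Num.max b3 (Num.max b1 b2).
have B01 : 0 <= B < 1.
  rewrite /B le_max b30 /= !gt_max.
  by case/andP: b101 => _ ->; case/andP: b201 => _ ->; case/andP: b301 => _ ->.
have [B0 B1] := andP B01.
pose C := C3 + (C2 + C1 ^+ 2).
have C0 : 0 < C by rewrite !addr_gt0// exprn_gt0.
have [g01 gE] := sqrt_lt1 B01; have [g0 g1] := andP g01.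
exists C, (Num.sqrt B); split => // s t sk tk hs ht.
have hs' : indices (sort leq s) by rewrite (indices_perm (perm_sortl s)).
have ht' : indices (sort leq t) by rewrite (indices_perm (perm_sortl t)).
have [_ /(_ (sort leq t)) + _] :=
  h3 (sort leq s) (etrans (size_sort _ _) sk) hs' (sorted_sort s).
move=> /(_ (etrans (size_sort _ _) tk) ht' (sorted_sort t)).
have hst : indices (sort leq s ++ sort leq t) by rewrite /indices all_cat; apply/andP.
rewrite !mean_prodE// -EFinM -EFinB abse_EFin lee_fin.
have -> : m (sort leq s ++ sort leq t) = m (s ++ t).
  by apply: mean_prod_perm; apply: perm_cat.
rewrite !(mean_prod_perm (perm_sortl _)).
set q := [seq _ | _ <- _, _ <- _].
have : min_seq q \in q.
  apply: min_seq_mem; rewrite -size_eq0 size_allpairs !size_sort sk tk muln_eq0.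
  by rewrite -lt0n k0 || rewrite negb_or -!lt0n k0.
move=> /allpairsP[[a c] [/= + + qE]]; rewrite !mem_sort.
move=> /(nthP 0%N)[l ls la] /(nthP 0%N)[l' lt lc].
rewrite {}qE absdiffE -la -lc => hd.
exists l, l'; split; [by rewrite -sk|by rewrite -tk|].
set D := (gap_sum (s ++ t) + _)%N; set dd := dist s t l l' in D *.
have hg : `|m (s ++ t) - m s * m t| <= C * B ^+ gap_sum (s ++ t).
  apply: le_trans (ler_normB _ _) _; rewrite normrM.
  have le2 : `|m (s ++ t)| <= C2 * B ^+ gap_sum (s ++ t).
    apply: le_trans (h2 s t sk tk hs ht) _; apply: ler_wpM2l; first exact: ltW.
    by apply: lerXn2r; rewrite ?nnegrE// /B !le_max lexx !orbT.
  have le1 u : size u = k -> indices u -> `|m u| <= C1 * B ^+ gap_sum u.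
    move=> uk hu; apply: le_trans (h1 u uk hu) _; apply: ler_wpM2l; first exact: ltW.
    by apply: lerXn2r; rewrite ?nnegrE// /B !le_max lexx !orbT.
  have le3 : `|m s| * `|m t| <= C1 ^+ 2 * B ^+ gap_sum (s ++ t).
    apply: (@le_trans _ _ ((C1 * B ^+ gap_sum s) * (C1 * B ^+ gap_sum t))).
      by apply: ler_pM => //; exact: le1.
    rewrite mulrACA -expr2 -exprD; apply: ler_wpM2l; first by rewrite exprn_ge0// ltW.
    by apply: ler_wiXn2l; rewrite ?(ltW B1)// gap_sum_cat ?sk ?tk.
  have le4 : 0 <= C3 * B ^+ gap_sum (s ++ t) by rewrite mulr_ge0 ?exprn_ge0// ltW.
  by rewrite /C !mulrDl; lra.
have hd' : `|m (s ++ t) - m s * m t| <= C * B ^+ dd.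
  apply: le_trans hd _; apply: ler_pM; rewrite ?exprn_ge0 ?(ltW C30)//.
    by rewrite /C lerDl addr_ge0 ?sqr_ge0// ltW.
  by apply: lerXn2r; rewrite ?nnegrE// /B le_max lexx.
(* geometric mean of the two bounds *)
have [le|gt] := leqP dd (gap_sum (s ++ t)).
  apply: le_trans hg _; apply: ler_wpM2l; first exact: ltW.
  rewrite -[X in X ^+ gap_sum _]gE -exprM; apply: ler_wiXn2l; rewrite ?(ltW g1)//.
  by rewrite mul2n -addnn leq_add2l.
apply: le_trans hd' _; apply: ler_wpM2l; first exact: ltW.
rewrite -[X in X ^+ dd]gE -exprM; apply: ler_wiXn2l; rewrite ?(ltW g1)//.
by rewrite mul2n -addnn leq_add2r ltnW.
Qed.

Let indices_edges N k (p : walk N k) : indices (edges (@edge_index N) p).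
Proof.
apply/allP => i /(nthP 0%N)[l]; rewrite size_edges => lk <-.
by rewrite nth_edges// edge_index_gt0.
Qed.

Section SecondMoment.
Variables (N k : nat).
Hypothesis N0 : (0 < N)%N.
Local Notation e := (@edge_index N).
Let r : R := N%:R^-1 * (Num.sqrt N%:R)^-1 ^+ k.
Let c : R := (dyck k 0)%:R.

Lemma mean_linear (I : finType) (a : I -> R) (s : I -> seq nat) :
  (forall i, indices (s i)) ->
  (\int[P]_w (\sum_i a i * prod_rv Z (s i) w)%:E = (\sum_i a i * m (s i))%:E)%E.
Proof.
move=> hs.
have int i : P.-integrable setT (fun w => (a i * prod_rv Z (s i) w)%:E).
  apply: (eq_integrable _ (fun w => (a i)%:E * (prod_rv Z (s i) w)%:E)%E) => //.
  by apply: integrableZl => //; exact: mex.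
under eq_integral do rewrite -sumEFin.
rewrite integral_sum// -sumEFin; apply: eq_bigr => i _.
under eq_integral do rewrite EFinM.
rewrite integralZl//; last exact: mex.
by rewrite EFinM -mean_prodE// unlock.
Qed.

(* The constant [c] is treated as one more word, the empty one, so that the deviation
is a linear combination of products of the process. *)
Let coef (o : walk N k + unit) : R :=
  match o with inl p => if closed p then r else 0 | inr _ => - c end.
Let word (o : walk N k + unit) : seq nat :=
  match o with inl p => edges e p | inr _ => [::] end.

Let deviationE w :
  trace_moment (rescaled_mx N (diagonal_filling N) (fun n => Z n w)) k - c =
  \sum_o coef o * prod_rv Z (word o) w.
Proof.
rewrite trace_moment_walks big_sumType/=; congr (_ + _).
  rewrite mulr_sumr big_mkcond/=; apply: eq_bigr => p _.
  by case: ifP => _; rewrite ?mul0r.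
by rewrite (big_pred1 tt)/= ?/prod_rv ?big_nil ?mulr1// => -[].
Qed.

(** The bias-variance decomposition; the empty word has covariance 0 with all others. *)
Lemma deviation_square :
  (\int[P]_w ((trace_moment (rescaled_mx N (diagonal_filling N) (fun n => Z n w)) k
     - c) ^+ 2)%:E =
   (r ^+ 2 * (\sum_(p : walk N k | closed p) \sum_(q : walk N k | closed q)
      (m (edges e p ++ edges e q) - m (edges e p) * m (edges e q))) +
    (r * (\sum_(p : walk N k | closed p) m (edges e p)) - c) ^+ 2)%:E)%E.
Proof.
have iw o : indices (word o) by case: o => [p|[]]//; exact: indices_edges.
transitivity (\int[P]_w (\sum_(oo : (walk N k + unit) * (walk N k + unit))
    coef oo.1 * coef oo.2 * prod_rv Z (word oo.1 ++ word oo.2) w)%:E)%E.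
  apply: eq_integral => w _; rewrite deviationE expr2 big_distrlr/= pair_big/=.
  congr EFin; apply: eq_bigr => -[u u'] _ /=.
  by rewrite /prod_rv big_cat/= mulrACA.
rewrite mean_linear; last by move=> [u u']; rewrite /indices all_cat; apply/andP.
congr EFin.
transitivity (\sum_(oo : (walk N k + unit) * (walk N k + unit))
    (coef oo.1 * coef oo.2 * (m (word oo.1 ++ word oo.2) - m (word oo.1) * m (word oo.2))
    + (coef oo.1 * m (word oo.1)) * (coef oo.2 * m (word oo.2)))).
  by apply: eq_bigr => oo _; ring.
rewrite big_split/=; congr (_ + _).
  rewrite -(pair_bigA _ (fun o o' => coef o * coef o' *
    (m (word o ++ word o') - m (word o) * m (word o'))))/=.
  rewrite big_sumType/= [X in _ + X]big1 ?addr0; last first.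
    move=> u _; apply: big1 => o _.
    by rewrite mean_prod_nil mul1r subrr mulr0.
  rewrite mulr_sumr [RHS]big_mkcond/=; apply: eq_bigr => p _.
  rewrite big_sumType/= [X in _ + X]big1 ?addr0; last first.
    by move=> u _; rewrite cats0 mean_prod_nil mulr1 subrr mulr0.
  case: ifP => _; last by rewrite big1// => q _; rewrite !mul0r.
  rewrite mulr_sumr [RHS]big_mkcond/=; apply: eq_bigr => q _.
  by case: ifP => _; rewrite ?expr2// mulr0 mul0r.
rewrite -(pair_bigA _ (fun o o' => (coef o * m (word o)) * (coef o' * m (word o'))))/=.
rewrite -big_distrlr/= -expr2; congr (_ ^+ 2).
rewrite big_sumType/=; congr (_ + _).
  rewrite mulr_sumr [RHS]big_mkcond/=; apply: eq_bigr => p _.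
  by case: ifP => _; rewrite ?mul0r.
by rewrite (big_pred1 tt)/= ?mean_prod_nil ?mulr1// => -[].
Qed.

End SecondMoment.

Let sqrtV_exp N k : (0 < N)%N ->
  (N%:R^-1 * (Num.sqrt N%:R)^-1 ^+ k) ^+ 2 = (N%:R ^+ k.+2)^-1 :> R.
Proof.
move=> N0; rewrite exprMn -exprM mulnC exprM !exprVn sqr_sqrtr//.
by rewrite -invfM -exprD.
Qed.

(** The double sum over walks is at most of order [N ^ (k + 1)], the normalisation of order
[N ^ - (k + 2)]. *)
Lemma variance_bound k : (0 < k)%N -> exists K : R, 0 <= K /\ forall N, (0 < N)%N ->
  (N%:R^-1 * (Num.sqrt N%:R)^-1 ^+ k) ^+ 2 *
  (\sum_(p : walk N k | closed p) \sum_(q : walk N k | closed q)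
      (m (edges (@edge_index N) p ++ edges (@edge_index N) q) -
       m (edges (@edge_index N) p) * m (edges (@edge_index N) q))) <= K / N%:R.
Proof.
move=> k0; have [C [b [C0 b01 hcov]]] := mean_prod_cov k0.
have b0 : 0 <= b by case/andP: b01.
pose A : R := ((k + k)`! * (2 * (2 ^ k * 2 ^ k)))%:R * (1 - b)^-1 ^+ k.+1.
have A0 : 0 <= A.
  rewrite mulr_ge0// exprn_ge0// invr_ge0 subr_ge0 ltW//; by case/andP: b01.
exists (C * (\sum_(l < k) \sum_(l' < k) A)); split.
  by rewrite mulr_ge0 ?(ltW C0)// sumr_ge0// => l _; rewrite sumr_ge0.
move=> N N0; have Nn0 : N%:R != 0 :> R by rewrite pnatr_eq0 -lt0n.
pose e := @edge_index N.
pose G (l l' : nat) (pq : walk N k * walk N k) := b ^+ (gap_sum (edges e pq.1 ++ edges e pq.2) +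
  ((nth 0 (edges e pq.1) l - nth 0 (edges e pq.2) l') +
   (nth 0 (edges e pq.2) l' - nth 0 (edges e pq.1) l)))%N.
have le : \sum_(p : walk N k | closed p) \sum_(q : walk N k | closed q)
      (m (edges e p ++ edges e q) - m (edges e p) * m (edges e q)) <=
    C * (\sum_(l < k) \sum_(l' < k) A) * N%:R ^+ k.+1.
  rewrite pair_big_dep/=.
  apply: (@le_trans _ _ (\sum_(pq : walk N k * walk N k)
      C * \sum_(l < k) \sum_(l' < k) G l l' pq)).
    rewrite big_mkcond/=; apply: ler_sum => -[p q] _ /=.
    have ge0 : 0 <= C * \sum_(l < k) \sum_(l' < k) G l l' (p, q).
      rewrite mulr_ge0 ?(ltW C0)// sumr_ge0// => l _; rewrite sumr_ge0// => l' _.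
      by rewrite exprn_ge0.
    case: ifP => // _; apply: le_trans (ler_norm _) _.
    by apply: hcov; rewrite ?size_edges//; exact: indices_edges.
  rewrite -mulr_sumr -mulrA; apply: ler_wpM2l; first exact: ltW.
  rewrite exchange_big/= mulr_suml; apply: ler_sum => l _.
  rewrite exchange_big/= mulr_suml; apply: ler_sum => l' _.
  exact: (sum_walk_pairs (@edge_index_inj N)).
rewrite sqrtV_exp//.
apply: (@le_trans _ _ ((N%:R ^+ k.+2)^-1 * (C * (\sum_(l < k) \sum_(l' < k) A) * N%:R ^+ k.+1))).
  by apply: ler_wpM2l => //; rewrite invr_ge0 exprn_ge0.
rewrite (exprS _ k.+1) le_eqVlt; apply/orP; left; apply/eqP; field.
by rewrite Nn0 expf_neq0.
Qed.

(** The walks that are not tree traversals contribute little because of their number,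
the tree traversals contribute 1 each up to an error that is small on average, and
their number is [dyck k 0] times a falling factorial of order [N ^ (k/2 + 1)]. *)
Lemma bias_bound k : (0 < k)%N -> exists K : R, 0 <= K /\ forall N, (0 < N)%N ->
  `|(N%:R^-1 * (Num.sqrt N%:R)^-1 ^+ k) *
    (\sum_(p : walk N k | closed p) m (edges (@edge_index N) p)) - (dyck k 0)%:R|
  <= K / N%:R.
Proof.
move=> k0; have [ok|ek] := boolP (odd k).
  exists 0; split => // N N0; rewrite mul0r big1 ?mulr0 ?sub0r ?normrN.
    by rewrite dyck_odd ?addn0// normr0.
  by move=> p _; rewrite mean_prod_odd ?size_edges//; exact: indices_edges.
have [C1 [b1 [C10 b101 h1]]] := mean_prod_bound k0 ek.
have [C2 [b2 [C20 b201 h2]]] := mean_prod_pairs k0 ek.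
have b10 : 0 <= b1 by case/andP: b101.
have b20 : 0 <= b2 by case/andP: b201.
pose A1 : R := (k`! * ((k * k + k * k + k) * (2 ^ k * 5)))%:R * (1 - b1)^-1 ^+ k./2.
pose A2 : R := (k`! * 2 ^ k)%:R * (1 - b2)^-1 ^+ k./2.+1.
have A10 : 0 <= A1.
  rewrite mulr_ge0// exprn_ge0// invr_ge0 subr_ge0 ltW//; by case/andP: b101.
have A20 : 0 <= A2.
  rewrite mulr_ge0// exprn_ge0// invr_ge0 subr_ge0 ltW//; by case/andP: b201.
pose K := C1 * A1 + C2 * (\sum_(j < k./2.-1) A2) + (dyck k 0)%:R * (k./2.+1 ^ 2)%:R.
have S20 : 0 <= \sum_(j < k./2.-1) A2 by rewrite sumr_ge0.
exists K; split; first by rewrite /K !addr_ge0// mulr_ge0// ltW.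
move=> N N0; have Nn0 : N%:R != 0 :> R by rewrite pnatr_eq0 -lt0n.
have Np : 0 < N%:R :> R by rewrite ltr0n.
pose e := @edge_index N; pose h := k./2.
have rE : N%:R^-1 * (Num.sqrt N%:R)^-1 ^+ k = (N%:R ^+ h.+1)^-1 :> R.
  have -> : k = (2 * h)%N by rewrite mul2n -[LHS]odd_double_half (negbTE ek).
  by rewrite exprM exprVn sqr_sqrtr// -exprVn exprS.
pose tree := (#|@tree_walk N k|)%:R : R.
have le1 : `|\sum_(p : walk N k | closed p) m (edges e p) - tree| <=
    (C1 * A1 + C2 * (\sum_(j < k./2.-1) A2)) * N%:R ^+ h.
  rewrite (bigID (@tree_walk N k))/=.
  have -> : \sum_(p : walk N k | closed p && tree_walk p) m (edges e p) =
      \sum_(p : walk N k | tree_walk p) m (edges e p).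
    by apply: eq_bigl => p; apply: andb_idl; exact: tree_walk_closed.
  rewrite addrAC /tree -sum1_card natr_sum -sumrB addrC mulrDl.
  apply: le_trans (ler_normD _ _) _; apply: lerD.
    apply: le_trans (ler_norm_sum _ _ _) _.
    apply: (@le_trans _ _ (C1 *
        \sum_(p : walk N k | closed p && ~~ tree_walk p) b1 ^+ gap_sum (edges e p))).
      rewrite mulr_sumr; apply: ler_sum => p _.
      by apply: h1; rewrite ?size_edges//; exact: indices_edges.
    rewrite -mulrA; apply: ler_wpM2l; first exact: ltW.
    apply: (@sum_not_tree_walk R 4 N e (@edge_index_inj N)) => //.
    exact: card_edge_index_dist.
  apply: le_trans (ler_norm_sum _ _ _) _.
  pose G j (p : walk N k) := b2 ^+ (gap_sum (edges e p) +
     (nth 0%N (sort leq (edges e p)) j.*2.+2 -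
      nth 0%N (sort leq (edges e p)) j.*2))%N.
  apply: (@le_trans _ _ (\sum_(p : walk N k) C2 * \sum_(j < k./2.-1) G j p)).
    rewrite big_mkcond/=; apply: ler_sum => p _.
    have ge0 : 0 <= C2 * \sum_(j < k./2.-1) G j p.
      by rewrite mulr_ge0 ?(ltW C20)// sumr_ge0// => j _; rewrite exprn_ge0.
    case: ifP => // tp; apply: (h2 (edges e p) (size_edges e p) (indices_edges p)).
    exact: (tree_walk_gap_sum (@edge_indexC N)).
  rewrite -mulr_sumr -mulrA; apply: ler_wpM2l; first exact: ltW.
  rewrite exchange_big/= mulr_suml; apply: ler_sum => j _.
  apply: (sum_walk_close_pairs (@edge_index_inj N)) => //.
  by have := ltn_ord j; lia.
have le2 : `|tree - (dyck k 0)%:R * N%:R ^+ h.+1| <=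
    (dyck k 0)%:R * (h.+1 ^ 2)%:R * N%:R ^+ h.
  rewrite /tree card_tree_walk natrM -mulrBr normrM normr_nat -mulrA.
  apply: ler_wpM2l => //; rewrite -!natrX -natrM.
  have ge := ffact_ge N h; have leN := ffact_le_exp N h.+1.
  by rewrite distrC ger0_norm ?subr_ge0 ?ler_nat// lerBlDl -natrD ler_nat.
rewrite rE.
have -> : (N%:R ^+ h.+1)^-1 * (\sum_(p : walk N k | closed p) m (edges e p)) - (dyck k 0)%:R =
    (N%:R ^+ h.+1)^-1 * ((\sum_(p : walk N k | closed p) m (edges e p) - tree) +
      (tree - (dyck k 0)%:R * N%:R ^+ h.+1)).
  by field; rewrite expf_neq0.
rewrite normrM ger0_norm ?invr_ge0 ?exprn_ge0//.
apply: (@le_trans _ _ ((N%:R ^+ h.+1)^-1 * (K * N%:R ^+ h))).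
  apply: ler_wpM2l; first by rewrite invr_ge0 exprn_ge0.
  by apply: le_trans (ler_normD _ _) _; rewrite /K mulrDl; exact: lerD.
rewrite exprS le_eqVlt; apply/orP; left; apply/eqP; field.
by rewrite Nn0 expf_neq0.
Qed.
Local Notation Y N w k :=
  (trace_moment (rescaled_mx N (diagonal_filling N) (fun n => Z n w)) k).

Lemma second_moment_bound k : exists K : R, 0 <= K /\ forall N, (0 < N)%N ->
  (\int[P]_w ((Y N w k - (dyck k 0)%:R) ^+ 2)%:E <= (K / N%:R)%:E)%E.
Proof.
have [->|k0] := posnP k.
  exists 0; split => // N N0.
  rewrite (eq_integral (cst 0%E)); first by rewrite integral_cst// mul0e mul0r.
  move=> w _; rewrite /trace_moment expr0 mxtrace1 mulVf ?subrr ?expr0n//.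
  by rewrite pnatr_eq0 -lt0n.
have [K1 [K10 h1]] := variance_bound k0.
have [K2 [K20 h2]] := bias_bound k0.
exists (K1 + K2 ^+ 2); split; first by rewrite addr_ge0// sqr_ge0.
move=> N N0; have Np : 1 <= N%:R :> R by rewrite ler1n.
rewrite deviation_square lee_fin mulrDl; apply: lerD; first exact: h1.
rewrite -(real_normK (num_real (_ - _))).
apply: (@le_trans _ _ ((K2 / N%:R) ^+ 2)).
  by rewrite ler_sqr ?nnegrE ?divr_ge0//; exact: h2.
rewrite expr_div_n; apply: ler_wpM2l; first exact: sqr_ge0.
by rewrite lef_pV2 ?posrE ?exprn_gt0 ?ltr0n// expr2 ler_peMl// ler0n.
Qed.

Let measurable_entry N i j :
  measurable_fun setT (fun w => rescaled_mx N (diagonal_filling N) (fun n => Z n w) i j).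
Proof.
rewrite (_ : (fun w => _) = (fun w => (Num.sqrt N%:R)^-1 * Z (edge_index i j) w)).
  by apply: measurable_funM => //; exact: measurable_funPT.
by apply/funext => w; rewrite !mxE.
Qed.

Let measurable_Y N k : measurable_fun setT (fun w => Y N w k).
Proof. by apply: measurable_trace_moment => i j; exact: measurable_entry. Qed.

(** Chebyshev's inequality: the second moment of the deviation is of order 1/N. *)
Lemma trace_moment_tail k (eta : R) : 0 < eta ->
  exists K : R, forall N, (0 < N)%N ->
  measurable [set w | eta < `|Y N w k - (dyck k 0)%:R|] /\
  (P [set w | (eta < `|Y N w k - (dyck k 0)%:R|)%R] <= (K / N%:R)%:E)%E.
Proof.
move=> eta0; have [K [K0 h]] := second_moment_bound k.
exists (K / eta ^+ 2) => N N0; set A := [set w | _].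
have mdev : measurable_fun setT (fun w => Y N w k - (dyck k 0)%:R).
  by apply: measurable_funB => //; exact: measurable_Y.
have mA : measurable A.
  have mf : measurable_fun setT (fun w => (`|Y N w k - (dyck k 0)%:R|)%:E).
    by apply/measurable_EFinP; exact: measurableT_comp.
  by have := emeasurable_fun_o_infty measurableT mf eta%:E; rewrite setTI.
split => //.
have le : ((eta ^+ 2)%:E * P A <= (K / N%:R)%:E)%E.
  apply: le_trans (h N N0).
  rewrite -[A in P A]setIT -integral_indic// -ge0_integralZl//; last 2 first.
  - by apply/measurable_EFinP; exact: measurable_indic.
  - by rewrite lee_fin sqr_ge0.
  apply: ge0_le_integral => //.
  - by move=> w _; rewrite -EFinM lee_fin mulr_ge0 ?sqr_ge0.
  - apply/measurable_EFinP; apply: measurable_funM => //; exact: measurable_indic.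
  - by apply/measurable_EFinP; exact: measurable_funX.
  move=> w _; rewrite -EFinM lee_fin indicE; case: (boolP (w \in A)) => [|_].
    rewrite inE /A/= mulr1 => /ltW wA.
    by rewrite -(real_normK (num_real (_ - _))) ler_sqr ?nnegrE// ltW.
  by rewrite mulr0 sqr_ge0.
have fP : P A \is a fin_num by exact: fin_num_measure.
move: le; rewrite -(fineK fP) -EFinM !lee_fin => le.
by rewrite mulrAC ler_pdivlMr ?exprn_gt0// mulrC.
Qed.

(** The empirical measures are close to the semicircle law as soon as finitely many
trace moments are close to the Dyck numbers. *)
Lemma esd_cvg_semicircle : weakly_cvg_in_probability P
  (fun N w => esd (rescaled_mx N (diagonal_filling N) (fun n => Z n w)))
  semicircle_law.
Proof.
move=> f cf [M [_ /(_ (M + 1))]]; rewrite ltrDl ltr01 => /(_ isT) fM e e0.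
have {}fM x : `|f x| <= M + 1 by exact: fM.
have [J [eta [eta0 close]]] := esd_close cf fM (divr_gt0 e0 (ltr0n R 5)).
have e5 : 5 * (e / 5) = e by field.
rewrite {}e5 in close.
have [K hK] := choice (fun j => trace_moment_tail j eta0).
set c := (\int[semicircle_law]_x (f x)%:E)%E in close *.
pose E N := [set w | (e%:E < `| \int[esd (rescaled_mx N (diagonal_filling N)
  (fun n => Z n w))]_x (f x)%:E - c |)%E].
change (P (E N) @[N --> \oo] --> 0%E).
pose D N j := [set w | eta < `|Y N w j - (dyck j 0)%:R|].
have bound N : (0 < N)%N -> (P (E N) <= (((\sum_(j < J) K j) / N%:R)%:E))%E.
  move=> N0.
  have mD j : measurable (D N j) by have [] := hK j N N0.
  apply: (@le_trans _ _ (P (\big[setU/set0]_(j < J) D N j))).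
    apply: le_measure; rewrite ?inE.
    - have mf : measurable_fun setT (fun w =>
          `| \int[esd (rescaled_mx N (diagonal_filling N) (fun n => Z n w))]_x (f x)%:E
            - c |%E).
        apply: measurableT_comp => //; apply: emeasurable_funB => //.
        apply: (measurable_esd_integral _ _ cf fM) => [i j|w].
          exact: measurable_entry.
        exact: rescaled_mx_sym.
      by have := emeasurable_fun_o_infty measurableT mf e%:E; rewrite setTI.
    - exact: bigsetU_measurable.
    move=> w Ew; apply: contrapT => nD.
    move: Ew; rewrite /E/=; apply/negP; rewrite -leNgt; apply: close => // [|j jJ].
      exact: rescaled_mx_sym.
    rewrite leNgt; apply/negP => Dj; apply: nD.
    by rewrite -bigcup_mkord; exists j.
  apply: le_trans (Boole_inequality _ _) _ => //.
  rewrite mulr_suml -sumEFin; apply: lee_sum => j _.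
  by have [] := hK j N N0.
apply: (@squeeze_cvge _ _ _ _ (cst 0%E) _ (fun N => ((\sum_(j < J) K j) / N%:R)%:E)).
- near=> N; rewrite measure_ge0/=; apply: bound; near: N; exact: nbhs_infty_gt.
- exact: cvg_cst.
apply: cvg_EFin; first by near=> N.
rewrite -cvg_shiftS; have := cvgMl_tmp (a := \sum_(j < J) K j) (@cvg_harmonic R).
by rewrite mulr0; apply.
Unshelve. all: by end_near.
Qed.

End ProcessMoments.

Theorem lemma3p7 (R : realType) :
  [/\ (forall N : nat,
         set_bij [set n : nat | (1 <= n <= (N * N.+1)./2)%N]
                 [set p : nat * nat | upper_triangle N p]
                 (diagonal_filling N) /\
         (forall j k : nat, (1 <= j)%N -> (j <= k)%N -> (k <= N)%N ->
            filling_inv N (diagonal_filling N) (j, k) = diagonal_index N j k)),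
      (forall N i j n : nat,
         (1 <= i <= N)%N -> (1 <= j <= N)%N -> (0 < n)%N ->
         (num_at_dist N (diagonal_filling N) i j n <= 4)%N),
      (forall n : nat, (1 <= n)%N ->
       forall e : R, 0 < e ->
       \forall N \near \oo, forall i j : nat,
         (1 <= i <= N)%N -> (1 <= j <= N)%N ->
         (num_at_dist N (diagonal_filling N) i j n)%:R <= e * N%:R) &
      (forall (d : measure_display) (T : measurableType d)
              (P : probability T R) (Z : nat -> {RV P >-> R}),
         moments_exist Z -> moment_M1 Z -> moment_M2 Z -> moment_M3 Z ->
         weakly_cvg_in_probability P
           (fun N w => esd (rescaled_mx N (diagonal_filling N) (fun n => Z n w)))
           semicircle_law)].
Proof.
split => [N|||d T P Z].
- split; first exact: diagonal_filling_bij.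
  exact: filling_inv_diagonal_index.
- exact: num_at_dist_diagonal_le4.
- move=> n n0 e e0; near=> N => i j iN jN.
  apply: (@le_trans _ _ 4); first by rewrite ler_nat num_at_dist_diagonal_le4.
  rewrite -ler_pdivrMl// mulrC; near: N; exact: nbhs_infty_ger.
- exact: esd_cvg_semicircle.
Unshelve. all: by end_near.
Qed.
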